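(* Let $n\in\mathbb N$, let $p_0$ be nonzero a.e. with $p_0,1/p_0\in L(0,1)$, let $b$ be measurable with $b^2=p_0$, and let $p_k\in W_{2,1/b}^{-k}$, $k=\overline{1,n}$, $q_\nu\in W_{2,1/b}^{-\nu}$, $\nu=\overline{0,n-1}$. For $y\in W_{2,b}^n$ consider $$\ell_{2n}y:=\sum_{k=0}^n\big(p_ky^{(n-k)}\big)^{(n-k)}+i\sum_{k=0}^{n-1}\Big(\big(q_ky^{(n-k-1)}\big)^{(n-k)}+\big(q_ky^{(n-k)}\big)^{(n-k-1)}\Big),$$ a functional on $\mathring W_{2,b}^n$. Then $$\ell_{2n}y=\frac{d^n}{dx^n}\Big(By^{(n)}+Cy\Big),\ \text{i.e. } (\ell_{2n}y,\varphi)=(-1)^n\int_0^1\big(By^{(n)}+Cy\big)\varphi^{(n)}dx\ \ \forall\varphi\in\mathring W^n_{2,b},$$ where $B$ maps $L_{2,b}$ bijectively onto $L_{2,1/b}$, $$Bf(x)=b^2(x)f(x)+\int_0^xK(x,t)f(t)\,dt,\qquad |K(x,t)|\le a(x)+a(t)\ \text{ with some } a\in L_{2,1/b},$$ $$Cy=\sum_{\nu=0}^{n-1}y^{(\nu)}(0)u_\nu(x),\quad u_\nu\in L_{2,1/b},$$ and $$K(x,t)=\sum_{k=1}^n\Bigg(\frac{(x-t)^{k-1}}{(k-1)!}\Big(P_k(x)+iQ_{k-1}(x)+(-1)^k\big(P_k(t)-iQ_{k-1}(t)\big)\Big)$$ $$+\sum_{\nu=1}^{k-1}(-1)^\nu\int_t^x\frac{(x-\tau)^{\nu-1}}{(\nu-1)!}\Big(\tbinom{k}{\nu}P_k(\tau)+i\big(\tbinom{k-1}{\nu}-\tbinom{k-1}{\nu-1}\big)Q_{k-1}(\tau)\Big)\frac{(\tau-t)^{k-1-\nu}}{(k-1-\nu)!}\,d\tau\Bigg),$$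 where $P_k,Q_{k-1}\in L_{2,1/b}$ are any functions with $P_k^{(k)}=p_k$, $Q_{k-1}^{(k-1)}=q_{k-1}$ (generalized derivatives), $k=\overline{1,n}$ ($Q_0=q_0$); $K$ does not depend on the choice of these primitives.
   Context: With $p=2$: $L_{2,b}$ is the space of measurable $f$ with $bf\in L_2(0,1)$, $L_{2,1/b}$ those $\sigma$ with $\sigma/b\in L_2(0,1)$. $W_{2,b}^k$: $g$ with $g,\dots,g^{(k-1)}\in AC[0,1]$, $g^{(k)}\in L_{2,b}$; $\mathring W_{2,b}^k$: those with $g^{(\nu)}(0)=g^{(\nu)}(1)=0$, $\nu<k$. $W_{2,1/b}^{-k}$ is the set of functionals $f$ on $\mathring W_{2,b}^k$ of the form $(f,\varphi)=(-1)^k\int_0^1\sigma\varphi^{(k)}dx$ with $\sigma\in L_{2,1/b}$; we write $f=\sigma^{(k)}$ (generalized derivative; for $k=0$, $f=\sigma$ is a function). Derivative of a functional: $(f',\varphi):=-(f,\varphi')$; product with a function $y\in W^k_{2,b}$: $(fy,\varphi):=(f,\varphi y)$. Each term of $\ell_{2n}y$ is thus a functional on some $\mathring W^j_{2,b}$, $j\le n$, regarded on $\mathring W^n_{2,b}$ by restriction. $\binom{k}{\nu}$ are binomial coefficients. *)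

(* Defs.v *)
From HB Require Import structures.
From mathcomp Require Import all_boot all_order all_algebra.
From mathcomp Require Import all_classical all_reals all_analysis.
From mathcomp Require Import complex.
Set Implicit Arguments. Unset Strict Implicit. Unset Printing Implicit Defensive.
Import Order.TTheory GRing.Theory Num.Theory.
Import numFieldNormedType.Exports.
Local Open Scope classical_set_scope.
Local Open Scope ring_scope.
Local Open Scope complex_scope.

Section Defs.
Variable R : realType.
Local Notation C := R[i].
Local Notation mu := (@lebesgue_measure R).

Definition I01 : set R := `[0%R, 1%R]%classic.

Definition cmeas (D : set R) (f : R -> C) :=
  measurable_fun D (fun x => complex.Re (f x)) /\ measurable_fun D (fun x => complex.Im (f x)).
Definition cintegrable (D : set R) (f : R -> C) :=
  mu.-integrable D (fun x => (complex.Re (f x))%:E) /\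
  mu.-integrable D (fun x => (complex.Im (f x))%:E).
Definition cint (D : set R) (f : R -> C) : C :=
  (\int[mu]_(x in D) complex.Re (f x))%:C + 'i * (\int[mu]_(x in D) complex.Im (f x))%:C.

Definition csq (z : C) : R := complex.Re z ^+ 2 + complex.Im z ^+ 2.
Definition cabs (z : C) : R := Num.sqrt (csq z).

Definition L2w (w f : R -> C) :=
  cmeas I01 f /\ mu.-integrable I01 (fun x => (csq (w x * f x))%:E).

Definition winv (b : R -> C) : R -> C := fun x => (b x)^-1.

Definition AC (a c : R) (g : R -> C) :=
  forall e : R, 0 < e -> exists2 d : R, 0 < d &
    forall (m : nat) (s t : 'I_m -> R),
      (forall i, a <= s i /\ s i <= t i /\ t i <= c) ->
      (forall i j, i != j -> t i <= s j \/ t j <= s i) ->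
      \sum_(i < m) (t i - s i) < d ->
      \sum_(i < m) cabs (g (t i) - g (s i)) < e.

Definition aederiv (g h : R -> C) :=
  {ae mu, forall x : R, `]0%R, 1%R[%classic x ->
     is_derive x (1 : R) (fun t => complex.Re (g t)) (complex.Re (h x)) /\
     is_derive x (1 : R) (fun t => complex.Im (g t)) (complex.Im (h x))}.

(* G = (g, g', ..., g^(k), ...) is a function g in W^k_{2,b} together with
   its derivatives: g,...,g^(k-1) in AC[0,1], G (nu+1) = (G nu)' a.e.,
   g^(k) in L_{2,b} *)
Definition Wfam (b : R -> C) (k : nat) (G : nat -> R -> C) :=
  (forall nu, (nu < k)%N -> AC 0 1 (G nu) /\ aederiv (G nu) (G nu.+1)) /\
  L2w b (G k).

Definition Wcirc (b : R -> C) (k : nat) (G : nat -> R -> C) :=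
  Wfam b k G /\ (forall nu, (nu < k)%N -> G nu 0 = 0 /\ G nu 1 = 0).

(* functionals, acting on (test) functions given with their derivatives *)
Definition Distr := (nat -> R -> C) -> C.

(* f = sigma^(k) in W^{-k}_{2,1/b}: (f, phi) = (-1)^k int_0^1 sigma phi^(k) *)
Definition Wneg (b : R -> C) (k : nat) (f : Distr) (sigma : R -> C) :=
  L2w (winv b) sigma /\
  forall Phi, Wcirc b k Phi ->
    f Phi = (-1) ^+ k * cint I01 (fun x => sigma x * Phi k x).

Definition dfun (f : R -> C) : Distr :=
  fun Phi => cint I01 (fun x => f x * Phi 0%N x).

Definition shift (m : nat) (G : nat -> R -> C) : nat -> R -> C :=
  fun j => G (m + j)%N.

Definition dderiv (F : Distr) : Distr := fun Phi => - F (shift 1 Phi).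
Definition diter (m : nat) (F : Distr) : Distr := iter m dderiv F.

Definition leib (Phi Y : nat -> R -> C) : nat -> R -> C :=
  fun j x => \sum_(i < j.+1) ('C(j, i))%:R * (Phi i x * Y (j - i)%N x).

Definition dmul (F : Distr) (Y : nat -> R -> C) : Distr :=
  fun Phi => F (leib Phi Y).

Definition pco (p0 : R -> C) (p : nat -> Distr) (k : nat) : Distr :=
  if k == 0%N then dfun p0 else p k.

Definition ell (n : nat) (p0 : R -> C) (p q : nat -> Distr)
    (Y Phi : nat -> R -> C) : C :=
  \sum_(k < n.+1) diter (n - k)%N (dmul (pco p0 p k) (shift (n - k)%N Y)) Phi
  + 'i * \sum_(k < n)
      (diter (n - k)%N (dmul (q k) (shift (n - k - 1)%N Y)) Phi
       + diter (n - k - 1)%N (dmul (q k) (shift (n - k)%N Y)) Phi).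

Definition primitives (b : R -> C) (n : nat) (p q : nat -> Distr)
    (P Q : nat -> R -> C) :=
  forall k, (1 <= k <= n)%N ->
    Wneg b k (p k) (P k) /\ Wneg b (k - 1)%N (q (k - 1)%N) (Q (k - 1)%N).

Definition rfact (m : nat) : R := (m`!)%:R.

Definition Kfun (n : nat) (P Q : nat -> R -> C) (x t : R) : C :=
  \sum_(1 <= k < n.+1)
    ( ((x - t) ^+ (k - 1)%N / rfact (k - 1)%N)%:C *
        (P k x + 'i * Q (k - 1)%N x
         + (-1) ^+ k * (P k t - 'i * Q (k - 1)%N t))
    + \sum_(1 <= nu < k) (-1) ^+ nu *
        cint `[t, x]%classic (fun tau =>
          ((x - tau) ^+ (nu - 1)%N / rfact (nu - 1)%N)%:C *
          (('C(k, nu))%:R * P k tau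
           + 'i * (('C((k - 1)%N, nu))%:R - ('C((k - 1)%N, (nu - 1)%N))%:R) * Q (k - 1)%N tau) *
          ((tau - t) ^+ (k - 1 - nu)%N / rfact (k - 1 - nu)%N)%:C)).

Definition Bop (b : R -> C) (K : R -> R -> C) (f : R -> C) (x : R) : C :=
  b x ^+ 2 * f x + cint `[0%R, x]%classic (fun t => K x t * f t).

Definition Cop (n : nat) (u : nat -> R -> C) (Y : nat -> R -> C) (x : R) : C :=
  \sum_(nu < n) Y nu 0 * u nu x.

End Defs.
Arguments I01 {R}.

(* Main.v *)
(* Write J f (x) = int_0^x f and let W be the coefficient of phi^(n-nu) y^(n-mu)
   after Leibniz' rule, nu + mu = k >= 1. Since phi vanishes to order n at both
   ends, integrating by parts nu times gives
     int W y^(n-mu) phi^(n-nu) = (-1)^nu int J^nu (W y^(n-mu)) phi^(n),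
   and y^(n-mu) is a Taylor polynomial at 0 plus J^mu y^(n). The polynomial part
   goes into C; the operator J^nu W J^mu is an integral operator whose kernel is
   obtained from Cauchy's formula for repeated integration.
   All kernels are separable: K(x,t) = sum_i A_i(x) B_i(t) with A_i, B_i in
   L_{2,1/b}, because (x-t)^m expands by the binomial formula. Fubini's theorem
   on the triangle t < x thus reduces to integration by parts for primitives of
   integrable functions.
   Bijectivity of B: the Volterra equation f = f_0 - b^-2 int_0^x K f is solved
   by a Neumann series which converges geometrically with respect to the weight
   |b|^-2 G exp(4 int_0^x |G/b|^2), where |K(x,t)| <= G(x) G(t).
   Independence of the primitives: two choices give the same functional, so the
   difference D of the kernels satisfies int H phi^(n) = 0 for all phi, where
   H(x) = int_0^x D(x,t) f(t) dt and f = 1_(r,1]. As H vanishes on [0,r], every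
   step function can be corrected there (Vandermonde) to become some phi^(n);
   hence H = 0 a.e. for all rational r, and D = 0 a.e. *)
Require Import Defs.
From HB Require Import structures.
From mathcomp Require Import all_boot all_order all_algebra.
From mathcomp Require Import all_classical all_reals all_analysis.
From mathcomp Require Import complex.
From mathcomp Require Import measurable_realfun ring lra zify.
Import Order.TTheory GRing.Theory Num.Theory.
Import numFieldNormedType.Exports.
Local Open Scope classical_set_scope.
Local Open Scope ring_scope.
Local Open Scope complex_scope.
Set Implicit Arguments. Unset Strict Implicit. Unset Printing Implicit Defensive.

(** * Absolutely continuous real functions *)

Section RealAC.
Variable R : realType.
Local Notation mu := (@lebesgue_measure R).
Implicit Types (g h f : R -> R) (U : set R) (e x y z : R).

(** Derivatives exist only almost everywhere, so integration by parts depends on one fact: an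
    absolutely continuous function whose derivative vanishes almost everywhere is constant. It gives
    the fundamental theorem of calculus for the epsilon-delta notion of absolute continuity. The
    second obstacle is integrability: W lies only in L_{2,1/b}, and y^(n), phi^(n) only in L_{2,b},
    so next to W at most one factor may be of top order. Every term with k >= 1 misses at least one
    derivative, which suffices; the term of p_0 misses none, is kept apart and becomes the part b^2
    of B. Finally, the estimates for the Volterra operator hold at every point of [0, 1], since its
    values are integrals; limits can therefore be taken pointwise, without completeness of the
    weighted spaces. *)

Definition rAC g :=
  forall e : R, 0 < e -> exists2 d : R, 0 < d &
    forall (m : nat) (s t : 'I_m -> R),
      (forall i, 0 <= s i /\ s i <= t i /\ t i <= 1) ->
      (forall i j, i != j -> t i <= s j \/ t j <= s i) ->
      \sum_(i < m) (t i - s i) < d ->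
      \sum_(i < m) `|g (t i) - g (s i)| < e.

(* A Cousin-type covering of [0, x] in which the increments of [g] are either
   controlled by [e] or live on non-overlapping intervals inside [U]. *)
Definition chain (U : set R) (e : R) g (x : R) :=
  exists (m : nat) (s t : nat -> R),
    [/\ forall i, (i < m)%N -> 0 <= s i /\ s i <= t i /\ t i <= x,
        forall i j, (i < j < m)%N -> t i <= s j,
        (((\sum_(i < m) (t i - s i)) %:E) <= mu (U `&` `[0%R, x]))%E &
        `|g x - g 0| <= e * x + \sum_(i < m) `|g (t i) - g (s i)|].

Lemma chain0 U e g : chain U e g 0.
Proof.
exists 0%N, (fun=> 0), (fun=> 0); split => //.
- by rewrite big_ord0; exact: measure_ge0.
- by rewrite big_ord0 subrr normr0 mulr0 addr0.
Qed.

Lemma chain_small U e g y z : open U -> 0 <= y -> y <= z -> chain U e g y ->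
  `|g z - g y| <= e * (z - y) -> chain U e g z.
Proof.
move=> oU y0 yz [m [s [t [st ts su gg]]]] gzy.
exists m, s, t; split => //.
- by move=> i im; have [a [b c]] := st _ im; do 2!split=> //; apply: le_trans yz.
- apply: le_trans su _; apply: le_measure; rewrite ?inE.
  + by apply: measurableI => //; exact: open_measurable.
  + by apply: measurableI => //; exact: open_measurable.
  + by apply: setIS => w /=; rewrite !in_itv/= => /andP[-> /le_trans]; apply.
- have -> : g z - g 0 = (g z - g y) + (g y - g 0) by rewrite addrA subrK.
  apply: le_trans (ler_normD _ _) _.
  have -> : e * z = e * (z - y) + e * y by rewrite -mulrDr subrK.
  by rewrite -addrA lerD.
Qed.

Lemma chain_open U e g y z : open U -> 0 <= e -> 0 <= y -> y <= z -> chain U e g y ->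
  `[y, z]%classic `<=` U -> chain U e g z.
Proof.
move=> oU e0 y0 yz [m [s [t [st ts su gg]]]] yzU.
exists m.+1, (fun i => if i == m then y else s i), (fun i => if i == m then z else t i).
split.
- move=> i; rewrite ltnS leq_eqVlt => /predU1P[->|im]; first by rewrite eqxx.
  rewrite (ltn_eqF im).
  by have [a [b c]] := st _ im; do 2!split=> //; apply: le_trans yz.
- move=> i j /andP[ij]; rewrite ltnS leq_eqVlt => /predU1P[jm|jm].
    rewrite jm in ij *; rewrite eqxx (ltn_eqF ij).
    by have [_ []] := st _ ij.
  rewrite (ltn_eqF jm) (ltn_eqF (ltn_trans ij jm)).
  by apply: ts; rewrite ij.
- rewrite big_ord_recr/= eqxx.
  under eq_bigr => i _ do rewrite (ltn_eqF (ltn_ord i)).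
  (* The interval is taken half-open so that it is disjoint from [0, y] and the measures add. *)
  rewrite EFinD; have -> : (z - y)%:E = mu `]y, z].
    rewrite lebesgue_measure_itv/= lte_fin; case: ltP => // zy.
    by rewrite (le_anti (introT andP (conj yz zy))) subrr.
  apply: (@le_trans _ _ (mu (U `&` `[0%R, y]) + mu `]y, z])%E).
    by apply: leeD.
  rewrite -measureU//; last 2 first.
  + by apply: measurableI => //; exact: open_measurable.
  + rewrite -subset0 => w [[_ /=]]; rewrite !in_itv/= => /andP[_ wy] /andP[yw _].
    by move: (lt_le_trans yw wy); rewrite ltxx.
  apply: le_measure; rewrite ?inE.
  + apply: measurableU => //; apply: measurableI => //; exact: open_measurable.
  + by apply: measurableI => //; exact: open_measurable.
  + move=> w [[Uw]|] /=; rewrite !in_itv/=.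
      by move=> /andP[-> /le_trans wl]; split => //; exact: wl.
    move=> /andP[yw wz]; split; last by rewrite wz (le_trans y0 (ltW yw)).
    by apply: yzU; rewrite /= in_itv/= (ltW yw).
- rewrite big_ord_recr/= eqxx.
  under eq_bigr => i _ do rewrite (ltn_eqF (ltn_ord i)).
  have -> : g z - g 0 = (g y - g 0) + (g z - g y) by ring.
  apply: le_trans (ler_normD _ _) _.
  rewrite addrA lerD2r; apply: le_trans gg _.
  by rewrite lerD2r ler_wpM2l.
Qed.

(** Real induction: the supremum c of the points reached by a chain can be stepped over, from some y
    <= c to some z >= c, hence c = x. The local hypothesis speaks of intervals straddling c because
    differentiability at c controls exactly those increments. *)
Lemma chain_all U e g x :open U -> 0 < e -> 0 <= x ->
  (forall c : R, 0 <= c <= x -> exists2 r : R, 0 < r & forall y z : R,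
     c - r < y -> 0 <= y -> y <= c -> c <= z -> z < c + r -> z <= x ->
     `[y, z]%classic `<=` U \/ `|g z - g y| <= e * (z - y)) ->
  chain U e g x.
Proof.
move=> oU e0 x0 H.
pose S := [set y | 0 <= y <= x /\ chain U e g y].
have S0 : S 0 by split; [rewrite lexx | exact: chain0].
have ubS : ubound S x by move=> y [/andP[]].
have supS : has_sup S by split; [exists 0 | exists x].
pose c := sup S.
have c0 : 0 <= c by apply: ub_le_sup => //; exists x.
have cx : c <= x by apply: ge_sup => //; exists 0.
have [r r0 Hr] := H c (introT andP (conj c0 cx)).
have [y Sy cry] := sup_adherent r0 supS.
have yc : y <= c by apply: ub_le_sup => //; exists x.
have [/andP[y0 yx] Ty] := Sy.
pose z := Num.min x (c + r / 2).
have cz : c <= z by rewrite /z le_min cx lerDl divr_ge0// ltW.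
have zx : z <= x by rewrite /z ge_min lexx.
have zr : z < c + r.
  by rewrite /z gt_min; apply/orP; right; rewrite ltrD2l ltr_pdivrMr// ltr_pMr// ltr1n.
have Tz : chain U e g z.
  have yz := le_trans yc cz.
  have [yzU|gg] := Hr _ _ cry y0 yc cz zr zx.
    exact: (chain_open oU (ltW e0) y0).
  exact: (chain_small oU y0).
have zc : z <= c.
  by apply: ub_le_sup; [exists x | split=> //; rewrite zx (le_trans c0 cz)].
have : z = x.
  apply/eqP; rewrite eq_le zx/= leNgt; apply/negP => zltx.
  have : z = c + r / 2.
    move: zltx; rewrite /z; case: (leP x (c + r / 2)) => //.
    by rewrite ltxx.
  by move=> E; move: zc; rewrite E gerDl leNgt divr_gt0.
by move=> <-.
Qed.

(** The exceptional null set is covered by an open U of measure below the [d] that absolute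
    continuity gives for [e]; at the other points difference quotients are small. A chain then
    bounds the increment by [e * x] plus the increments over intervals of total length below [d],
    and both parts are at most [e' / 2]. *)
Lemma rAC_const g : rAC g ->
  {ae mu, forall x : R, `]0%R, 1%R[%classic x -> is_derive x (1 : R) g 0} ->
  forall x, 0 <= x <= 1 -> g x = g 0.
Proof.
move=> gAC [N [mN N0 NS]] x /andP[x0 x1].
apply/eqP; rewrite -subr_eq0 -normr_le0; apply/ler_addgt0Pl => e' e'0; rewrite addr0.
have e0 : 0 < e' / 2 by rewrite divr_gt0.
set e := e' / 2 in e0.
have [d d0 Hd] := gAC _ e0.
(* The derivative is known on the open interval, so the endpoints join the exceptional set. *)
pose N' := N `|` [set 0; 1].
have mN' : measurable N' by apply: measurableU => //; apply: measurableU.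
have muN' : mu N' = 0%E.
  apply/eqP; rewrite eq_le measure_ge0 andbT.
  apply: le_trans (measureU2 _ _ _) _ => //; first exact: measurableU.
  rewrite [X in (X + _)%E](_ : _ = 0%E); last exact: N0.
  rewrite add0e; apply: le_trans (measureU2 _ _ _) _ => //.
  rewrite [X in (X + _)%E](_ : _ = 0%E); last exact: lebesgue_measure_set1.
  by rewrite add0e [leLHS](_ : _ = 0%E)//; exact: lebesgue_measure_set1.
have [U [oU NU muU]] : exists U : set R, [/\ open U, N' `<=` U & (mu U < d%:E)%E].
  have [|U [oU NU muU]] := @lebesgue_regularity_outer R N' d mN' _ d0.
    by rewrite [X in (X < _)%E]muN'.
  exists U; split => //.
  have -> : U = (U `\` N') `|` N' by rewrite setUC setDUK.
  apply: le_lt_trans (measureU2 _ _ _) _ => //.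
    by apply: measurableD => //; exact: open_measurable.
  by rewrite [X in (_ + X)%E](_ : _ = 0%E)//= adde0.
have [] : chain U e g x.
  apply: chain_all => // c /andP[c0 cx].
  have [Uc|NUc] := pselect (U c).
    have := oU; rewrite openE => /(_ _ Uc); rewrite /interior => -[r /= r0 rU].
    exists r => // y z cy y0 yc cz zc zx; left => w /=; rewrite in_itv/= => /andP[yw wz].
    apply: rU; rewrite /ball/= ltr_distlC.
    by rewrite (lt_le_trans cy yw) (le_lt_trans wz zc).
  have c01 : `]0%R, 1%R[%classic c.
    rewrite /= in_itv/= !lt_neqAle c0 (le_trans cx x1) !andbT.
    apply/andP; split; apply/eqP => E; apply: NUc; apply: NU; right; rewrite /=.
      by left.
    by right.
  have dg : is_derive c (1 : R) g 0.
    apply: contrapT => nd; apply: NUc; apply: NU; left; apply: NS => /=.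
    by move=> /(_ c01).
  have := dg; case => ex_d d_g.
  have : h^-1 *: (g (h + c) - g c) @[h --> 0%R^'] --> (0 : R).
    move: ex_d; rewrite /derivable => /cvg_ex[l /= cl].
    have lE : l = 0.
      by rewrite -d_g; apply/esym; exact: (cvg_lim (@Rhausdorff R) cl).
    rewrite -[X in _ --> X]lE; move: cl; apply: cvg_trans; apply: near_eq_cvg; near=> h.
    by rewrite /= [h *: 1]mulr1.
  move=> /cvgrPdist_le /(_ e e0) /=.
  rewrite near_withinE /= => -[r /= r0 rH].
  have est : forall w, `|w - c| < r -> `|g w - g c| <= e * `|w - c|.
    move=> w wr; have [->|wc] := eqVneq w c; first by rewrite !subrr !normr0 mulr0.
    have := rH (w - c); rewrite /= sub0r normrN => /(_ wr).
    rewrite subr_eq0 => /(_ wc); rewrite subrK sub0r normrN normrZ normfV.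
    by rewrite ler_pdivrMl ?normr_gt0 ?subr_eq0// mulrC.
  exists r => // y z cy y0 yc cz zc zx; right.
  have -> : g z - g y = (g z - g c) - (g y - g c) by rewrite opprB addrA subrK.
  apply: le_trans (ler_normB _ _) _.
  have -> : z - y = `|z - c| + `|y - c|.
    by rewrite ger0_norm ?subr_ge0// ler0_norm ?subr_le0// opprB addrA subrK.
  rewrite mulrDr lerD// est//.
    by rewrite ger0_norm ?subr_ge0// ltrBlDl.
  by rewrite ler0_norm ?subr_le0// opprB ltrBlDl -ltrBlDr.
move=> m [s [t [st ts su gg]]].
apply: le_trans gg _; rewrite [e']splitr lerD//.
  by rewrite -[leRHS]mulr1 ler_wpM2l// ?ltW// (le_trans x1).
apply/ltW; apply: (Hd m (fun i => s i) (fun i => t i)).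
- move=> i; have [a [b c]] := st i (ltn_ord i).
  by do 2!split => //; apply: le_trans x1.
- move=> i j ij; have [ij'|ji'|/val_inj E] := ltngtP i j.
  + by left; apply: ts; rewrite ij' /=.
  + by right; apply: ts; rewrite ji' /=.
  + by rewrite E eqxx in ij.
- rewrite -lte_fin; apply: le_lt_trans su _; apply: le_lt_trans muU.
  apply: le_measure; rewrite ?inE.
  + by apply: measurableI => //; exact: open_measurable.
  + exact: open_measurable.
  + exact: subIsetl.
Unshelve. all: by end_near. Qed.

End RealAC.

(** * The fundamental theorem of calculus for absolutely continuous functions *)

Section RealFTC.
Variable R : realType.
Local Notation mu := (@lebesgue_measure R).
Implicit Types (g h f : R -> R) (U : set R) (e x y z : R).

Lemma aeS (P Q : R -> Prop) : (forall x, P x -> Q x) ->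
  {ae mu, forall x, P x} -> {ae mu, forall x, Q x}.
Proof. by move=> PQ; apply: filterS; [exact: (ae_filter_ringOfSetsType mu) | exact: PQ]. Qed.

Lemma aeS2 (P Q S : R -> Prop) : (forall x, P x -> Q x -> S x) ->
  {ae mu, forall x, P x} -> {ae mu, forall x, Q x} -> {ae mu, forall x, S x}.
Proof. by move=> PQ; apply: filterS2; [exact: (ae_filter_ringOfSetsType mu) | exact: PQ]. Qed.

Lemma mI01 : measurable (@I01 R).
Proof. exact: measurable_itv. Qed.

#[local] Hint Resolve mI01 : core.

Definition rJ f x : R := \int[mu]_(t in `[0%R, x]) f t.

Lemma rJB f s t : mu.-integrable I01 (EFin \o f) -> 0 <= s -> s <= t -> t <= 1 ->
  rJ f t - rJ f s = \int[mu]_(x in `]s, t]) f x.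
Proof.
move=> fi s0 st t1; rewrite /rJ Rintegral_itvB ?bnd_simp//.
by apply: integrableS fi => //; rewrite /I01; apply: subset_itvl; rewrite bnd_simp.
Qed.

Lemma rJ0 f : rJ f 0 = 0.
Proof. by rewrite /rJ set_itv1 Rintegral_set1. Qed.

(** Absolute continuity of the integral is applied once, to the union of the intervals; these may
    touch, so half-open ones are used to keep them disjoint. *)
Lemma rAC_rJ f : mu.-integrable I01 (EFin \o f) -> rAC (rJ f).
Proof.
move=> fi e e0.
have fi' : mu.-integrable setT (EFin \o f \_ I01).
  rewrite -restrict_EFin; apply/integrable_restrict => //=.
  by rewrite setTI.
have [d [d0 Hd]] := integral_normr_continuous fi' e0.
exists d => // m s t st sep sumd.
pose A (i : 'I_m) := `]s i, t i]%classic.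
pose D := \big[setU/set0]_(i < m) A i.
have mA i : measurable (A i) by exact: measurable_itv.
have tA : trivIset [set` index_enum 'I_m] A.
  move=> i j _ _ [w []]; rewrite /A /= !in_itv/= => /andP[iw wi] /andP[jw wj].
  apply/eqP; apply: contraPT iw => ij; apply/negP; rewrite -leNgt.
  have [tisj|tjsi] := sep _ _ ij.
    by move: (lt_le_trans jw (le_trans wi tisj)); rewrite ltxx.
  exact: le_trans wj tjsi.
have mD : measurable D by exact: bigsetU_measurable.
have muD : (mu D < d%:E)%E.
  rewrite /D measure_bigsetU_ord//; last first.
    by apply: sub_trivIset tA => i _ /=; rewrite mem_index_enum.
  rewrite (eq_bigr (fun i => (t i - s i)%:E)); first by rewrite sumEFin lte_fin.
  move=> i _; rewrite [LHS]lebesgue_measure_itv/= lte_fin; case: ltP => // tsi.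
  by have [_ [sti _]] := st i; rewrite (le_anti (introT andP (conj tsi sti))) subrr.
have A01 i : A i `<=` I01.
  move=> w; rewrite /A /I01 /= !in_itv/= => /andP[iw wi].
  have [si [_ ti]] := st i; rewrite (le_trans si (ltW iw))/=; exact: le_trans wi ti.
have fAi i : mu.-integrable (A i) (EFin \o f).
  by apply: integrableS fi; [exact: mI01 | exact: mA | exact: A01].
have -> : \sum_(i < m) `|rJ f (t i) - rJ f (s i)| =
          \sum_(i < m) `|\int[mu]_(x in A i) f x|.
  by apply: eq_bigr => i _; have [si [sti ti]] := st i; rewrite rJB.
apply: le_lt_trans (Hd D mD muD).
have -> : \int[mu]_(x in D) `|(f \_ I01) x| = \sum_(i < m) \int[mu]_(x in A i) `|f x|.
  rewrite /Rintegral /D integral_bigsetU_EFin//.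
  - rewrite -sum_fine; last first.
      move=> i _; apply: integrable_fin_num; first exact: mA.
      have : mu.-integrable (A i) (EFin \o (fun x => `|(f \_ I01) x|)); last by [].
      refine (@eq_integrable _ _ _ mu (A i) (mA i) (EFin \o (Num.norm \o f)) _ _
        (integrable_norm (fAi i))) => // w wA.
      by rewrite /= patchE mem_set//; exact: (A01 i w (set_mem wA)).
    apply: eq_bigr => i _; congr fine; apply: eq_integral => w wA.
    by rewrite patchE mem_set//; exact: (A01 i w (set_mem wA)).
  - by rewrite index_enum_uniq.
  - apply/measurable_EFinP; apply: measurableT_comp => //.
    have /integrableP[/measurable_EFinP mf _] := fi'.
    exact: measurable_funTS.
by apply: ler_sum => i _; apply: le_normr_Rintegral; [exact: mA | exact: fAi].
Qed.

Lemma rJ_restrict f x : x <= 1 -> rJ (f \_ I01) x = rJ f x.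
Proof.
move=> x1; apply: eq_Rintegral => w; rewrite inE /= in_itv/= => /andP[w0 wx].
by rewrite patchE mem_set// /I01 /= in_itv/= w0 (le_trans wx).
Qed.

Lemma is_derive_near f g x l : (\forall y \near x, f y = g y) ->
  is_derive x (1 : R) f l -> is_derive x (1 : R) g l.
Proof.
move=> fg [df dl]; split.
  by apply: near_eq_derivable df.
by rewrite -dl; apply/esym; apply: near_eq_derive.
Qed.

(** Lebesgue differentiation is applied to the extension of [f] by zero, which is locally integrable
    on the line; near an interior point both functions have the same primitive. *)
Lemma rJ_derive f : mu.-integrable I01 (EFin \o f) ->
  {ae mu, forall x : R, `]0%R, 1%R[%classic x -> is_derive x (1 : R) (rJ f) (f x)}.
Proof.
move=> fi.
have fi' : mu.-integrable setT (EFin \o f \_ I01).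
  rewrite -restrict_EFin; apply/integrable_restrict => //=.
  by rewrite setTI.
have lf : locally_integrable setT (f \_ I01) by apply: integrable_locally => //.
have := @FTC1 R (f \_ I01) (BLeft 0).
have fy y : mu.-integrable `[0%R, y] (EFin \o f \_ I01) by apply: integrableS fi'.
move=> /(_ fy lf); apply: aeS => x + x01; move: (x01); rewrite /= in_itv/= => /andP[x0 x1].
have x0' : (0%:E < x%:E)%E by rewrite lte_fin.
move=> /(_ x0') [dF F'].
apply: (@is_derive_near (rJ (f \_ I01))).
  near=> y; apply: rJ_restrict; apply/ltW; near: y.
  exact: (lt_nbhsl x1).
split; first exact: dF.
rewrite -derive1E; move: F'; rewrite patchE mem_set//.
by rewrite /I01/= in_itv/= !ltW.
Unshelve. all: by end_near. Qed.

Lemma rACD g h : rAC g -> rAC h -> rAC (fun x => g x + h x).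
Proof.
move=> gA hA e e0; have e20 : 0 < e / 2 by rewrite divr_gt0.
have [d1 d10 H1] := gA _ e20; have [d2 d20 H2] := hA _ e20.
exists (Num.min d1 d2); first by rewrite lt_min d10.
move=> m s t st sep; rewrite lt_min => /andP[sd1 sd2].
rewrite [e]splitr; apply: le_lt_trans (ltrD (H1 _ _ _ st sep sd1) (H2 _ _ _ st sep sd2)).
rewrite -big_split/=; apply: ler_sum => i _.
by apply: le_trans (ler_normD _ _); rewrite opprD addrACA.
Qed.

(** The retraction onto [0, 1]. [rAC g] says nothing outside [0, 1]; composed with the retraction,
    [g] becomes continuous on the line, which gives measurability and boundedness. *)
Definition clamp x : R := Num.max 0 (Num.min 1 x).

Lemma clamp01 x : 0 <= clamp x <= 1.
Proof. by rewrite /clamp le_max lexx/= ge_max ler01/= ge_min lexx. Qed.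

Lemma clampE x : 0 <= x <= 1 -> clamp x = x.
Proof. by rewrite /clamp => /andP[x0 x1]; rewrite min_r// max_r. Qed.

Lemma clampP x :
  [\/ x <= 0 /\ clamp x = 0, 0 <= x <= 1 /\ clamp x = x | 1 <= x /\ clamp x = 1].
Proof.
have [x0|/ltW x0] := leP x 0.
  apply: Or31; split=> //; rewrite /clamp min_r ?max_l//.
  exact: le_trans ler01.
have [x1|/ltW x1] := leP x 1; first by apply: Or32; rewrite x0 clampE ?x0.
by apply: Or33; split=> //; rewrite /clamp min_l// max_r.
Qed.

Lemma clamp_lip x y : `|clamp x - clamp y| <= `|x - y|.
Proof.
wlog xy : x y / x <= y.
  by move=> H; have [/H//|/ltW/H] := leP x y; rewrite distrC [leRHS]distrC.
rewrite (ler0_norm (_ : x - y <= 0)) ?subr_le0// ler_norml.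
have [[? ->]|[/andP[? ?] ->]|[? ->]] := clampP x;
have [[? ->]|[/andP[? ?] ->]|[? ->]] := clampP y; apply/andP; split; lra.
Qed.

Lemma rAC_clamp g : rAC g -> continuous (g \o clamp).
Proof.
move=> gA x; apply/cvgrPdist_lt => e e0.
have [d d0 H] := gA _ e0.
near=> y.
have xyd : `|clamp x - clamp y| < d.
  apply: le_lt_trans (clamp_lip _ _) _; near: y.
  by exact: cvgr_dist_lt.
have /andP[x0 x1] := clamp01 x; have /andP[y0 y1] := clamp01 y.
have [xy|/ltW yx] := leP (clamp x) (clamp y).
- have := H 1%N (fun=> clamp x) (fun=> clamp y); rewrite !big_ord1 distrC.
  apply => //; first by move=> i j; rewrite !ord1 eqxx.
  by move: xyd; rewrite distrC ger0_norm ?subr_ge0.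
- have := H 1%N (fun=> clamp y) (fun=> clamp x); rewrite !big_ord1.
  apply => //; first by move=> i j; rewrite !ord1 eqxx.
  by move: xyd; rewrite ger0_norm ?subr_ge0.
Unshelve. all: by end_near. Qed.

Lemma rAC_measurable g : rAC g -> measurable_fun I01 g.
Proof.
move=> gA; apply: (@eq_measurable_fun _ _ _ _ _ (g \o clamp)).
  by move=> x; rewrite inE /I01/= in_itv/= => x01; rewrite clampE.
by apply: measurable_funTS; apply: continuous_measurable_fun; exact: rAC_clamp.
Qed.

Lemma rAC_bounded g : rAC g -> exists M : R, forall x, 0 <= x <= 1 -> `|g x| <= M.
Proof.
move=> gA.
have cg : continuous (fun x => `|(g \o clamp) x|).
  move=> x; apply: continuous_comp; first exact: rAC_clamp.
  exact: norm_continuous.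
have [//||c _ Hc] := @EVT_max R (fun x => `|(g \o clamp) x|) 0 1.
  exact: continuous_subspaceT.
exists `|g (clamp c)| => x x01; have := Hc x; rewrite in_itv/= x01 => /(_ isT).
by rewrite clampE.
Qed.

Lemma rACM g h : rAC g -> rAC h -> rAC (fun x => g x * h x).
Proof.
move=> gA hA e e0.
have [M0 gM0] := rAC_bounded gA; have [N0 hN0] := rAC_bounded hA.
pose M := `|M0| + `|N0| + 1.
have M_gt0 : 0 < M by rewrite ltr_wpDl// addr_ge0.
have gM x : 0 <= x <= 1 -> `|g x| <= M.
  move=> /gM0 /le_trans; apply; rewrite /M -addrA; apply: le_trans (ler_norm _) _.
  by rewrite lerDl addr_ge0.
have hM x : 0 <= x <= 1 -> `|h x| <= M.
  move=> /hN0 /le_trans; apply; rewrite /M addrAC addrC; apply: le_trans (ler_norm _) _.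
  by rewrite lerDl addr_ge0.
have e20 : 0 < e / 2 / M by rewrite !divr_gt0.
have [d1 d10 H1] := gA _ e20; have [d2 d20 H2] := hA _ e20.
exists (Num.min d1 d2); first by rewrite lt_min d10.
move=> m s t st sep; rewrite lt_min => /andP[sd1 sd2].
have K1 := H1 _ _ _ st sep sd1; have K2 := H2 _ _ _ st sep sd2.
rewrite -(ltr_pM2r M_gt0) divfK ?gt_eqF// in K1.
rewrite -(ltr_pM2r M_gt0) divfK ?gt_eqF// in K2.
rewrite [e]splitr; apply: le_lt_trans (ltrD K1 K2).
rewrite !mulr_suml -big_split/=; apply: ler_sum => i _.
have [s0 [sti t1]] := st i.
have -> : g (t i) * h (t i) - g (s i) * h (s i) =
  (g (t i) - g (s i)) * h (t i) + (h (t i) - h (s i)) * g (s i) by ring.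
apply: le_trans (ler_normD _ _) _; rewrite !normrM lerD// ler_wpM2l//.
  by apply: hM; rewrite (le_trans s0 sti).
by apply: gM; rewrite s0 (le_trans sti).
Qed.

Lemma rAC_cst (c : R) : rAC (fun=> c).
Proof.
move=> e e0; exists 1 => // m s t _ _ _; rewrite big1// => i _.
by rewrite subrr normr0.
Qed.

(** The function [g - rJ h] is absolutely continuous with derivative zero almost everywhere. *)
Lemma rAC_ftc g h : rAC g ->
  {ae mu, forall x : R, `]0%R, 1%R[%classic x -> is_derive x (1 : R) g (h x)} ->
  mu.-integrable I01 (EFin \o h) ->
  forall x, 0 <= x <= 1 -> g x = g 0 + rJ h x.
Proof.
move=> gA gh hi x x01.
pose k y := g y + (-1) * rJ h y.
have : k x = k 0.
  apply: rAC_const x01 => //.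
    by apply: rACD => //; apply: rACM; [exact: rAC_cst | exact: rAC_rJ].
  apply: aeS2 gh (rJ_derive hi) => y gy hy y01.
  have [gy' hy'] := (gy y01, hy y01).
  have := is_deriveD gy' (is_deriveZ (-1) hy').
  by rewrite scaleN1r subrr.
by rewrite /k rJ0 mulr0 addr0 => <-; rewrite mulN1r subrK.
Qed.

Lemma rJ_zero f : mu.-integrable I01 (EFin \o f) ->
  (forall x, 0 <= x <= 1 -> rJ f x = 0) ->
  {ae mu, forall x, I01 x -> f x = 0}.
Proof.
move=> fi J0.
have ends : {ae mu, forall x : R, x != 0 /\ x != 1}.
  exists [set 0; 1]; split; [exact: measurableU| |].
    apply/eqP; rewrite eq_le measure_ge0 andbT.
    apply: le_trans (measureU2 _ _ _) _ => //.
    rewrite [X in (X + _)%E](_ : _ = 0%E); last exact: lebesgue_measure_set1.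
    by rewrite add0e [leLHS](_ : _ = 0%E)//; exact: lebesgue_measure_set1.
  move=> x /= /not_andP[/negP|/negP]; rewrite negbK => /eqP ->; [by left|by right].
apply: aeS2 ends (rJ_derive fi) => x [x0 x1] dx x01.
have {}x01 : `]0%R, 1%R[%classic x.
  move: x01; rewrite /I01/= !in_itv/= => /andP[x0' x1'].
  by rewrite !lt_neqAle x0' x1' x1 eq_sym x0.
have [_ <-] := dx x01.
have [_ <-] : is_derive x (1 : R) (fun=> 0 : R) 0 by apply: (@is_derive_cst _ R R 0 x 1).
move: x01; rewrite /= in_itv/= => /andP[x0' x1'].
apply: near_eq_derive; near=> y; apply: J0.
by apply/andP; split; apply/ltW; near: y; [exact: (lt_nbhsr x0') | exact: (lt_nbhsl x1')].
Unshelve. all: by end_near. Qed.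

End RealFTC.

(** * Complex-valued integrals *)

Section Complex.
Variable R : realType.
Local Notation mu := (@lebesgue_measure R).
Local Notation C := R[i].
Local Notation ACf := (@Defs.AC R 0 1).
Implicit Types (z w : C) (D : set R) (f g : R -> C).

Lemma cReD z w : complex.Re (z + w) = complex.Re z + complex.Re w.
Proof. by case: z w => ? ? [? ?]. Qed.
Lemma cImD z w : complex.Im (z + w) = complex.Im z + complex.Im w.
Proof. by case: z w => ? ? [? ?]. Qed.
Lemma cReN z : complex.Re (- z) = - complex.Re z.
Proof. by case: z. Qed.
Lemma cImN z : complex.Im (- z) = - complex.Im z.
Proof. by case: z. Qed.
Lemma cReM z w : complex.Re (z * w) =
  complex.Re z * complex.Re w - complex.Im z * complex.Im w.
Proof. by case: z w => ? ? [? ?]. Qed.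
Lemma cImM z w : complex.Im (z * w) =
  complex.Re z * complex.Im w + complex.Im z * complex.Re w.
Proof. by case: z w => ? ? [? ?]. Qed.
Definition ReIm := (cReD, cImD, cReN, cImN, cReM, cImM).

Lemma eq_ReIm z w : complex.Re z = complex.Re w -> complex.Im z = complex.Im w -> z = w.
Proof. by case: z w => ? ? [? ?] /= -> ->. Qed.

Lemma cabsE z : cabs z = Normc.normc z.
Proof. by case: z. Qed.
Lemma cabs_ge0 z : 0 <= cabs z.
Proof. exact: sqrtr_ge0. Qed.
Lemma csq_ge0 z : 0 <= csq z.
Proof. by rewrite /csq addr_ge0// sqr_ge0. Qed.
Lemma csqE z : csq z = cabs z ^+ 2.
Proof. by rewrite /cabs sqr_sqrtr// csq_ge0. Qed.
Lemma cabsM z w : cabs (z * w) = cabs z * cabs w.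
Proof. by rewrite !cabsE Normc.normcM. Qed.
Lemma csqM z w : csq (z * w) = csq z * csq w.
Proof. by rewrite !csqE cabsM exprMn. Qed.
Lemma cabsD z w : cabs (z + w) <= cabs z + cabs w.
Proof. by rewrite !cabsE; exact: le_normcD. Qed.
Lemma cabsN z : cabs (- z) = cabs z.
Proof. by rewrite !cabsE; exact: normcN. Qed.
Lemma cabs0 : cabs (0 : C) = 0.
Proof. by rewrite cabsE Normc.normc0. Qed.
Lemma cabsV z : cabs z^-1 = (cabs z)^-1.
Proof. by rewrite !cabsE Normc.normcV. Qed.
Lemma cabs_eq0 z : (cabs z == 0) = (z == 0).
Proof.
apply/eqP/eqP => [|->]; last exact: cabs0.
by rewrite cabsE => /Normc.eq0_normc.
Qed.
Lemma cabs_real (x : R) : cabs x%:C = `|x|.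
Proof. by rewrite /cabs /csq /= expr0n addr0 sqrtr_sqr. Qed.
Lemma cabs_Re z : `|complex.Re z| <= cabs z.
Proof.
rewrite /cabs /csq -sqrtr_sqr ler_wsqrtr// lerDl; exact: sqr_ge0.
Qed.
Lemma cabs_Im z : `|complex.Im z| <= cabs z.
Proof.
rewrite /cabs /csq -sqrtr_sqr ler_wsqrtr// lerDr; exact: sqr_ge0.
Qed.
Lemma cabs_le z : cabs z <= `|complex.Re z| + `|complex.Im z|.
Proof.
rewrite -[leRHS]ger0_norm ?addr_ge0// -sqrtr_sqr /cabs /csq ler_wsqrtr//.
rewrite sqrrD !real_normK ?num_real// -addrA lerD2l lerDr mulrn_wge0// mulr_ge0//.
Qed.
Lemma cabs_sum I (r : seq I) (P : pred I) (F : I -> C) :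
  cabs (\sum_(i <- r | P i) F i) <= \sum_(i <- r | P i) cabs (F i).
Proof.
elim/big_rec2: _ => [|i x y _ IH]; first by rewrite cabs0.
by apply: le_trans (cabsD _ _) _; rewrite lerD2l.
Qed.

Lemma aeI (P : R -> Prop) : (forall x, P x) -> {ae mu, forall x, P x}.
Proof. by move=> PT; exact: (aeW mu PT). Qed.

(** Domination is often known only almost everywhere, typically where [b] is nonzero; the
    exceptional null set is cut out of [D] before comparing. *)
Lemma le_integrable_ae D (f g : R -> R) : measurable D -> measurable_fun D f ->
  {ae mu, forall x, D x -> `|f x| <= g x} ->
  mu.-integrable D (EFin \o g) -> mu.-integrable D (EFin \o f).
Proof.
move=> mD mf [N [mN N0 NS]] gi.
apply/(negligible_integrable mN mD _ N0); first exact/measurable_EFinP.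
have mDN : measurable (D `\` N) by exact: measurableD.
have giN : mu.-integrable (D `\` N) (EFin \o g).
  by apply: integrableS gi => //; exact: subDsetl.
refine (@le_integrable _ _ R mu _ mDN _ _ _ _ giN).
  by apply/measurable_EFinP; apply: measurable_funS mf => //; exact: subDsetl.
move=> x [Dx Nx] /=; rewrite lee_fin.
have : `|f x| <= g x by apply: contrapT => H; apply: Nx; apply: NS => /= /(_ Dx).
by move=> /le_trans; apply; exact: ler_norm.
Qed.

Lemma eq_Rintegral_ae D (f g : R -> R) : measurable D ->
  measurable_fun D f -> measurable_fun D g ->
  {ae mu, forall x, D x -> f x = g x} ->
  \int[mu]_(x in D) f x = \int[mu]_(x in D) g x.
Proof.
move=> mD mf mg fg; congr fine; apply: ae_eq_integral => //.
- exact/measurable_EFinP.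
- exact/measurable_EFinP.
- by apply: aeS fg => x fg Dx; rewrite fg.
Qed.

(** Inversion is discontinuous at 0; on nonnegative numbers it is the real power with exponent -1, a
    measurable function, also under the convention that 0 has inverse 0. *)
Lemma measurable_inv_ge0 D (f : R -> R) : measurable_fun D f ->
  (forall x, 0 <= f x) -> measurable_fun D (fun x => (f x)^-1).
Proof.
move=> mf f0; apply: (@eq_measurable_fun _ _ _ _ _ (fun x => f x `^ (-1))).
  by move=> x _; rewrite powR_inv1.
by apply: (measurableT_comp (measurable_powR (-1))).
Qed.

Lemma measurable_sqrt D (f : R -> R) : measurable_fun D f ->
  measurable_fun D (fun x => Num.sqrt (f x)).
Proof.
move=> mf; apply: (measurableT_comp _ mf).
by apply: continuous_measurable_fun; exact: sqrt_continuous.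
Qed.

Lemma cmeasD D f g : cmeas D f -> cmeas D g -> cmeas D (fun x => f x + g x).
Proof.
move=> [a b] [c d]; split.
  by under eq_fun do rewrite cReD; exact: measurable_funD.
by under eq_fun do rewrite cImD; exact: measurable_funD.
Qed.
Lemma cmeasM D f g : cmeas D f -> cmeas D g -> cmeas D (fun x => f x * g x).
Proof.
move=> [a b] [c d]; split.
  by under eq_fun do rewrite cReM; apply: measurable_funB; exact: measurable_funM.
by under eq_fun do rewrite cImM; apply: measurable_funD; exact: measurable_funM.
Qed.
Lemma cmeas_cst D z : cmeas D (fun=> z).
Proof. by split; exact: measurable_cst. Qed.
Lemma cmeas_real D (f : R -> R) : measurable_fun D f -> cmeas D (fun x => (f x)%:C).
Proof. by move=> mf; split => //=; exact: measurable_cst. Qed.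
Lemma cmeas_csq D f : cmeas D f -> measurable_fun D (fun x => csq (f x)).
Proof.
by move=> [a b]; apply: measurable_funD; exact: measurable_funX.
Qed.
Lemma cmeas_cabs D f : cmeas D f -> measurable_fun D (fun x => cabs (f x)).
Proof. by move=> mf; apply: measurable_sqrt; exact: cmeas_csq. Qed.
Lemma cmeasV D f : cmeas D f -> cmeas D (fun x => (f x)^-1).
Proof.
move=> mf; have [a b] := mf.
have mi := measurable_inv_ge0 (cmeas_csq mf) (fun x => csq_ge0 (f x)).
split.
  rewrite (_ : (fun x => _) = (fun x => complex.Re (f x) * (csq (f x))^-1)).
    exact: measurable_funM.
  by apply/funext => x; case: (f x).
rewrite (_ : (fun x => _) = (fun x => - complex.Im (f x) * (csq (f x))^-1)).
  by apply: measurable_funM => //; exact: measurable_funN.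
by apply/funext => x; case: (f x) => p q; rewrite mulNr.
Qed.
Lemma eq_cmeas D f g : (forall x, D x -> f x = g x) -> cmeas D f -> cmeas D g.
Proof.
move=> fg [a b]; split; [apply: eq_measurable_fun a|apply: eq_measurable_fun b];
  by move=> x; rewrite inE => /fg ->.
Qed.

Lemma cintegrable_cmeas D f : cintegrable D f -> cmeas D f.
Proof.
move=> [/integrableP[/measurable_EFinP a _] /integrableP[/measurable_EFinP b _]].
by split.
Qed.

Lemma cintegrable_le D f (g : R -> R) : measurable D -> cmeas D f ->
  {ae mu, forall x, D x -> cabs (f x) <= g x} ->
  mu.-integrable D (EFin \o g) -> cintegrable D f.
Proof.
move=> mD [a b] fg gi; split; apply: (le_integrable_ae mD _ _ gi) => //.
  by apply: aeS fg => x fg /fg; apply: le_trans; exact: cabs_Re.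
by apply: aeS fg => x fg /fg; apply: le_trans; exact: cabs_Im.
Qed.

Lemma integrable_RD D (f g : R -> R) : measurable D ->
  mu.-integrable D (EFin \o f) -> mu.-integrable D (EFin \o g) ->
  mu.-integrable D (EFin \o (fun x => f x + g x)).
Proof. by move=> mD fi gi; exact: (@integrableD _ _ R mu _ mD _ _ fi gi). Qed.
Lemma integrable_RZ D (f : R -> R) (k : R) : measurable D ->
  mu.-integrable D (EFin \o f) ->
  mu.-integrable D (EFin \o (fun x => k * f x)).
Proof. by move=> mD fi; exact: (@integrableZl _ _ R mu _ mD k _ fi). Qed.

Lemma integrable_cabs D f : measurable D -> cintegrable D f ->
  mu.-integrable D (EFin \o (fun x => cabs (f x))).
Proof.
move=> mD fi; have [a b] := fi.
have := integrable_RD mD (integrable_norm a) (integrable_norm b).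
apply: le_integrable_ae => //.
  by apply: cmeas_cabs; exact: cintegrable_cmeas.
by apply: aeI => x _; rewrite ger0_norm ?cabs_ge0//; exact: cabs_le.
Qed.

Lemma cintegrableD D f g : measurable D -> cintegrable D f -> cintegrable D g ->
  cintegrable D (fun x => f x + g x).
Proof.
move=> mD [a b] [c d]; split.
  by under eq_fun do rewrite cReD; exact: integrable_RD.
by under eq_fun do rewrite cImD; exact: integrable_RD.
Qed.
Lemma cintegrableZ D z f : measurable D -> cintegrable D f ->
  cintegrable D (fun x => z * f x).
Proof.
move=> mD fi.
apply: (cintegrable_le (g := fun x => cabs z * cabs (f x))) => //.
- by apply: cmeasM; [exact: cmeas_cst | exact: cintegrable_cmeas].
- by apply: aeI => x _; rewrite cabsM.
- by apply: integrable_RZ => //; exact: integrable_cabs.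
Qed.
Lemma cintegrableS D E f : measurable D -> measurable E -> E `<=` D ->
  cintegrable D f -> cintegrable E f.
Proof.
by move=> mD mE ED [a b]; split;
  [exact: (@integrableS _ _ R mu _ _ _ mD mE ED a)|exact: (@integrableS _ _ R mu _ _ _ mD mE ED b)].
Qed.
Lemma cintegrable0 D : cintegrable D (fun=> 0).
Proof. by split; exact: integrable0. Qed.
Lemma eq_cintegrable D f g : measurable D -> (forall x, D x -> f x = g x) ->
  cintegrable D f -> cintegrable D g.
Proof.
move=> mD fg [a b]; split;
  [apply: (@eq_integrable _ _ R mu _ mD _ _ _ a)
  |apply: (@eq_integrable _ _ R mu _ mD _ _ _ b)] => x;
  by rewrite inE => /fg ->.
Qed.
Lemma cintegrable_sum D I (r : seq I) (F : I -> R -> C) : measurable D ->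
  (forall i, cintegrable D (F i)) -> cintegrable D (fun x => \sum_(i <- r) F i x).
Proof.
move=> mD Fi; elim: r => [|i r IH].
  by under eq_fun do rewrite big_nil; exact: cintegrable0.
by under eq_fun do rewrite big_cons; exact: cintegrableD.
Qed.

Lemma RintD D (f g : R -> R) : measurable D ->
  mu.-integrable D (EFin \o f) -> mu.-integrable D (EFin \o g) ->
  \int[mu]_(x in D) (f x + g x) = \int[mu]_(x in D) f x + \int[mu]_(x in D) g x.
Proof. by move=> mD fi gi; exact: (@RintegralD _ _ R mu _ _ _ mD fi gi). Qed.
Lemma RintB D (f g : R -> R) : measurable D ->
  mu.-integrable D (EFin \o f) -> mu.-integrable D (EFin \o g) ->
  \int[mu]_(x in D) (f x - g x) = \int[mu]_(x in D) f x - \int[mu]_(x in D) g x.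
Proof. by move=> mD fi gi; exact: (@RintegralB _ _ R mu _ _ _ mD fi gi). Qed.
Lemma RintZ D (f : R -> R) (k : R) : measurable D -> mu.-integrable D (EFin \o f) ->
  \int[mu]_(x in D) (k * f x) = k * \int[mu]_(x in D) f x.
Proof. by move=> mD fi; exact: (@RintegralZl _ _ R mu _ _ k mD fi). Qed.

Lemma Re_cint D f : complex.Re (cint D f) = \int[mu]_(x in D) complex.Re (f x).
Proof. by rewrite /cint !ReIm /=; ring. Qed.
Lemma Im_cint D f : complex.Im (cint D f) = \int[mu]_(x in D) complex.Im (f x).
Proof. by rewrite /cint !ReIm /=; ring. Qed.

Lemma eq_cint D f g : (forall x, D x -> f x = g x) -> cint D f = cint D g.
Proof.
move=> fg; apply: eq_ReIm; rewrite !(Re_cint, Im_cint); apply: eq_Rintegral => x;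
  by rewrite inE => /fg ->.
Qed.

Lemma eq_cint_ae D f g : measurable D -> cmeas D f -> cmeas D g ->
  {ae mu, forall x, D x -> f x = g x} -> cint D f = cint D g.
Proof.
move=> mD [a b] [c d] fg.
apply: eq_ReIm; rewrite !(Re_cint, Im_cint); apply: eq_Rintegral_ae => //;
  by apply: aeS fg => x H /H ->.
Qed.

Lemma cintD D f g : measurable D -> cintegrable D f -> cintegrable D g ->
  cint D (fun x => f x + g x) = cint D f + cint D g.
Proof.
move=> mD [a b] [c d]; apply: eq_ReIm.
  by rewrite Re_cint cReD !Re_cint -RintD//; apply: eq_Rintegral => x _; rewrite cReD.
by rewrite Im_cint cImD !Im_cint -RintD//; apply: eq_Rintegral => x _; rewrite cImD.
Qed.

Lemma cintZ D z f : measurable D -> cintegrable D f ->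
  cint D (fun x => z * f x) = z * cint D f.
Proof.
move=> mD [a b]; apply: eq_ReIm.
  rewrite Re_cint cReM Re_cint Im_cint -!RintZ// -RintB//; try exact: integrable_RZ.
  by apply: eq_Rintegral => x _; rewrite cReM.
rewrite Im_cint cImM Re_cint Im_cint -!RintZ// -RintD//; try exact: integrable_RZ.
by apply: eq_Rintegral => x _; rewrite cImM.
Qed.

Lemma cint0 D : cint D (fun=> 0) = 0.
Proof.
by apply: eq_ReIm; rewrite !(Re_cint, Im_cint) /Rintegral /= integral0.
Qed.

Lemma cint_sum D I (r : seq I) (F : I -> R -> C) : measurable D ->
  (forall i, cintegrable D (F i)) ->
  cint D (fun x => \sum_(i <- r) F i x) = \sum_(i <- r) cint D (F i).
Proof.
move=> mD Fi; elim: r => [|i r IH].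
  by rewrite big_nil -[RHS](cint0 D); apply: eq_cint => x _; rewrite big_nil.
rewrite big_cons -IH -cintD//; last exact: cintegrable_sum.
by apply: eq_cint => x _; rewrite big_cons.
Qed.

Lemma le_Rint D (f g : R -> R) : measurable D ->
  mu.-integrable D (EFin \o f) -> mu.-integrable D (EFin \o g) ->
  (forall x, D x -> f x <= g x) ->
  \int[mu]_(x in D) f x <= \int[mu]_(x in D) g x.
Proof. by move=> mD fi gi fg; exact: (@le_Rintegral _ _ R mu _ _ _ mD fi gi fg). Qed.

Lemma abs_Rint_le D (f g : R -> R) : measurable D ->
  mu.-integrable D (EFin \o f) -> mu.-integrable D (EFin \o g) ->
  (forall x, D x -> `|f x| <= g x) ->
  `|\int[mu]_(x in D) f x| <= \int[mu]_(x in D) g x.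
Proof.
move=> mD fi gi fg; apply: le_trans (@le_normr_Rintegral _ _ R mu _ _ mD fi) _.
by apply: le_Rint => //; exact: integrable_norm.
Qed.

(** Real and imaginary part are estimated separately, which costs the factor 2; it reappears in the
    exponent of the weight for the Volterra operator. *)
Lemma cabs_cint D f : measurable D -> cintegrable D f ->
  cabs (cint D f) <= 2 * \int[mu]_(x in D) cabs (f x).
Proof.
move=> mD fi; have [a b] := fi; have ai := integrable_cabs mD fi.
apply: le_trans (cabs_le _) _; rewrite Re_cint Im_cint mulr_natl mulr2n.
by apply: lerD; apply: abs_Rint_le => // x _; [exact: cabs_Re | exact: cabs_Im].
Qed.

Lemma AC_ReIm f : ACf f <->
  rAC (fun x => complex.Re (f x)) /\ rAC (fun x => complex.Im (f x)).
Proof.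
split=> [fA|[rA iA] e e0].
- split=> e e0; have [d d0 H] := fA _ e0; exists d => // m s t st sep sd;
    apply: le_lt_trans (H m s t st sep sd); apply: ler_sum => i _.
    by apply: le_trans (cabs_Re _); rewrite !ReIm.
  by apply: le_trans (cabs_Im _); rewrite !ReIm.
- have e20 : 0 < e / 2 by rewrite divr_gt0.
  have [d1 d10 H1] := rA _ e20; have [d2 d20 H2] := iA _ e20.
  exists (Num.min d1 d2); first by rewrite lt_min d10.
  move=> m s t st sep; rewrite lt_min => /andP[sd1 sd2].
  rewrite [e]splitr; apply: le_lt_trans (ltrD (H1 _ _ _ st sep sd1) (H2 _ _ _ st sep sd2)).
  rewrite -big_split/=; apply: ler_sum => i _.
  by apply: le_trans (cabs_le _) _; rewrite !ReIm.
Qed.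

Lemma ACM f g : ACf f -> ACf g -> ACf (fun x => f x * g x).
Proof.
move=> /AC_ReIm[a b] /AC_ReIm[c d]; apply/AC_ReIm; split.
  have := rACD (rACM a c) (rACM (rAC_cst (-1)) (rACM b d)).
  by under eq_fun do rewrite mulN1r -cReM.
have := rACD (rACM a d) (rACM b c).
by under eq_fun do rewrite -cImM.
Qed.
Lemma ACD f g : ACf f -> ACf g -> ACf (fun x => f x + g x).
Proof.
move=> /AC_ReIm[a b] /AC_ReIm[c d]; apply/AC_ReIm; split.
  by have := rACD a c; under eq_fun do rewrite -cReD.
by have := rACD b d; under eq_fun do rewrite -cImD.
Qed.
Lemma AC_cst z : ACf (fun=> z : C).
Proof. by apply/AC_ReIm; split; exact: rAC_cst. Qed.
Lemma AC_sum I (r : seq I) (F : I -> R -> C) :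
  (forall i, ACf (F i)) -> ACf (fun x => \sum_(i <- r) F i x).
Proof.
move=> mF; elim: r => [|i r IH].
  by under eq_fun do rewrite big_nil; exact: (AC_cst 0).
by under eq_fun do rewrite big_cons; exact: (ACD (mF i) IH).
Qed.

Lemma aederivD f g f' g' : aederiv f f' -> aederiv g g' ->
  aederiv (fun x => f x + g x) (fun x => f' x + g' x).
Proof.
apply: aeS2 => x H K x01; have [a b] := H x01; have [c d] := K x01; split.
  by under eq_fun do rewrite cReD; rewrite cReD; exact: is_deriveD.
by under eq_fun do rewrite cImD; rewrite cImD; exact: is_deriveD.
Qed.

Lemma aederivM f g f' g' : aederiv f f' -> aederiv g g' ->
  aederiv (fun x => f x * g x) (fun x => f' x * g x + f x * g' x).
Proof.
apply: aeS2 => x H K x01; have [a b] := H x01; have [c d] := K x01; split.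
  under eq_fun do rewrite cReM.
  set l := complex.Re _; rewrite (_ : l =
      complex.Re (f x) *: complex.Re (g' x) + complex.Re (g x) *: complex.Re (f' x) -
      (complex.Im (f x) *: complex.Im (g' x) + complex.Im (g x) *: complex.Im (f' x))).
    exact: (is_deriveB (is_deriveM a c) (is_deriveM b d)).
  by rewrite /l !ReIm /GRing.scale /=; ring.
under eq_fun do rewrite cImM.
set l := complex.Im _; rewrite (_ : l =
    complex.Re (f x) *: complex.Im (g' x) + complex.Im (g x) *: complex.Re (f' x) +
    (complex.Im (f x) *: complex.Re (g' x) + complex.Re (g x) *: complex.Im (f' x))).
  exact: (is_deriveD (is_deriveM a d) (is_deriveM b c)).
by rewrite /l !ReIm /GRing.scale /=; ring.
Qed.

Lemma aederiv_cst z : aederiv (fun=> z) (fun=> 0).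
Proof.
apply: aeI => x _; split => /=.
  exact: (@is_derive_cst _ R R _ x 1).
exact: (@is_derive_cst _ R R _ x 1).
Qed.

Lemma aederiv_sum I (r : seq I) (F F' : I -> R -> C) :
  (forall i, aederiv (F i) (F' i)) ->
  aederiv (fun x => \sum_(i <- r) F i x) (fun x => \sum_(i <- r) F' i x).
Proof.
move=> mF; elim: r => [|i r IH].
  under eq_fun do rewrite big_nil.
  by under [X in aederiv _ X]eq_fun do rewrite big_nil; exact: aederiv_cst.
under eq_fun do rewrite big_cons.
by under [X in aederiv _ X]eq_fun do rewrite big_cons; exact: aederivD.
Qed.

Definition J f x : C := cint `[0%R, x] f.

Lemma Re_J f x : complex.Re (J f x) = rJ (fun t => complex.Re (f t)) x.
Proof. by rewrite Re_cint. Qed.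
Lemma Im_J f x : complex.Im (J f x) = rJ (fun t => complex.Im (f t)) x.
Proof. by rewrite Im_cint. Qed.

Lemma J_AC f : cintegrable I01 f -> ACf (J f).
Proof.
move=> [a b]; apply/AC_ReIm; split.
  by under eq_fun do rewrite Re_J; exact: rAC_rJ.
by under eq_fun do rewrite Im_J; exact: rAC_rJ.
Qed.

Lemma J_deriv f : cintegrable I01 f -> aederiv (J f) f.
Proof.
move=> [a b]; apply: aeS2 (rJ_derive a) (rJ_derive b) => x H K x01; split.
  by under eq_fun do rewrite Re_J; exact: H.
by under eq_fun do rewrite Im_J; exact: K.
Qed.

Lemma J0 f : J f 0 = 0.
Proof. by apply: eq_ReIm; rewrite ?Re_J ?Im_J rJ0. Qed.

Lemma AC_ftc f f' : ACf f -> aederiv f f' -> cintegrable I01 f' ->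
  forall x, 0 <= x <= 1 -> f x = f 0 + J f' x.
Proof.
move=> /AC_ReIm[fr fi] ff' [f'r f'i] x x01; apply: eq_ReIm.
  rewrite cReD Re_J; apply: (rAC_ftc fr) => //.
  by apply: aeS ff' => y H /H[].
rewrite cImD Im_J; apply: (rAC_ftc fi) => //.
by apply: aeS ff' => y H /H[].
Qed.

Lemma J_zero f : cintegrable I01 f -> (forall x, 0 <= x <= 1 -> J f x = 0) ->
  {ae mu, forall x, I01 x -> f x = 0}.
Proof.
move=> [a b] H.
have /= H1 := rJ_zero a; have /= H2 := rJ_zero b.
apply: aeS2 (H1 _) (H2 _).
- by move=> x K1 K2 x01; apply: eq_ReIm; rewrite ?K1 ?K2.
- by move=> x x01; rewrite -Re_J H.
- by move=> x x01; rewrite -Im_J H.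
Qed.

End Complex.

(** * Repeated primitives *)

Section JCalculus.
Variable R : realType.
Local Notation mu := (@lebesgue_measure R).
Local Notation C := R[i].
Local Notation ACf := (@Defs.AC R 0 1).
Implicit Types (f g A W : R -> C) (x t : R).

(** The multipliers: they preserve integrability and every weighted space, and polynomials and
    primitives of integrable functions are among them. *)
Definition bmeas f := cmeas I01 f /\ exists M : R, forall x, I01 x -> cabs (f x) <= M.

Lemma I01E x : I01 x <-> 0 <= x <= 1.
Proof. by rewrite /I01 /= in_itv/=. Qed.

Lemma bmeasM f g : bmeas f -> bmeas g -> bmeas (fun x => f x * g x).
Proof.
move=> [mf [M fM]] [mg [N gN]]; split; first exact: cmeasM.
exists (M * N) => x x01; rewrite cabsM.
by apply: ler_pM; rewrite ?cabs_ge0// ?fM ?gN.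
Qed.
Lemma bmeasD f g : bmeas f -> bmeas g -> bmeas (fun x => f x + g x).
Proof.
move=> [mf [M fM]] [mg [N gN]]; split; first exact: cmeasD.
exists (M + N) => x x01; apply: le_trans (cabsD _ _) _.
by apply: lerD; rewrite ?fM ?gN.
Qed.
Lemma bmeas_cst (z : C) : bmeas (fun=> z).
Proof. by split; [exact: cmeas_cst | exists (cabs z)]. Qed.

Lemma AC_bmeas f : ACf f -> bmeas f.
Proof.
move=> /AC_ReIm[rA iA]; split; first by split; exact: rAC_measurable.
have [M HM] := rAC_bounded rA; have [N HN] := rAC_bounded iA.
exists (M + N) => x /I01E x01; apply: le_trans (cabs_le _) _.
by rewrite lerD ?HM ?HN.
Qed.

Lemma bmeas_cint f g : bmeas f -> cintegrable I01 g -> cintegrable I01 (fun x => f x * g x).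
Proof.
move=> [mf [M fM]] gi; have m01 : measurable (@I01 R) := @mI01 R.
apply: (cintegrable_le (g := fun x => M * cabs (g x))) => //.
- by apply: cmeasM => //; exact: cintegrable_cmeas.
- by apply: aeI => x x01; rewrite cabsM ler_wpM2r ?cabs_ge0// fM.
- by apply: integrable_RZ => //; exact: integrable_cabs.
Qed.

Lemma cintegrable_cst (z : C) : cintegrable I01 (fun=> z).
Proof.
have m01 : measurable (@I01 R) := @mI01 R.
have H (r : R) : mu.-integrable I01 (EFin \o (fun=> r)).
  apply: measurable_bounded_integrable => //.
  - by rewrite [X in (X < _)%E]lebesgue_measure_itv/= lte_fin ltr01 -EFinD ltry.
  - exact: bounded_cst.
by split; exact: H.
Qed.

Lemma bmeas_cintegrable f : bmeas f -> cintegrable I01 f.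
Proof.
move=> fb; apply: (@eq_cintegrable _ _ (fun x => f x * 1)); first exact: mI01.
  by move=> x _; rewrite mulr1.
by apply: bmeas_cint => //; exact: cintegrable_cst.
Qed.

Lemma J_bmeas f : cintegrable I01 f -> bmeas (J f).
Proof. by move=> fi; apply: AC_bmeas; exact: J_AC. Qed.

Lemma J_cint f : cintegrable I01 f -> cintegrable I01 (J f).
Proof. by move=> fi; apply: bmeas_cintegrable; exact: J_bmeas. Qed.

Lemma iterJ_cint f m : cintegrable I01 f -> cintegrable I01 (iter m (@J R) f).
Proof. by move=> fi; elim: m => //= m IH; exact: J_cint. Qed.

Lemma I0x x : 0 <= x <= 1 -> `[0%R, x]%classic `<=` @I01 R.
Proof. by move=> /andP[_ x1]; rewrite /I01; apply: subset_itvl; rewrite bnd_simp. Qed.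

Lemma Itx t x : 0 <= t -> x <= 1 -> `[t, x]%classic `<=` @I01 R.
Proof. by move=> t0 x1; rewrite /I01; apply: subset_itv; rewrite bnd_simp. Qed.

Lemma cint_I0x f x : 0 <= x <= 1 -> cintegrable I01 f -> cintegrable `[0%R, x] f.
Proof.
move=> x01; apply: cintegrableS => //; [exact: mI01 | exact: I0x].
Qed.

Lemma cint_Itx f t x : 0 <= t -> x <= 1 -> cintegrable I01 f -> cintegrable `[t, x] f.
Proof.
move=> t0 x1; apply: cintegrableS => //; [exact: mI01 | exact: Itx].
Qed.

Lemma eq_J f g x : 0 <= x <= 1 -> (forall y, 0 <= y <= 1 -> f y = g y) -> J f x = J g x.
Proof. by move=> x01 fg; apply: eq_cint => y /(I0x x01)/I01E /fg. Qed.

Lemma JD f g x : 0 <= x <= 1 -> cintegrable I01 f -> cintegrable I01 g ->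
  J (fun y => f y + g y) x = J f x + J g x.
Proof. by move=> x01 fi gi; apply: cintD => //; exact: cint_I0x. Qed.

Lemma JZ f z x : 0 <= x <= 1 -> cintegrable I01 f -> J (fun y => z * f y) x = z * J f x.
Proof. by move=> x01 fi; apply: cintZ => //; exact: cint_I0x. Qed.

Lemma J_sum I (r : seq I) (F : I -> R -> C) x : 0 <= x <= 1 ->
  (forall i, cintegrable I01 (F i)) ->
  J (fun y => \sum_(i <- r) F i y) x = \sum_(i <- r) J (F i) x.
Proof. by move=> x01 Fi; apply: cint_sum => // i; exact: cint_I0x. Qed.

Lemma byparts (U V u v : R -> C) x : ACf U -> ACf V -> aederiv U u -> aederiv V v ->
  cintegrable I01 u -> cintegrable I01 v -> 0 <= x <= 1 ->
  J (fun y => u y * V y + U y * v y) x = U x * V x - U 0 * V 0.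
Proof.
move=> UA VA Uu Vv ui vi x01.
rewrite (AC_ftc (ACM UA VA) (aederivM Uu Vv) _ x01); first by rewrite addrAC subrr add0r.
apply: cintegrableD; first exact: mI01.
  under eq_fun do rewrite mulrC.
  by apply: bmeas_cint => //; exact: AC_bmeas.
by apply: bmeas_cint => //; exact: AC_bmeas.
Qed.

Lemma cint_tx A t x : cintegrable I01 A -> 0 <= t -> t <= x -> x <= 1 ->
  cint `[t, x] A = J A x - J A t.
Proof.
move=> [a b] t0 tx x1.
have H (f : R -> R) : mu.-integrable I01 (EFin \o f) ->
    \int[mu]_(y in `[t, x]) f y = rJ f x - rJ f t.
  move=> fi; rewrite rJB// Rintegral_itv_obnd_cbnd//.
  apply: (@integrableS _ _ R mu I01) fi => //; first exact: mI01.
  move=> y /=; rewrite /I01/= !in_itv/= => /andP[ty yx].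
  by rewrite (le_trans t0 (ltW ty)) (le_trans yx x1).
apply: eq_ReIm; first by rewrite Re_cint cReD cReN !Re_J H.
by rewrite Im_cint cImD cImN !Im_J H.
Qed.

(** Integration by parts with the primitives of [A] and [g]: the left side is [J A x * J g x] minus
    the integral of [J A * g], and [J A x - J A t] is the integral of [A] over [t, x]. *)
Lemma J_fubini A g x : cintegrable I01 A -> cintegrable I01 g -> 0 <= x <= 1 ->
  J (fun s => A s * J g s) x = cint `[0%R, x] (fun t => cint `[t, x] A * g t).
Proof.
move=> Ai gi x01.
have := byparts (J_AC Ai) (J_AC gi) (J_deriv Ai) (J_deriv gi) Ai gi x01.
have Jgb := J_bmeas gi; have JAb := J_bmeas Ai.
rewrite JD//; last 2 first.
- by under eq_fun do rewrite mulrC; exact: bmeas_cint.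
- exact: bmeas_cint.
rewrite !J0 mul0r subr0 => H.
transitivity (J A x * J g x - J (fun y => J A y * g y) x).
  by rewrite -H addrK.
rewrite -JZ// -mulN1r -JZ//; last exact: bmeas_cint.
rewrite -JD//; last 2 first.
- by apply: cintegrableZ => //; exact: mI01.
- by apply: cintegrableZ; [exact: mI01 | exact: bmeas_cint].
apply: eq_cint => t /=; rewrite in_itv/= => /andP[t0 tx].
by rewrite cint_tx//; [rewrite mulrBl mulN1r | case/andP: x01].
Qed.

(** Divided powers: each is the derivative of the next, and the binomial theorem for them has no
    coefficients. *)
Definition ee m (y : R) : C := (y ^+ m / rfact R m)%:C.

Lemma rfact_neq0 m : rfact R m != 0.
Proof. by rewrite /rfact pnatr_eq0 -lt0n fact_gt0. Qed.

Lemma rfactS m : rfact R m.+1 = m.+1%:R * rfact R m.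
Proof. by rewrite /rfact factS natrM. Qed.

Lemma ee0 y : ee 0 y = 1.
Proof. by rewrite /ee expr0 /rfact fact0 divr1. Qed.

Lemma eeS0 m : ee m.+1 0 = 0.
Proof. by rewrite /ee expr0n mul0r. Qed.

Lemma ee_add m (x t : R) :
  ee m (x - t) = \sum_(i < m.+1) ee i x * ee (m - i) (- t).
Proof.
rewrite /ee exprDn_comm; last exact: mulrC.
rewrite mulr_suml rmorph_sum /=.
rewrite (reindex_inj rev_ord_inj)/=; apply: eq_bigr => i _.
have im : (i <= m)%N by rewrite -ltnS.
rewrite -rmorphM; congr (_%:C); rewrite subSS subKn//.
rewrite bin_sub// /rfact -(bin_fact im) !natrM -mulr_natl.
have := rfact_neq0 i; have := rfact_neq0 (m - i); rewrite /rfact => a b.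
have c : ('C(m, i))%:R != 0 :> R by rewrite pnatr_eq0 -lt0n bin_gt0.
by field; rewrite a b c.
Qed.

Lemma rAC_id : rAC (fun x : R => x).
Proof.
move=> e e0; exists e => // m s t st _ sd; apply: le_lt_trans sd.
by apply: ler_sum => i _; have [_ [sti _]] := st i; rewrite ger0_norm// subr_ge0.
Qed.

Lemma AC_ee m (c s : R) : ACf (fun x => ee m (c + s * x)).
Proof.
apply/AC_ReIm; split; last exact: rAC_cst.
have P : rAC (fun x => (c + s * x) ^+ m).
  elim: m => [|m IH]; first by under eq_fun do rewrite expr0; exact: (rAC_cst 1).
  under eq_fun do rewrite exprS.
  exact: (rACM (rACD (rAC_cst c) (rACM (rAC_cst s) (@rAC_id))) IH).
exact: (rACM P (rAC_cst (rfact R m)^-1)).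
Qed.

Lemma deriv_ee m (c s : R) :
  aederiv (fun x => ee m.+1 (c + s * x)) (fun x => s%:C * ee m (c + s * x)).
Proof.
apply: aeI => x _; split; last first.
  rewrite (_ : complex.Im (_ * _) = 0); first exact: (@is_derive_cst _ R R 0 x 1).
  by rewrite cImM /=; ring.
rewrite /ee cReM /=.
have H : is_derive x (1 : R) (fun y => c + s * y) s.
  have := is_deriveD (is_derive_cst c x 1) (is_deriveZ s (is_derive_id x (1 : R))).
  by rewrite add0r /GRing.scale /= mulr1.
have K := is_deriveZ (rfact R m.+1)^-1 (is_deriveX m.+1 H).
have -> : (fun t => (c + s * t) ^+ m.+1 / rfact R m.+1) =
    (rfact R m.+1)^-1 \*: (fun y => c + s * y) ^+ m.+1.
  by apply/funext => y /=; rewrite mulrC exprfctE.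
apply: is_derive_eq K _; rewrite /GRing.scale /= rfactS.
have a := rfact_neq0 m; have b : m.+1%:R != 0 :> R by rewrite pnatr_eq0.
by rewrite mul0r subr0; field; rewrite a /= -natr1 addrC in b *; rewrite b.
Qed.

Lemma bmeas_ee m (c s : R) : bmeas (fun x => ee m (c + s * x)).
Proof. by apply: AC_bmeas; exact: AC_ee. Qed.
Lemma bmeas_ee1 m : bmeas (fun x => ee m x).
Proof. by have := bmeas_ee m 0 1; under eq_fun do rewrite add0r mul1r. Qed.
Lemma bmeas_eeN m : bmeas (fun x => ee m (- x)).
Proof. by have := bmeas_ee m 0 (-1); under eq_fun do rewrite add0r mulN1r. Qed.
Lemma bmeas_eeB m c : bmeas (fun x => ee m (c - x)).
Proof. by have := bmeas_ee m c (-1); under eq_fun do rewrite mulN1r. Qed.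

Lemma cint_ee m (t x : R) : 0 <= t -> t <= x -> x <= 1 ->
  cint `[t, x] (fun s => ee m (x - s)) = ee m.+1 (x - t).
Proof.
move=> t0 tx x1.
rewrite cint_tx//; last by apply: bmeas_cintegrable; exact: bmeas_eeB.
have H y : 0 <= y <= 1 -> ee m.+1 (x - y) = ee m.+1 x - J (fun s => ee m (x - s)) y.
  move=> y01.
  have := AC_ftc (AC_ee m.+1 x (-1)) (deriv_ee m x (-1)) _ y01.
  rewrite mulN1r mulr0 addr0 => ->.
    congr (_ + _); rewrite JZ//.
      rewrite rmorphN1 mulN1r; congr (- _); apply: eq_J => // z _; by rewrite mulN1r.
    by apply: bmeas_cintegrable; exact: bmeas_ee.
  apply: cintegrableZ; first exact: mI01.
  by apply: bmeas_cintegrable; exact: bmeas_ee.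
have := H x; rewrite subrr eeS0 (le_trans t0 tx) x1 => /(_ isT) Hx.
have := H t; rewrite t0 (le_trans tx x1) => /(_ isT) ->.
move/eqP: Hx; rewrite eq_sym subr_eq0 => /eqP <-.
by [].
Qed.

(** Cauchy's formula. The induction splits off the innermost [J] with x held fixed, so that
    [J_fubini] applies to [A t = ee m (x - t)]. *)
Lemma iterJE m f x : cintegrable I01 f -> 0 <= x <= 1 ->
  iter m.+1 (@J R) f x = cint `[0%R, x] (fun t => ee m (x - t) * f t).
Proof.
elim: m f => [|m IH] f fi x01.
  by rewrite /=; apply: eq_cint => t _; rewrite ee0 mul1r.
rewrite iterSr IH//; last exact: J_cint.
have := J_fubini (A := fun t => ee m (x - t)) _ fi x01.
rewrite {1}/J => ->; last by apply: bmeas_cintegrable; exact: bmeas_eeB.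
apply: eq_cint => t /=; rewrite in_itv/= => /andP[t0 tx].
by rewrite cint_ee//; case/andP: x01.
Qed.

(** Two uses of Cauchy's formula leave a double integral whose factor [ee k (s - t)] mixes s and t.
    The binomial expansion makes it a sum of products, [J_fubini] exchanges the integrals in each of
    them, and the sum is folded back. *)
Lemma iterJ2E m k W f x : cintegrable I01 W -> cintegrable I01 f -> 0 <= x <= 1 ->
  iter m.+1 (@J R) (fun s => W s * iter k.+1 (@J R) f s) x =
  cint `[0%R, x] (fun t =>
    cint `[t, x] (fun s => ee m (x - s) * W s * ee k (s - t)) * f t).
Proof.
move=> Wi fi x01; have m01 : measurable (@I01 R) := @mI01 R.
have JWf : cintegrable I01 (fun s => W s * iter k.+1 (@J R) f s).
  under eq_fun do rewrite mulrC; apply: bmeas_cint => //.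
  by rewrite iterS; apply: J_bmeas; exact: iterJ_cint.
rewrite iterJE//.
have /andP[x0 x1] := x01.
pose A i s := ee m (x - s) * W s * ee i s.
have Ai i : cintegrable I01 (A i).
  rewrite /A; under eq_fun do rewrite mulrC mulrA.
  by apply: bmeas_cint => //; apply: bmeasM; [exact: bmeas_ee1 | exact: bmeas_eeB].
pose G i t := ee (k - i) (- t) * f t.
have Gi i : cintegrable I01 (G i) by apply: bmeas_cint => //; exact: bmeas_eeN.
transitivity (J (fun s => \sum_(i < k.+1) A i s * J (G i) s) x).
  apply: eq_cint => s sx; have s01 := (I01E _).1 (I0x x01 sx).
  rewrite iterJE// mulrA.
  transitivity (ee m (x - s) * W s * \sum_(i < k.+1) ee i s * J (G i) s).
    congr (_ * _).
    transitivity (J (fun t => \sum_(i < k.+1) ee i s * G i t) s).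
      apply: eq_cint => t _; rewrite ee_add mulr_suml; apply: eq_bigr => i _.
      by rewrite /G mulrA.
    rewrite J_sum//; last by move=> i; apply: cintegrableZ.
    by apply: eq_bigr => i _; rewrite JZ.
  by rewrite mulr_sumr; apply: eq_bigr => i _; rewrite /A !mulrA.
have AJi i : cintegrable I01 (fun s => A i s * J (G i) s).
  by under eq_fun do rewrite mulrC; apply: bmeas_cint => //; exact: J_bmeas.
rewrite J_sum//.
transitivity (\sum_(i < k.+1) J (fun t => cint `[t, x] (A i) * G i t) x).
  by apply: eq_bigr => i _; rewrite J_fubini.
(* A version of the integrand that is integrable on all of [0, 1]; it is matched with the integral
   over [t, x] for t <= x. *)
pose B i t := (J (A i) x - J (A i) t) * G i t.
have Bi i : cintegrable I01 (B i).
  apply: bmeas_cint => //; apply: bmeasD; first exact: bmeas_cst.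
  have := bmeasM (bmeas_cst (-1)) (J_bmeas (Ai i)).
  by under eq_fun do rewrite mulN1r.
have AE t i : 0 <= t <= x -> cint `[t, x] (A i) = J (A i) x - J (A i) t.
  by move=> /andP[t0 tx]; rewrite cint_tx.
transitivity (\sum_(i < k.+1) J (B i) x).
  apply: eq_bigr => i _; apply: eq_cint => t /=; rewrite in_itv/= => tx.
  by rewrite AE.
rewrite -J_sum//.
apply: eq_cint => t /=; rewrite in_itv/= => tx.
transitivity (\sum_(i < k.+1) cint `[t, x] (fun s => ee (k - i) (- t) * A i s) * f t).
  have /andP[t0 _] := tx.
  apply: eq_bigr => i _; rewrite cintZ//; last exact: cint_Itx.
  by rewrite AE// /B /G; ring.
rewrite -mulr_suml -cint_sum//; last first.
  move=> i; apply: cintegrableZ => //; apply: cint_Itx => //; by case/andP: tx.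
congr (_ * _); apply: eq_cint => s _.
rewrite (ee_add k) mulr_sumr; apply: eq_bigr => i _; rewrite /A; ring.
Qed.

End JCalculus.

(** * Weighted spaces and separable kernels *)

Section Weighted.
Variable R : realType.
Local Notation mu := (@lebesgue_measure R).
Local Notation C := R[i].
Local Notation ACf := (@Defs.AC R 0 1).
Implicit Types (b f g A W : R -> C) (x t : R).

(** What is used of [b], in a form invariant under passing from [b] to [1 / b]: each lemma about
    L_{2,b} thus serves for L_{2,1/b} too. *)
Definition weight b :=
  [/\ cmeas I01 b, mu.-integrable I01 (EFin \o (fun x => csq (b x))),
      mu.-integrable I01 (EFin \o (fun x => csq (b x)^-1)) &
      {ae mu, forall x, I01 x -> b x != 0}].

Lemma csqV (z : C) : csq z^-1 = (csq z)^-1.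
Proof. by rewrite !csqE cabsV exprVn. Qed.

Lemma weight_of_sqr (p0 : R -> C) b :
  cintegrable I01 p0 -> cintegrable I01 (fun x => (p0 x)^-1) ->
  {ae mu, forall x, I01 x -> p0 x != 0} -> cmeas I01 b ->
  {ae mu, forall x, I01 x -> b x ^+ 2 = p0 x} -> weight b.
Proof.
move=> pi pVi p0n mb bp; have m01 : measurable (@I01 R) := @mI01 R.
have E x : I01 x -> b x ^+ 2 = p0 x -> csq (b x) = cabs (p0 x).
  by move=> x01 <-; rewrite expr2 cabsM -expr2 -csqE.
split => //.
- apply: le_integrable_ae (integrable_cabs m01 pi) => //; first exact: cmeas_csq.
  apply: aeS bp => x H x01; rewrite ger0_norm ?csq_ge0//.
  by rewrite (E _ x01 (H x01)).
- apply: le_integrable_ae (integrable_cabs m01 pVi) => //.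
    by apply: cmeas_csq; exact: cmeasV.
  apply: aeS bp => x H x01; rewrite ger0_norm ?csq_ge0//.
  by rewrite csqV (E _ x01 (H x01)) cabsV.
- apply: aeS2 bp p0n => x H K x01; apply: contraNneq (K x01) => b0.
  by rewrite -(H x01) b0 expr0n.
Qed.

Lemma weight_inv b : weight b -> weight (winv b).
Proof.
move=> [a c d e]; split; rewrite /winv.
- exact: cmeasV.
- exact: d.
- by under [X in integrable _ _ (EFin \o X)]eq_fun do rewrite invrK.
- by apply: aeS e => x H /H; rewrite invr_eq0.
Qed.

Lemma winvK b : winv (winv b) = b.
Proof. by apply/funext => x; rewrite /winv invrK. Qed.

Lemma L2w_cmeas b f : L2w b f -> cmeas I01 f.
Proof. by case. Qed.

Lemma L2w_le b f (g : R -> R) : weight b -> cmeas I01 f ->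
  {ae mu, forall x, I01 x -> csq (b x * f x) <= g x} ->
  mu.-integrable I01 (EFin \o g) -> L2w b f.
Proof.
move=> [mb _ _ _] mf H gi; split => //.
apply: (le_integrable_ae (@mI01 R) _ _ gi).
  by apply: cmeas_csq; exact: cmeasM.
by apply: aeS H => x K x01; rewrite ger0_norm ?csq_ge0//; exact: K.
Qed.

(** Duality of the two weighted spaces: where [b] is nonzero, g f is the product of b f and g / b,
    and p q <= p^2 + q^2. *)
Lemma L2w_mul b f g : weight b -> L2w b f -> L2w (winv b) g ->
  cintegrable I01 (fun x => g x * f x).
Proof.
move=> [mb _ _ b0] [mf fi] [mg gi]; have m01 : measurable (@I01 R) := @mI01 R.
apply: (cintegrable_le m01 _ _ (integrable_RD m01 fi gi)).
  exact: cmeasM.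
apply: aeS b0 => x H x01.
have -> : g x * f x = (b x * f x) * (winv b x * g x).
  by rewrite /winv; field; exact: H.
rewrite cabsM !csqE.
set p := cabs _; set q := cabs _.
have p0 : 0 <= p := cabs_ge0 _; have q0 : 0 <= q := cabs_ge0 _.
by have := sqr_ge0 (p - q); rewrite sqrrB; nra.
Qed.

Lemma L2w_bmeas b f : weight b -> bmeas f -> L2w b f.
Proof.
move=> wb [mf [M fM]]; have [mb bi _ _] := wb.
apply: (L2w_le wb mf _ (integrable_RZ (M ^+ 2) (@mI01 R) bi)).
apply: aeI => x x01; rewrite csqM [leLHS]mulrC /= ler_wpM2r ?csq_ge0// csqE.
by rewrite lerXn2r ?nnegrE ?cabs_ge0 ?fM// (le_trans (cabs_ge0 (f x))) ?fM.
Qed.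

(** Pairing with the constant 1, which lies in the dual space because 1 / |b|^2 is integrable. *)
Lemma L2w_cint b f : weight b -> L2w b f -> cintegrable I01 f.
Proof.
move=> wb fb; have := L2w_mul wb fb (L2w_bmeas (weight_inv wb) (bmeas_cst 1)).
by under eq_fun do rewrite mul1r.
Qed.

Lemma csqD_le (z w : C) : csq (z + w) <= 2 * (csq z + csq w).
Proof.
rewrite !csqE; have := cabsD z w; have := cabs_ge0 (z + w).
set p := cabs z; set q := cabs w; set r := cabs _ => r0 rpq.
have p0 : 0 <= p := cabs_ge0 _; have q0 : 0 <= q := cabs_ge0 _.
have : r ^+ 2 <= (p + q) ^+ 2 by rewrite lerXn2r ?nnegrE ?addr_ge0.
by have := sqr_ge0 (p - q); rewrite sqrrB sqrrD; nra.
Qed.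

Lemma L2wD b f g : weight b -> L2w b f -> L2w b g -> L2w b (fun x => f x + g x).
Proof.
move=> wb [mf fi] [mg gi]; have m01 : measurable (@I01 R) := @mI01 R.
apply: (L2w_le wb _ _ (integrable_RZ 2 m01 (integrable_RD m01 fi gi))).
  exact: cmeasD.
by apply: aeI => x x01; rewrite mulrDr; exact: csqD_le.
Qed.

Lemma bmeas_L2w b f g : weight b -> bmeas f -> L2w b g -> L2w b (fun x => f x * g x).
Proof.
move=> wb [mf [M fM]] [mg gi].
apply: (L2w_le wb _ _ (integrable_RZ (M ^+ 2) (@mI01 R) gi)).
  exact: cmeasM.
apply: aeI => x x01; rewrite mulrCA [csq (f x * _)]csqM ler_wpM2r ?csq_ge0// csqE.
by rewrite lerXn2r ?nnegrE ?cabs_ge0 ?fM// (le_trans (cabs_ge0 (f x))) ?fM.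
Qed.

Lemma L2wZ b f z : weight b -> L2w b f -> L2w b (fun x => z * f x).
Proof. by move=> wb; apply: bmeas_L2w => //; exact: bmeas_cst. Qed.

Lemma L2w0 b : weight b -> L2w b (fun=> 0).
Proof. by move=> wb; apply: L2w_bmeas => //; exact: bmeas_cst. Qed.

Lemma L2w_sum b I (r : seq I) (F : I -> R -> C) : weight b ->
  (forall i, L2w b (F i)) -> L2w b (fun x => \sum_(i <- r) F i x).
Proof.
move=> wb mF; elim: r => [|i r IH].
  by under eq_fun do rewrite big_nil; exact: L2w0.
by under eq_fun do rewrite big_cons; exact: L2wD.
Qed.

Lemma eq_L2w b f g : weight b -> (forall x, I01 x -> f x = g x) -> L2w b f -> L2w b g.
Proof.
move=> wb fg [mf fi]; apply: (L2w_le wb _ _ fi); first exact: (eq_cmeas fg).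
by apply: aeI => x /fg ->.
Qed.

Lemma L2w_cabs b f : weight b -> L2w b f -> L2w b (fun x => (cabs (f x))%:C).
Proof.
move=> wb [mf fi]; apply: (L2w_le wb _ _ fi).
  by apply: cmeas_real; exact: cmeas_cabs.
by apply: aeI => x _; rewrite !csqM !(csqE (_%:C)) (csqE (f x)) cabs_real ger0_norm ?cabs_ge0.
Qed.

Variable b : R -> C.
Hypothesis wb : weight b.
Let wVb := weight_inv wb.

(** Separability gives integrability and the mapping property of the operator, but by itself only a
    product bound; the bound by a sum is therefore carried along. Both are asked on the triangle t
    <= x, where integrals over [t, x] are differences of primitives. *)
Definition adm (K : R -> R -> C) :=
  (exists (I : finType) (A B : I -> R -> C),
    (forall i, L2w (winv b) (A i) /\ L2w (winv b) (B i)) /\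
    forall x t, 0 <= t -> t <= x -> x <= 1 -> K x t = \sum_i A i x * B i t) /\
  (exists a : R -> R, L2w (winv b) (fun x => (a x)%:C) /\
    forall x t, 0 <= t -> t <= x -> x <= 1 -> cabs (K x t) <= a x + a t).

Lemma adm_ext K K' : (forall x t, 0 <= t -> t <= x -> x <= 1 -> K x t = K' x t) ->
  adm K -> adm K'.
Proof.
move=> KK [[I [A [B [AB KE]]]] [a [ai Ka]]]; split.
  by exists I, A, B; split => // x t t0 tx x1; rewrite -KK// KE.
by exists a; split => // x t t0 tx x1; rewrite -KK// Ka.
Qed.

Lemma adm0 : adm (fun _ _ => 0).
Proof.
split.
  exists void, (fun _ => fun=> 0), (fun _ => fun=> 0); split; first by case.
  by move=> x t _ _ _; rewrite big1// => -[].
exists (fun=> 0); split; first exact: (L2w0 wVb).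
by move=> x t _ _ _; rewrite cabs0 addr0.
Qed.

Lemma admD K K' : adm K -> adm K' -> adm (fun x t => K x t + K' x t).
Proof.
move=> [[I [A [B [AB KE]]]] [a [ai Ka]]] [[I' [A' [B' [AB' KE']]]] [a' [ai' Ka']]].
split.
  exists (I + I')%type, (fun i => match i with inl i => A i | inr i => A' i end),
     (fun i => match i with inl i => B i | inr i => B' i end); split.
    by case.
  by move=> x t t0 tx x1; rewrite KE// KE'// big_sumType.
exists (fun x => a x + a' x); split.
  by under eq_fun do rewrite rmorphD; exact: L2wD.
move=> x t t0 tx x1; apply: le_trans (cabsD _ _) _; rewrite addrACA.
by rewrite lerD ?Ka ?Ka'.
Qed.

Lemma adm_sum J (r : seq J) (K : J -> R -> R -> C) :
  (forall j, adm (K j)) -> adm (fun x t => \sum_(j <- r) K j x t).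
Proof.
move=> aK; elim: r => [|j r IH].
  by apply: adm_ext adm0 => x t _ _ _; rewrite big_nil.
by apply: adm_ext (admD (aK j) IH) => x t _ _ _; rewrite big_cons.
Qed.

Lemma adm_mulx c K : bmeas c -> adm K -> adm (fun x t => c x * K x t).
Proof.
move=> cb [[I [A [B [AB KE]]]] [a [ai Ka]]]; have [mc [M cM]] := cb; split.
  exists I, (fun i x => c x * A i x), B; split.
    by move=> i; have [Ai Bi] := AB i; split => //; exact: bmeas_L2w.
  by move=> x t t0 tx x1; rewrite KE// mulr_sumr; apply: eq_bigr => i _; rewrite mulrA.
exists (fun x => M * a x); split.
  by under eq_fun do rewrite rmorphM; exact: L2wZ.
move=> x t t0 tx x1; rewrite cabsM -mulrDr.
have x01 : I01 x by apply/I01E; rewrite (le_trans t0).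
by apply: ler_pM; rewrite ?cabs_ge0 ?cM ?Ka.
Qed.

Lemma adm_mult d K : bmeas d -> adm K -> adm (fun x t => K x t * d t).
Proof.
move=> cb [[I [A [B [AB KE]]]] [a [ai Ka]]]; have [mc [M cM]] := cb; split.
  exists I, A, (fun i t => d t * B i t); split.
    by move=> i; have [Ai Bi] := AB i; split => //; exact: bmeas_L2w.
  by move=> x t t0 tx x1; rewrite KE// mulr_suml; apply: eq_bigr => i _; ring.
exists (fun x => M * a x); split.
  by under eq_fun do rewrite rmorphM; exact: L2wZ.
move=> x t t0 tx x1; rewrite cabsM -mulrDr mulrC.
have t01 : I01 t by apply/I01E; rewrite t0 (le_trans tx).
by apply: ler_pM; rewrite ?cabs_ge0 ?cM ?Ka.
Qed.

Lemma admZ z K : adm K -> adm (fun x t => z * K x t).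
Proof. by apply: adm_mulx; exact: bmeas_cst. Qed.

Lemma adm_x A : L2w (winv b) A -> adm (fun x _ => A x).
Proof.
move=> Ai; split.
  exists unit, (fun=> A), (fun=> fun=> 1); split.
    by move=> _; split => //; apply: L2w_bmeas => //; exact: bmeas_cst.
  by move=> x t _ _ _; rewrite big_const card_unit /= addr0 mulr1.
exists (fun x => cabs (A x)); split; first exact: L2w_cabs.
by move=> x t _ _ _; rewrite lerDl cabs_ge0.
Qed.

Lemma adm_t A : L2w (winv b) A -> adm (fun _ t => A t).
Proof.
move=> Ai; split.
  exists unit, (fun=> fun=> 1), (fun=> A); split.
    by move=> _; split => //; apply: L2w_bmeas => //; exact: bmeas_cst.
  by move=> x t _ _ _; rewrite big_const card_unit /= addr0 mul1r.
exists (fun x => cabs (A x)); split; first exact: L2w_cabs.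
by move=> x t _ _ _; rewrite lerDr cabs_ge0.
Qed.

Lemma adm_ee m K : adm K -> adm (fun x t => ee m (x - t) * K x t).
Proof.
move=> aK.
have H : adm (fun x t => \sum_(i < m.+1) (ee i x * (K x t * ee (m - i) (- t)))).
  apply: adm_sum => i; apply: (adm_mulx (bmeas_ee1 R i)).
  exact: (adm_mult (bmeas_eeN R (m - i))).
apply: adm_ext H => x t _ _ _.
by rewrite ee_add mulr_suml; apply: eq_bigr => i _; ring.
Qed.

(** Once both divided powers are expanded, the integrals left over [t, x] are of functions of s
    alone, hence differences of values of bounded primitives. *)
Lemma adm_conv m k W : L2w (winv b) W ->
  adm (fun x t => cint `[t, x] (fun s => ee m (x - s) * W s * ee k (s - t))).
Proof.
move=> Wb; have Wi := L2w_cint wVb Wb.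
pose G i j s := ee (m - i) (- s) * ee j s * W s.
have Gi i j : cintegrable I01 (G i j).
  by apply: bmeas_cint => //; apply: bmeasM; [exact: bmeas_eeN | exact: bmeas_ee1].
have H : adm (fun x t => \sum_(i < m.+1) \sum_(j < k.+1)
    (ee i x * ((J (G i j) x + (-1) * J (G i j) t) * ee (k - j) (- t)))).
  apply: adm_sum => i; apply: adm_sum => j; apply: (adm_mulx (bmeas_ee1 R i)).
  apply: (adm_mult (bmeas_eeN R (k - j))).
  have JL : L2w (winv b) (J (G i j)) by apply: L2w_bmeas => //; exact: J_bmeas.
  exact: (admD (adm_x JL) (admZ (-1) (adm_t JL))).
apply: adm_ext H => x t t0 tx x1.
have Git i j : cintegrable `[t, x] (G i j) by apply: cint_Itx.
transitivity (cint `[t, x] (fun s => \sum_(i < m.+1) \sum_(j < k.+1)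
   (ee i x * ee (k - j) (- t)) * G i j s)).
  rewrite cint_sum//; last first.
    by move=> i; apply: cintegrable_sum => // j; apply: cintegrableZ.
  apply: eq_bigr => i _; rewrite cint_sum//; last by move=> j; apply: cintegrableZ.
  apply: eq_bigr => j _; rewrite cintZ// cint_tx//; ring.
apply: eq_cint => s _; rewrite (ee_add m) (ee_add k) !mulr_suml.
apply: eq_bigr => i _; rewrite mulr_sumr; apply: eq_bigr => j _; rewrite /G; ring.
Qed.

Definition KI (K : R -> R -> C) f x : C := cint `[0%R, x] (fun t => K x t * f t).

Lemma eq_KI K K' f x : 0 <= x <= 1 ->
  (forall x t, 0 <= t -> t <= x -> x <= 1 -> K x t = K' x t) -> KI K f x = KI K' f x.
Proof.
move=> /andP[x0 x1] KK; apply: eq_cint => t /=; rewrite in_itv/= => /andP[t0 tx].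
by rewrite KK.
Qed.

(** The products [B i * f] are integrable by duality, so the operator is a finite sum of multiples
    of the [A i] by bounded functions. Integrability and the mapping property of [KI] are read off
    from this. *)
Lemma adm_sep K : adm K -> exists (I : finType) (A B : I -> R -> C),
  [/\ forall i, L2w (winv b) (A i) /\ L2w (winv b) (B i),
      forall x t, 0 <= t -> t <= x -> x <= 1 -> K x t = \sum_i A i x * B i t &
      forall f x, L2w b f -> 0 <= x <= 1 ->
        cintegrable `[0%R, x] (fun t => K x t * f t) /\
        KI K f x = \sum_i A i x * J (fun t => B i t * f t) x].
Proof.
move=> [[I [A [B [AB KE]]]] _]; exists I, A, B; split => // f x fb x01.
have /andP[x0 x1] := x01.
have Bf i : cintegrable I01 (fun t => B i t * f t).
  by apply: (L2w_mul wb) => //; have [] := AB i.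
have E t : `[0%R, x]%classic t -> K x t * f t = \sum_i A i x * (B i t * f t).
  rewrite /= in_itv/= => /andP[t0 tx]; rewrite KE// mulr_suml.
  by apply: eq_bigr => i _; rewrite mulrA.
have Si i : cintegrable `[0%R, x] (fun t => A i x * (B i t * f t)).
  by apply: cintegrableZ => //; exact: cint_I0x.
split.
  apply: (@eq_cintegrable _ _ (fun t => \sum_i A i x * (B i t * f t))) => //.
    by move=> t xt; rewrite E.
  exact: cintegrable_sum.
rewrite /KI (eq_cint E) cint_sum//.
by apply: eq_bigr => i _; rewrite cintZ//; exact: cint_I0x.
Qed.

Lemma KI_cint K f x : adm K -> L2w b f -> 0 <= x <= 1 ->
  cintegrable `[0%R, x] (fun t => K x t * f t).
Proof. by move=> /adm_sep[I [A [B [_ _ H]]]] fb x01; have [] := H f x fb x01. Qed.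

Lemma KI_L2w K f : adm K -> L2w b f -> L2w (winv b) (KI K f).
Proof.
move=> /adm_sep[I [A [B [AB _ H]]]] fb.
apply: (@eq_L2w _ (fun x => \sum_i J (fun t => B i t * f t) x * A i x)) => //.
  move=> x /I01E x01; have [_ ->] := H f x fb x01.
  by apply: eq_bigr => i _; rewrite mulrC.
apply: L2w_sum => // i; have [Ai Bi] := AB i.
by apply: bmeas_L2w => //; apply: J_bmeas; exact: (L2w_mul wb).
Qed.

Lemma KID K K' f x : adm K -> adm K' -> L2w b f -> 0 <= x <= 1 ->
  KI (fun x t => K x t + K' x t) f x = KI K f x + KI K' f x.
Proof.
move=> aK aK' fb x01; rewrite /KI -cintD//; try exact: KI_cint.
by apply: eq_cint => t _; rewrite mulrDl.
Qed.

Lemma KIZ z K f x : adm K -> L2w b f -> 0 <= x <= 1 ->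
  KI (fun x t => z * K x t) f x = z * KI K f x.
Proof.
move=> aK fb x01; rewrite /KI -cintZ//; last exact: KI_cint.
by apply: eq_cint => t _; rewrite mulrA.
Qed.

End Weighted.

(** * Functionals represented by kernels *)

Section Rep.
Variable R : realType.
Local Notation mu := (@lebesgue_measure R).
Local Notation C := R[i].
Local Notation ACf := (@Defs.AC R 0 1).
Variable b : R -> C.
Hypothesis wb : weight b.
Let wVb := weight_inv wb.
Implicit Types (f g A W : R -> C) (x t : R) (Y Phi : nat -> R -> C).

Lemma Wfam_bmeas n Y nu : Wfam b n Y -> (nu < n)%N -> bmeas (Y nu).
Proof. by move=> [H _] /H[/AC_bmeas]. Qed.

Lemma Wfam_L2w n Y nu : Wfam b n Y -> (nu <= n)%N -> L2w b (Y nu).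
Proof.
move=> YW; rewrite leq_eqVlt => /predU1P[->|nun]; first by case: YW.
by apply: L2w_bmeas => //; exact: Wfam_bmeas YW nun.
Qed.

Lemma Wfam_cint n Y nu : Wfam b n Y -> (nu <= n)%N -> cintegrable I01 (Y nu).
Proof. by move=> YW nun; apply: (L2w_cint wb); exact: Wfam_L2w YW nun. Qed.

Lemma Wfam_ftc n Y nu x : Wfam b n Y -> (nu < n)%N -> 0 <= x <= 1 ->
  Y nu x = Y nu 0 + J (Y nu.+1) x.
Proof.
move=> YW nun x01; have [H _] := YW; have [YA YD] := H _ nun.
by apply: AC_ftc => //; exact: Wfam_cint YW nun.
Qed.

Lemma J_ee m x : 0 <= x <= 1 -> J (ee m) x = ee m.+1 x :> C.
Proof.
move=> x01; have := AC_ftc (AC_ee m.+1 0 1) (deriv_ee m 0 1) _ x01.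
rewrite mulr0 addr0 eeS0 add0r add0r mul1r => ->.
  by apply: eq_J => // y _; rewrite add0r mul1r mul1r.
apply: cintegrableZ; first exact: mI01.
by apply: bmeas_cintegrable; exact: bmeas_ee.
Qed.

Lemma iterJ_bmeas k f : cintegrable I01 f -> bmeas (iter k.+1 (@J R) f).
Proof. by move=> fi; rewrite iterS; apply: J_bmeas; exact: iterJ_cint. Qed.

Lemma eq_iterJ k f g x : 0 <= x <= 1 -> (forall y, 0 <= y <= 1 -> f y = g y) ->
  iter k (@J R) f x = iter k (@J R) g x.
Proof.
by elim: k x => [|k IH] x x01 fg /=; [exact: fg | apply: eq_J => // y y01; exact: IH].
Qed.

Lemma iterJD k f g x : 0 <= x <= 1 -> cintegrable I01 f -> cintegrable I01 g ->
  iter k (@J R) (fun y => f y + g y) x = iter k (@J R) f x + iter k (@J R) g x.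
Proof.
elim: k x => [//|k IH] x x01 fi gi /=.
by rewrite -JD//; [apply: eq_J => // y y01; exact: IH | exact: iterJ_cint ..].
Qed.

Lemma iterJZ k z f x : 0 <= x <= 1 -> cintegrable I01 f ->
  iter k (@J R) (fun y => z * f y) x = z * iter k (@J R) f x.
Proof.
elim: k x => [//|k IH] x x01 fi /=.
by rewrite -JZ//; [apply: eq_J => // y y01; exact: IH | exact: iterJ_cint].
Qed.

Lemma iterJ_sum k I (r : seq I) (F : I -> R -> C) x : 0 <= x <= 1 ->
  (forall i, cintegrable I01 (F i)) ->
  iter k (@J R) (fun y => \sum_(i <- r) F i y) x = \sum_(i <- r) iter k (@J R) (F i) x.
Proof.
move=> x01 Fi; elim: k x x01 => [//|k IH] x x01 /=.
rewrite -J_sum//; last by move=> i; exact: iterJ_cint.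
by apply: eq_J => // y y01; exact: IH.
Qed.

(** The factor of y^(m)(0) in the Taylor expansion at 0 of the derivative of y of order n - mu';
    lower derivatives do not occur in it. *)
Definition tayl n mu' m x : C := if (n - mu' <= m)%N then ee (m - (n - mu')) x else 0.

Lemma tayl_bmeas n k m : bmeas (tayl n k m).
Proof.
rewrite /tayl; case: (n - k <= m)%N; [exact: bmeas_ee1 | exact: bmeas_cst].
Qed.

Lemma taylor n Y k x : Wfam b n Y -> (k <= n)%N -> 0 <= x <= 1 ->
  Y (n - k)%N x = \sum_(m < n) Y m 0 * tayl n k m x + iter k (@J R) (Y n) x.
Proof.
move=> YW; elim: k x => [|k IH] x kn x01.
  rewrite subn0 big1 ?add0r// => m _; rewrite /tayl subn0 leqNgt ltn_ord /=.
  by rewrite mulr0.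
have nkE : (n - k = (n - k.+1).+1)%N by rewrite subnSK.
have nkn : (n - k.+1 < n)%N by rewrite -subn_gt0 subKn.
rewrite (Wfam_ftc YW nkn x01) -nkE.
transitivity (Y (n - k.+1)%N 0 +
   J (fun y => \sum_(m < n) Y m 0 * tayl n k m y + iter k (@J R) (Y n) y) x).
  by congr (_ + _); apply: eq_J => // y y01; rewrite IH// ltnW.
have Yi : cintegrable I01 (Y n) by exact: Wfam_cint YW (leqnn n).
have ti m : cintegrable I01 (fun y => Y m 0 * tayl n k m y).
  apply: cintegrableZ; first exact: mI01.
  by apply: bmeas_cintegrable; exact: tayl_bmeas.
rewrite JD//; last 2 first.
- by apply: cintegrable_sum => //; exact: mI01.
- exact: iterJ_cint.
rewrite addrA /=; congr (_ + _); rewrite J_sum//.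
have -> : Y (n - k.+1)%N 0 = \sum_(m < n) Y m 0 * (val m == n - k.+1)%N%:R.
  rewrite (bigD1 (Ordinal nkn))//= eqxx mulr1 big1 ?addr0// => i /negbTE.
  by rewrite -val_eqE /= => ->; rewrite mulr0.
rewrite -big_split/=; apply: eq_bigr => m _.
rewrite JZ//; last by apply: bmeas_cintegrable; exact: tayl_bmeas.
rewrite -mulrDr; congr (_ * _); rewrite /tayl nkE.
(* Smaller m do not contribute, for larger m the power goes up by one, and m = n - k.+1 is the new
   constant term. *)
have [mlt|mgt|->] := ltngtP m (n - k.+1)%N.
- by rewrite add0r; apply: cint0.
- by rewrite add0r J_ee// subnSK.
- by rewrite subnn ee0 /J cint0 addr0.
Qed.

Lemma cint_J f : cint I01 f = J f 1. Proof. by []. Qed.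

(** Each step replaces [g] by its primitive; the boundary terms vanish because [Phi (n - k.+1)] is
    zero at both ends. *)
Lemma byparts_iter n Phi k g : Wcirc b n Phi -> (k <= n)%N -> cintegrable I01 g ->
  cint I01 (fun x => g x * Phi (n - k)%N x) =
  (-1) ^+ k * cint I01 (fun x => iter k (@J R) g x * Phi n x).
Proof.
move=> [PW P0]; elim: k g => [|k IH] g kn gi; first by rewrite subn0 expr0 mul1r.
have nkE : (n - k = (n - k.+1).+1)%N by rewrite subnSK.
have nkn : (n - k.+1 < n)%N by rewrite -subn_gt0 subKn.
have [PA PD] := (PW.1 _ nkn); have [P00 P01] := P0 _ nkn.
have i1 : 0 <= (1 : R) <= 1 by rewrite ler01 lexx.
have Pi : cintegrable I01 (Phi (n - k.+1).+1) by apply: Wfam_cint PW _.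
have := byparts (J_AC gi) PA (J_deriv gi) PD gi Pi i1.
rewrite P01 P00 !mulr0 subrr JD//; last 2 first.
- under eq_fun do rewrite mulrC.
  by apply: bmeas_cint => //; exact: AC_bmeas.
- by apply: bmeas_cint => //; exact: J_bmeas.
move=> /eqP; rewrite addr_eq0 => /eqP; rewrite -!cint_J => ->.
rewrite -nkE IH//; [|exact: ltnW|exact: J_cint].
by rewrite -iterSr exprS mulN1r mulNr.
Qed.

(* [F] is the functional of the kernel [K] up to terms depending on [Y] only
   through its values at 0. *)
Definition rep n (F : (nat -> R -> C) -> (nat -> R -> C) -> C) (K : R -> R -> C) :=
  adm b K /\ exists u : nat -> R -> C,
    (forall nu, L2w (winv b) (u nu)) /\
    forall Y Phi, Wfam b n Y -> Wcirc b n Phi ->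
      F Y Phi = cint I01 (fun x => (KI K (Y n) x + Cop n u Y x) * Phi n x).

Lemma Cop_L2w n u Y : (forall nu, L2w (winv b) (u nu)) -> L2w (winv b) (Cop n u Y).
Proof.
move=> ub; rewrite /Cop; apply: (L2w_sum _ wVb) => i; exact: L2wZ.
Qed.

Lemma rep_ext n F F' K K' : rep n F K ->
  (forall Y Phi, Wfam b n Y -> Wcirc b n Phi -> F' Y Phi = F Y Phi) ->
  (forall x t, 0 <= t -> t <= x -> x <= 1 -> K x t = K' x t) -> rep n F' K'.
Proof.
move=> [aK [u [ub FE]]] FF KK; split; first exact: (adm_ext KK aK).
exists u; split=> [//|Y Phi YW PW]; rewrite (FF _ _ YW PW) (FE _ _ YW PW).
by apply: eq_cint => x /I01E x01; rewrite (eq_KI _ x01 KK).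
Qed.

Lemma rep0 n : rep n (fun _ _ => 0) (fun _ _ => 0).
Proof.
split; first exact: adm0.
exists (fun _ _ => 0); split => [nu|Y Phi _ _]; first exact: L2w0.
rewrite -[LHS](cint0 I01); apply: eq_cint => x _; rewrite /KI /Cop.
rewrite big1 => [|i _]; last by rewrite mulr0.
rewrite addr0 (_ : cint _ _ = 0) ?mul0r//.
by rewrite -[RHS](cint0 `[0%R, x]); apply: eq_cint => t _; rewrite mul0r.
Qed.

Lemma repD n F F' K K' : rep n F K -> rep n F' K' ->
  rep n (fun Y Phi => F Y Phi + F' Y Phi) (fun x t => K x t + K' x t).
Proof.
move=> [aK [u [ub FE]]] [aK' [u' [ub' FE']]]; split; first exact: admD.
exists (fun nu x => u nu x + u' nu x); split => [nu|Y Phi YW PW]; first exact: L2wD.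
have Yn : L2w b (Y n) by case: YW.
have Pn : L2w b (Phi n) by case: PW => -[].
rewrite (FE _ _ YW PW) (FE' _ _ YW PW) -cintD; last 3 first.
- exact: mI01.
- apply: (L2w_mul wb Pn); apply: (L2wD wVb); [exact: KI_L2w | exact: Cop_L2w].
- apply: (L2w_mul wb Pn); apply: (L2wD wVb); [exact: KI_L2w | exact: Cop_L2w].
apply: eq_cint => x /I01E x01; rewrite (KID wb aK aK' Yn x01) -mulrDl; congr (_ * _).
rewrite addrACA; congr (_ + _); rewrite /Cop -big_split/=.
by apply: eq_bigr => i _; rewrite mulrDr.
Qed.

Lemma repZ n z F K : rep n F K ->
  rep n (fun Y Phi => z * F Y Phi) (fun x t => z * K x t).
Proof.
move=> [aK [u [ub FE]]]; split; first exact: admZ.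
exists (fun nu x => z * u nu x); split => [nu|Y Phi YW PW]; first exact: L2wZ.
have Yn : L2w b (Y n) by case: YW.
have Pn : L2w b (Phi n) by case: PW => -[].
rewrite (FE _ _ YW PW) -cintZ; last 2 first.
- exact: mI01.
- apply: (L2w_mul wb Pn); apply: (L2wD wVb); [exact: KI_L2w | exact: Cop_L2w].
apply: eq_cint => x /I01E x01; rewrite (KIZ wb z aK Yn x01) mulrA; congr (_ * _).
rewrite mulrDr; congr (_ + _); rewrite /Cop mulr_sumr.
by apply: eq_bigr => i _; rewrite mulrCA.
Qed.

Lemma rep_sum n I (r : seq I) F K : (forall i, rep n (F i) (K i)) ->
  rep n (fun Y Phi => \sum_(i <- r) F i Y Phi) (fun x t => \sum_(i <- r) K i x t).
Proof.
move=> H; elim: r => [|i r IH].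
  by apply: rep_ext (rep0 n) _ _ => *; rewrite big_nil.
by apply: rep_ext (repD (H i) IH) _ _ => *; rewrite big_cons.
Qed.

Definition elem_term n nu k W (Y Phi : nat -> R -> C) : C :=
  cint I01 (fun x => W x * (Phi (n - nu)%N x * Y (n - k)%N x)).

(** The common scheme for one Leibniz term: [K] has to realise the operator J^nu W J^k on L_{2,b}.
    The last condition excludes nu = k = 0, where W, y^(n) and phi^(n) would meet and the integral
    need not exist. *)
Lemma rep_elem n nu k W K : L2w (winv b) W -> (nu <= n)%N -> (k <= n)%N ->
  adm b K ->
  (forall f x, L2w b f -> 0 <= x <= 1 ->
    KI K f x = iter nu (@J R) (fun s => W s * iter k (@J R) f s) x) ->
  (k = 0 -> nu <> 0)%N ->
  rep n (elem_term n nu k W) (fun x t => (-1) ^+ nu * K x t).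
Proof.
move=> Wb nun kn aK KE knu; have m01 : measurable (@I01 R) := @mI01 R.
have Wi := L2w_cint wVb Wb.
have WT m : L2w (winv b) (fun s => W s * tayl n k m s).
  by under eq_fun do rewrite mulrC; apply: bmeas_L2w => //; exact: tayl_bmeas.
(* What the Taylor polynomial contributes to C: the image of the factor of [Y m 0] under J^nu W,
   with the sign of the integrations by parts. *)
pose u m x := (-1) ^+ nu * iter nu (@J R) (fun s => W s * tayl n k m s) x.
have ub m : L2w (winv b) (u m).
  apply: L2wZ => //; case: (nu) => [|nu']; first exact: WT.
  by apply: L2w_bmeas => //; apply: iterJ_bmeas; exact: (L2w_cint wVb).
split; first exact: admZ.
exists u; split => // Y Phi YW PW.
have Yn : L2w b (Y n) by case: YW.
have WJ : cintegrable I01 (fun s => W s * iter k (@J R) (Y n) s).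
  case: (k) => [|k']; first exact: (L2w_mul wb).
  under eq_fun do rewrite mulrC; apply: bmeas_cint => //; apply: iterJ_bmeas.
  exact: (L2w_cint wb).
have WY : cintegrable I01 (fun s => W s * Y (n - k)%N s).
  by apply: (L2w_mul wb) => //; apply: Wfam_L2w YW _; exact: leq_subr.
transitivity (cint I01 (fun x => (W x * Y (n - k)%N x) * Phi (n - nu)%N x)).
  by apply: eq_cint => x _; ring.
rewrite (byparts_iter PW)// -cintZ//; last first.
  apply: (L2w_mul wb); first by case: PW => -[].
  case: (nu) knu => [|nu'] knu; last by apply: L2w_bmeas => //; exact: iterJ_bmeas.
  case: (k) knu kn => [|k'] knu kn; first by case: (knu erefl).
  apply: (eq_L2w wVb (f := fun s => Y (n - k'.+1)%N s * W s)).
    by move=> x _; rewrite mulrC.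
  apply: bmeas_L2w => //; apply: Wfam_bmeas YW _; rewrite -subn_gt0 subKn//.
apply: eq_cint => x /I01E x01; rewrite mulrA; congr (_ * _).
rewrite (KIZ wb _ aK Yn x01) KE//.
transitivity ((-1) ^+ nu * iter nu (@J R)
   (fun s => \sum_(m < n) Y m 0 * (W s * tayl n k m s) + W s * iter k (@J R) (Y n) s) x).
  congr (_ * _); apply: eq_iterJ => // y y01; rewrite (taylor YW)// mulrDr.
  by congr (_ + _); rewrite mulr_sumr; apply: eq_bigr => m _; rewrite mulrCA.
have Si m : cintegrable I01 (fun s => Y m 0 * (W s * tayl n k m s)).
  by apply: cintegrableZ => //; exact: (L2w_cint wVb).
rewrite iterJD//; last by apply: cintegrable_sum.
rewrite mulrDr addrC; congr (_ + _).
rewrite iterJ_sum// /Cop mulr_sumr; apply: eq_bigr => m _.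
by rewrite /u (iterJZ nu (Y m 0) x01 (L2w_cint wVb (WT m))) mulrCA.
Qed.

(** The three shapes of summand in the kernel come from three cases. Here no derivative is missing
    on phi, and Cauchy's formula for the iterated primitive of y^(n) suffices; in [rep_right] none
    is missing on y, in [rep_mid] both miss some. *)
Lemma rep_left n k W : L2w (winv b) W -> (k < n)%N ->
  rep n (elem_term n 0 k.+1 W) (fun x t => W x * ee k (x - t)).
Proof.
move=> Wb kn.
have aK : adm b (fun x t => ee k (x - t) * W x) by apply: adm_ee => //; exact: adm_x.
have aK' : adm b (fun x t => W x * ee k (x - t)).
  by apply: adm_ext aK => *; rewrite mulrC.
apply: rep_ext (rep_elem Wb (leq0n n) kn aK' _ _) _ _ => //.
- move=> f x fb x01; have fi := L2w_cint wb fb.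
  rewrite /= -[J _ x]/(iter k.+1 (@J R) f x) iterJE//.
  rewrite -cintZ//; first by apply: eq_cint => t _; rewrite mulrA.
  by apply: cint_I0x => //; apply: bmeas_cint => //; exact: bmeas_eeB.
- by move=> x t _ _ _; rewrite expr0 mul1r.
Qed.

Lemma rep_right n k W : L2w (winv b) W -> (k < n)%N ->
  rep n (elem_term n k.+1 0 W) (fun x t => (-1) ^+ k.+1 * (ee k (x - t) * W t)).
Proof.
move=> Wb kn.
have aK : adm b (fun x t => ee k (x - t) * W t) by apply: adm_ee => //; exact: adm_t.
apply: (rep_elem Wb kn (leq0n n) aK) => // f x fb x01.
rewrite iterJE//; last exact: (L2w_mul wb).
by apply: eq_cint => t _; rewrite mulrA.
Qed.

Lemma rep_mid n nu k W : L2w (winv b) W -> (nu < n)%N -> (k < n)%N ->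
  rep n (elem_term n nu.+1 k.+1 W) (fun x t => (-1) ^+ nu.+1 *
    cint `[t, x] (fun s => ee nu (x - s) * W s * ee k (s - t))).
Proof.
move=> Wb nun kn; apply: (rep_elem Wb nun kn) => //; first exact: adm_conv.
by move=> f x fb x01; rewrite iterJ2E//; [exact: (L2w_cint wVb) | exact: (L2w_cint wb)].
Qed.

End Rep.

(** * The functional ell *)

Section Ell.
Variable R : realType.
Local Notation mu := (@lebesgue_measure R).
Local Notation C := R[i].
Local Notation ACf := (@Defs.AC R 0 1).
Variable b : R -> C.
Hypothesis wb : weight b.
Let wVb := weight_inv wb.
Implicit Types (f g A W : R -> C) (x t : R) (Y Phi : nat -> R -> C).

Lemma diterE m (F : Distr R) Phi : diter m F Phi = (-1) ^+ m * F (Defs.shift m Phi).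
Proof.
elim: m Phi => [|m IH] Phi; first by rewrite expr0 mul1r.
by rewrite /diter iterS /dderiv -/(diter m F) IH exprS mulN1r mulNr.
Qed.

(** Pascal's rule, at one point: the product rule turns the Leibniz sum of order m into the one of
    order m + 1. *)
Lemma leib_rec (P Y : nat -> C) m :
  \sum_(i < m.+1) ('C(m, i))%:R * (P i.+1 * Y (m - i)%N + P i * Y (m - i).+1) =
  \sum_(i < m.+2) ('C(m.+1, i))%:R * (P i * Y (m.+1 - i)%N).
Proof.
under eq_bigr do rewrite mulrDr.
rewrite big_split /= [RHS]big_ord_recl /= bin0 mul1r subn0.
have -> : \sum_(i < m.+1) ('C(m.+1, bump 0 i))%:R * (P (bump 0 i) * Y (m.+1 - bump 0 i)%N) =
  \sum_(i < m.+1) ('C(m, i.+1))%:R * (P i.+1 * Y (m - i)%N) +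
  \sum_(i < m.+1) ('C(m, i))%:R * (P i.+1 * Y (m - i)%N).
  by rewrite -big_split /=; apply: eq_bigr => i _; rewrite /bump /= add1n binS natrD mulrDl subSS.
rewrite addrA addrC; congr (_ + _).
rewrite big_ord_recl /= bin0 mul1r subn0; congr (_ + _).
rewrite [RHS]big_ord_recr /= bin_small// mul0r addr0.
by apply: eq_bigr => i _; rewrite /bump /= add1n subnSK.
Qed.

(** The functionals are known only on families in [Wcirc], so the products they are applied to must
    be placed there. The last condition ensures that in the k-th derivative of the product no term
    has both factors of order n. *)
Lemma leib_Wcirc n Y Phi d e k : Wfam b n Y -> Wcirc b n Phi ->
  (d + k <= n)%N -> (e + k <= n)%N -> (d < n)%N || (e < n)%N ->
  Wcirc b k (leib (Defs.shift d Phi) (Defs.shift e Y)).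
Proof.
move=> YW PW dk ek de; have [PF P0] := PW.
have di i nu : (nu < k)%N -> (i <= nu)%N -> (d + i < n)%N.
  by move=> nuk inu; apply: leq_trans dk; rewrite ltn_add2l (leq_ltn_trans inu).
have ei i nu : (nu < k)%N -> (i <= nu)%N -> (e + i < n)%N.
  by move=> nuk inu; apply: leq_trans ek; rewrite ltn_add2l (leq_ltn_trans inu).
split; first split.
- move=> nu nuk; split.
    rewrite /leib; apply: AC_sum => i.
    have inu : (i <= nu)%N by rewrite -ltnS.
    have [PA _] := PF.1 _ (di i nu nuk inu).
    have [YA _] := YW.1 _ (ei (nu - i)%N nu nuk (leq_subr _ _)).
    exact: (ACM (AC_cst _) (ACM PA YA)).
  (* The summand with factor 0 comes from differentiating the binomial coefficient: the sum gets the
     literal form that the product rule produces. *)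
  have -> : leib (Defs.shift d Phi) (Defs.shift e Y) nu.+1 = fun x => \sum_(i < nu.+1)
      (0 * (Phi (d + i)%N x * Y (e + (nu - i))%N x) + ('C(nu, i))%:R *
        (Phi (d + i).+1 x * Y (e + (nu - i))%N x + Phi (d + i)%N x * Y (e + (nu - i)).+1 x)).
    apply/funext => x; rewrite /leib /Defs.shift.
    rewrite -(leib_rec (fun i => Phi (d + i)%N x) (fun i => Y (e + i)%N x)).
    by apply: eq_bigr => i _; rewrite mul0r add0r !addnS.
  rewrite /leib; apply: aederiv_sum => i.
  have inu : (i <= nu)%N by rewrite -ltnS.
  have [_ PD] := PF.1 _ (di i nu nuk inu).
  have [_ YD] := YW.1 _ (ei (nu - i)%N nu nuk (leq_subr _ _)).
  exact: (aederivM (aederiv_cst _) (aederivM PD YD)).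
- rewrite /leib /Defs.shift; apply: (L2w_sum _ wb) => i; apply: L2wZ => //.
  have ik : (i <= k)%N by rewrite -ltnS.
  have eki : (e + (k - i) <= n)%N by apply: leq_trans ek; rewrite leq_add2l leq_subr.
  have [dn|dn] := boolP (d + i < n)%N.
    by apply: bmeas_L2w => //; [exact: (Wfam_bmeas PF dn) | exact: (Wfam_L2w wb YW eki)].
  have diE : (d + i = d + k)%N.
    apply/eqP; rewrite eqn_leq leq_add2l ik /=; rewrite -leqNgt in dn.
    exact: leq_trans dk dn.
  have iE : i = k :> nat by move/eqP: diE; rewrite eqn_add2l => /eqP.
  have en : (e + (k - i) < n)%N.
    rewrite iE subnn addn0; case/orP: de => // dn'.
    have k0 : (0 < k)%N.
      by rewrite lt0n; apply: contraNneq dn => k0; rewrite iE k0 addn0.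
    by apply: leq_trans ek; rewrite -addn1 leq_add2l.
  apply: (eq_L2w wb (f := fun x => Y (e + (k - i))%N x * Phi (d + i)%N x)).
    by move=> x _; rewrite mulrC.
  apply: bmeas_L2w => //; first exact: (Wfam_bmeas YW en).
  by apply: (Wfam_L2w wb PF); rewrite diE.
- move=> nu nuk; rewrite /leib /Defs.shift; split; rewrite big1// => i _;
    have inu : (i <= nu)%N by [rewrite -ltnS];
    have [P00 P01] := P0 _ (di i nu nuk inu); rewrite ?P00 ?P01 mul0r mulr0//.
Qed.

Lemma sign_sub n k : (k <= n)%N -> (-1) ^+ (n - k) * (-1) ^+ k = (-1) ^+ n :> C.
Proof. by move=> kn; rewrite -exprD subnK. Qed.

Lemma elem_int n nu k W Y Phi : L2w (winv b) W -> (0 < nu)%N || (0 < k)%N ->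
  (nu <= n)%N -> (k <= n)%N -> Wfam b n Y -> Wcirc b n Phi ->
  cintegrable I01 (fun x => W x * (Phi (n - nu)%N x * Y (n - k)%N x)).
Proof.
move=> Wb nuk nun kn YW [PW _]; apply: (L2w_mul wb) => //.
have [nu0|nu0] := posnP nu.
  have k0 : (0 < k)%N by move: nuk; rewrite nu0.
  apply: (eq_L2w wb (f := fun x => Y (n - k)%N x * Phi (n - nu)%N x)).
    by move=> x _; rewrite mulrC.
  apply: bmeas_L2w => //; first by apply: (Wfam_bmeas YW); rewrite -subn_gt0 subKn.
  by apply: (Wfam_L2w wb PW); rewrite leq_subr.
apply: bmeas_L2w => //; first by apply: (Wfam_bmeas PW); rewrite -subn_gt0 subKn.
by apply: (Wfam_L2w wb YW); rewrite leq_subr.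
Qed.

(* Reindexing of the Leibniz expansion by the number of derivatives missing
   on [Phi]. *)
Lemma cint_leib n W k a c Y Phi :
  (forall nu, (nu <= k)%N -> cintegrable I01 (fun x =>
    W x * (Phi (n - (a + nu))%N x * Y (n - (c - nu))%N x))) ->
  (a + k <= n)%N -> (k <= c)%N -> (c <= n)%N ->
  cint I01 (fun x => W x * leib (Defs.shift (n - (a + k))%N Phi) (Defs.shift (n - c)%N Y) k x) =
  \sum_(nu < k.+1) ('C(k, nu))%:R * elem_term n (a + nu) (c - nu) W Y Phi.
Proof.
move=> Wi akn kc cn.
transitivity (cint I01 (fun x => \sum_(nu < k.+1) ('C(k, nu))%:R *
   (W x * (Phi (n - (a + nu))%N x * Y (n - (c - nu))%N x)))).
  apply: eq_cint => x _; rewrite /leib /Defs.shift mulr_sumr.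
  rewrite (reindex_inj rev_ord_inj)/=; apply: eq_bigr => i _.
  have ik : (i <= k)%N by rewrite -ltnS.
  rewrite subSS bin_sub// subKn// mulrCA; congr (_ * (_ * (Phi _ x * Y _ x))).
    by lia.
  by lia.
rewrite cint_sum; [|exact: mI01|].
  apply: eq_bigr => i _; rewrite cintZ; [by []|exact: mI01|].
  by apply: Wi; rewrite -ltnS.
move=> i; apply: cintegrableZ; first exact: mI01.
by apply: Wi; rewrite -ltnS.
Qed.

End Ell.

(** * The kernel of the functional ell *)

Section EllRep.
Variable R : realType.
Local Notation mu := (@lebesgue_measure R).
Local Notation C := R[i].
Variable b : R -> C.
Hypothesis wb : weight b.
Let wVb := weight_inv wb.
Implicit Types (f g A W P Q : R -> C) (x t : R) (Y Phi : nat -> R -> C).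

Lemma ell_p n (p : Distr R) P k Y Phi : (1 <= k <= n)%N -> Wneg b k p P ->
  Wfam b n Y -> Wcirc b n Phi ->
  diter (n - k)%N (dmul p (Defs.shift (n - k)%N Y)) Phi =
  (-1) ^+ n * \sum_(nu < k.+1) ('C(k, nu))%:R * elem_term n nu (k - nu) P Y Phi.
Proof.
move=> /andP[k1 kn] [Pb Pk] YW PW; rewrite diterE /dmul Pk; last first.
  by apply: (leib_Wcirc wb YW PW); lia.
rewrite mulrA sign_sub//; congr (_ * _).
by rewrite (cint_leib (a := 0) (c := k))// => nu nuk; apply: (elem_int wb) => //; lia.
Qed.

Lemma ell_q1 n (q : Distr R) Q k Y Phi : (k < n)%N -> Wneg b k q Q ->
  Wfam b n Y -> Wcirc b n Phi ->
  diter (n - k)%N (dmul q (Defs.shift (n - k - 1)%N Y)) Phi =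
  (-1) ^+ n * \sum_(nu < k.+1) ('C(k, nu))%:R * elem_term n nu (k.+1 - nu) Q Y Phi.
Proof.
move=> kn [Qb Qk] YW PW; rewrite diterE /dmul Qk; last first.
  by apply: (leib_Wcirc wb YW PW); lia.
rewrite mulrA sign_sub ?(ltnW kn)//; congr (_ * _).
have -> : (n - k - 1 = n - k.+1)%N by lia.
rewrite (cint_leib (a := 0) (c := k.+1)) //; last by rewrite add0n; lia.
by move=> nu nuk; apply: (elem_int wb) => //; lia.
Qed.

(** The functional is differentiated once less than in [ell_q1]: the total order is n - 1, so the
    sign is opposite, and phi misses one derivative more. This is the origin of the differences of
    binomial coefficients in K. *)
Lemma ell_q2 n (q : Distr R) Q k Y Phi : (k < n)%N -> Wneg b k q Q ->
  Wfam b n Y -> Wcirc b n Phi ->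
  diter (n - k - 1)%N (dmul q (Defs.shift (n - k)%N Y)) Phi =
  - ((-1) ^+ n * \sum_(nu < k.+1) ('C(k, nu))%:R * elem_term n nu.+1 (k - nu) Q Y Phi).
Proof.
move=> kn [Qb Qk] YW PW; rewrite diterE /dmul Qk; last first.
  by apply: (leib_Wcirc wb YW PW); lia.
rewrite mulrA -exprD -mulNr.
have -> : - (-1) ^+ n = (-1) ^+ (n - k - 1 + k) :> C.
  have -> : (n - k - 1 + k = n.-1)%N by lia.
  by rewrite -[in LHS](prednK (leq_ltn_trans (leq0n k) kn)) exprS mulN1r opprK.
congr (_ * _).
have -> : (n - k - 1 = n - (1 + k))%N by lia.
rewrite (cint_leib (a := 1) (c := k))//; last by lia.
by move=> nu nuk; apply: (elem_int wb) => //; lia.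
Qed.

Lemma elem_term_lin n nu k W V z1 z2 Y Phi : L2w (winv b) W -> L2w (winv b) V ->
  (0 < nu)%N || (0 < k)%N -> (nu <= n)%N -> (k <= n)%N ->
  Wfam b n Y -> Wcirc b n Phi ->
  elem_term n nu k (fun x => z1 * W x + z2 * V x) Y Phi =
  z1 * elem_term n nu k W Y Phi + z2 * elem_term n nu k V Y Phi.
Proof.
move=> Wb Vb nuk nun kn YW PW; have m01 : measurable (@I01 R) := @mI01 R.
have Wi := elem_int wb Wb nuk nun kn YW PW.
have Vi := elem_int wb Vb nuk nun kn YW PW.
rewrite /elem_term -!cintZ// -cintD//; try exact: cintegrableZ.
by apply: eq_cint => x _; ring.
Qed.

(** The contributions of p_{j+1} and q_j belong together: in each of their terms y and phi jointly
    miss j + 1 derivatives. *)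
Definition ell_part n P Q j Y Phi : C :=
  \sum_(nu < j.+2) ('C(j.+1, nu))%:R * elem_term n nu (j.+1 - nu) P Y Phi +
  'i * (\sum_(nu < j.+1) ('C(j, nu))%:R * elem_term n nu (j.+1 - nu) Q Y Phi -
        \sum_(nu < j.+1) ('C(j, nu))%:R * elem_term n nu.+1 (j - nu) Q Y Phi).

Definition Kmid P Q j nu x : C :=
  ('C(j.+1, nu.+1))%:R * P x + 'i * (('C(j, nu.+1))%:R - ('C(j, nu))%:R) * Q x.

(** The extreme terms, with all missing derivatives on one side, carry P + iQ and P - iQ; in
    between, the two sums over Q overlap after a shift of the index. The factors 1 fit the form of
    [elem_term_lin]. *)
Lemma ell_partE n P Q j Y Phi : L2w (winv b) P -> L2w (winv b) Q -> (j < n)%N ->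
  Wfam b n Y -> Wcirc b n Phi ->
  ell_part n P Q j Y Phi =
  elem_term n 0 j.+1 (fun x => 1 * P x + 'i * Q x) Y Phi +
  elem_term n j.+1 0 (fun x => 1 * P x + (- 'i) * Q x) Y Phi +
  \sum_(nu < j) elem_term n nu.+1 (j - nu) (Kmid P Q j nu) Y Phi.
Proof.
move=> Pb Qb jn YW PW.
rewrite elem_term_lin//; [|lia..].
rewrite elem_term_lin//; [|lia..].
have -> : \sum_(nu < j) elem_term n nu.+1 (j - nu) (Kmid P Q j nu) Y Phi =
  \sum_(nu < j) (('C(j.+1, nu.+1))%:R * elem_term n nu.+1 (j - nu) P Y Phi +
    'i * (('C(j, nu.+1))%:R - ('C(j, nu))%:R) * elem_term n nu.+1 (j - nu) Q Y Phi).
  apply: eq_bigr => nu _; have := ltn_ord nu => nuj.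
  by rewrite /Kmid elem_term_lin//; lia.
rewrite /ell_part big_ord_recl big_ord_recr /= bin0 /bump /= subnn binn subn0.
rewrite [X in 'i * (X - _)]big_ord_recl [X in 'i * (_ - X)]big_ord_recr /= bin0 binn subnn.
rewrite big_split /=.
have -> : \sum_(i < j) 'i * (('C(j, i.+1))%:R - ('C(j, i))%:R) *
     elem_term n i.+1 (j - i) Q Y Phi =
   'i * (\sum_(i < j) ('C(j, i.+1))%:R * elem_term n i.+1 (j - i) Q Y Phi -
         \sum_(i < j) ('C(j, i))%:R * elem_term n i.+1 (j - i) Q Y Phi).
  by rewrite -sumrB mulr_sumr; apply: eq_bigr => i _; ring.
under eq_bigr do rewrite add1n subSS.
under [X in 'i * (_ + X - _)]eq_bigr do rewrite /bump /= add1n subSS.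
rewrite !add1n !mul1r.
ring.
Qed.

Definition Kpart P Q j x t : C :=
  ((1 * P x + 'i * Q x) * ee j (x - t) +
   (-1) ^+ j.+1 * (ee j (x - t) * (1 * P t + (- 'i) * Q t))) +
  \sum_(nu < j) (-1) ^+ nu.+1 * cint `[t, x] (fun s =>
     ee nu (x - s) * Kmid P Q j nu s * ee (j - nu).-1 (s - t)).

Lemma rep_part n P Q j : L2w (winv b) P -> L2w (winv b) Q -> (j < n)%N ->
  rep b n (ell_part n P Q j) (Kpart P Q j).
Proof.
move=> Pb Qb jn.
have Lb (z1 z2 : C) : L2w (winv b) (fun x => z1 * P x + z2 * Q x).
  by apply: (L2wD wVb); exact: L2wZ.
have H := repD wb (repD wb (rep_left wb (Lb 1 'i) jn) (rep_right wb (Lb 1 (- 'i)) jn))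
  (rep_sum wb (index_enum 'I_j) (F := fun nu : 'I_j => elem_term n nu.+1 (j - nu) (Kmid P Q j nu))
     (K := fun (nu : 'I_j) x t => (-1) ^+ nu.+1 * cint `[t, x] (fun s =>
     ee nu (x - s) * Kmid P Q j nu s * ee (j - nu).-1 (s - t))) _).
apply: rep_ext (H _) _ _.
- move=> nu; have nuj := ltn_ord nu.
  have E : (j - nu = (j - nu).-1.+1)%N by lia.
  rewrite [X in elem_term n _ X]E.
  by apply: (rep_mid wb (Lb _ _)); lia.
- by move=> Y Phi YW PW; rewrite ell_partE.
- by [].
Qed.

Lemma Kfun_Kpart n (P Q : nat -> R -> C) x t :
  Kfun n P Q x t = \sum_(j < n) Kpart (P j.+1) (Q j) j x t.
Proof.
rewrite /Kfun big_add1 /= big_mkord; apply: eq_bigr => j _.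
rewrite subn1 /= -/(ee j (x - t)); congr (_ + _).
  by rewrite !mul1r; ring.
rewrite big_add1 /= big_mkord; apply: eq_bigr => nu _; congr (_ * _).
apply: eq_cint => s _; rewrite subn1 /= -/(ee nu (x - s)).
have -> : (j - nu.+1 = (j - nu).-1)%N by lia.
by [].
Qed.

Definition ell_rest n (P Q : nat -> R -> C) Y Phi : C :=
  \sum_(j < n) ell_part n (P j.+1) (Q j) j Y Phi.

Lemma rep_rest n (P Q : nat -> R -> C) :
  (forall j, (j < n)%N -> L2w (winv b) (P j.+1) /\ L2w (winv b) (Q j)) ->
  rep b n (ell_rest n P Q) (Kfun n P Q).
Proof.
move=> PQ.
have H := rep_sum wb (index_enum 'I_n) (F := fun j : 'I_n => ell_part n (P j.+1) (Q j) j)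
  (K := fun j : 'I_n => Kpart (P j.+1) (Q j) j) _.
refine (rep_ext (H n _) _ _) => [j|//|x t _ _ _]; last by rewrite Kfun_Kpart.
by have [] := PQ j (ltn_ord j) => Pj Qj; apply: rep_part.
Qed.

(** The term of p_0 stays outside the kernel: it will give the part b^2 y^(n) of B. *)
Lemma ell_restE n (p0 : R -> C) (p q : nat -> Distr R) (P Q : nat -> R -> C) Y Phi :
  primitives b n p q P Q -> Wfam b n Y -> Wcirc b n Phi ->
  ell n p0 p q Y Phi =
  (-1) ^+ n * (cint I01 (fun x => p0 x * (Phi n x * Y n x)) + ell_rest n P Q Y Phi).
Proof.
move=> PQ YW PW; rewrite /ell big_ord_recl mulrDr -addrA; congr (_ + _).
  rewrite diterE subn0 /pco /= /dmul /dfun; congr (_ * _); apply: eq_cint => x _.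
  by rewrite /leib /Defs.shift big_ord1 mul1r subn0 addn0.
rewrite /ell_rest mulr_sumr mulr_sumr -big_split; apply: eq_bigr => j _.
have jn := ltn_ord j.
have [Pj] := PQ j.+1 jn; rewrite subn1 /= => Qj.
rewrite /bump /= add1n /pco /= (ell_p _ Pj YW PW)//.
rewrite (ell_q1 jn Qj YW PW) (ell_q2 jn Qj YW PW) /ell_part.
ring.
Qed.

End EllRep.

(** * The Volterra equation *)

Section Volterra.
Variable R : realType.
Local Notation mu := (@lebesgue_measure R).
Local Notation C := R[i].
Variable b : R -> C.
Hypothesis wb : weight b.
Let wVb := weight_inv wb.
Variable K : R -> R -> C.
Hypothesis aK : adm b K.
Implicit Types (f g : R -> C) (x t : R).

(** Below a bound M of [g] the exponential is Lipschitz with constant e^M, by 1 + v <= e^v. *)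
Lemma rAC_expR (g : R -> R) : rAC g -> rAC (fun x => expR (g x)).
Proof.
move=> gA e e0; have [M gM] := rAC_bounded gA.
have E (u v : R) : u <= M -> v <= M -> `|expR u - expR v| <= expR M * `|u - v|.
  wlog uv : u v / v <= u.
    move=> H uM vM; have [/H|/ltW/H] := leP v u; first exact.
    by rewrite distrC [`|v - u|]distrC; apply.
  move=> uM vM; rewrite !ger0_norm ?subr_ge0 ?ler_expR//.
  have := expR_ge1Dx (v - u); rewrite expRB.
  have u0 := expR_gt0 u; rewrite -(ler_pM2r u0) divfK ?gt_eqF// => H.
  have K1 : expR u * (u - v) <= expR M * (u - v).
    by rewrite ler_wpM2r ?subr_ge0// ler_expR.
  apply: le_trans K1; lra.
have M0 : 0 < expR M := expR_gt0 M.
have e1 : 0 < e / expR M by rewrite divr_gt0.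
have [d d0 H] := gA _ e1; exists d => // m s t st sep sd.
have := H m s t st sep sd; rewrite ltr_pdivlMr// mulr_suml; apply: le_lt_trans.
apply: ler_sum => i _; rewrite mulrC; have [s0 [sti t1]] := st i.
apply: E; apply: le_trans (ler_norm _) _; apply: gM.
  by rewrite t1 (le_trans s0).
by rewrite s0 (le_trans sti).
Qed.

(* Exponential weights make the Volterra operator a contraction. *)
Lemma rJ_exp (g : R -> R) (l x : R) : 0 < l -> mu.-integrable I01 (EFin \o g) ->
  0 <= x <= 1 ->
  rJ (fun t => g t * expR (l * rJ g t)) x <= expR (l * rJ g x) / l.
Proof.
move=> l0 gi x01.
pose h y := expR (l * rJ g y).
have hA : rAC h by apply: rAC_expR; exact: (rACM (rAC_cst l) (rAC_rJ gi)).
have hb : mu.-integrable I01 (EFin \o (fun t => h t * g t)).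
  have [M hM] := rAC_bounded hA.
  apply: (@integrableMr _ _ R mu _ (@mI01 R) h (EFin \o g)) => //.
    exact: rAC_measurable.
  exists M; split => //; first exact: num_real.
  by move=> N MN y /I01E y01; apply: le_trans (hM _ y01) (ltW MN).
have hd : {ae mu, forall y : R, `]0%R, 1%R[%classic y -> is_derive y (1 : R) h (l * (h y * g y))}.
  apply: aeS (rJ_derive gi) => y H y01.
  have K1 := is_deriveZ l (H y01).
  have := @is_derive1_comp R expR (l \*: rJ g) y _ _ (is_derive_expR _) K1.
  by rewrite mulrCA.
have := rAC_ftc hA hd (integrable_RZ l (@mI01 R) hb) x01.
have -> : rJ (fun y => l * (h y * g y)) x = l * rJ (fun t => g t * expR (l * rJ g t)) x.
  rewrite /rJ RintZ//; first by congr (_ * _); apply: eq_Rintegral => y _; rewrite mulrC.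
  by apply: (@integrableS _ _ R mu I01) hb => //; [exact: mI01 | exact: I0x].
rewrite {1 2}/h rJ0 mulr0 expR0 => ->.
by rewrite mulrDl [l * _]mulrC mulfK ?gt_eqF// lerDr divr_ge0// ltW.
Qed.

(** Where [b] is nonzero, B f = g is the fixed-point equation f = g / b^2 + [Vop f]. *)
Definition Vop f x : C := - ((b x)^-1 ^+ 2 * KI K f x).

Lemma sqr_inv_L2w g : L2w (winv b) g -> L2w b (fun x => (b x)^-1 ^+ 2 * g x).
Proof.
move=> [mg gi]; have [mb _ _ b0] := wb.
apply: (L2w_le wb _ _ gi).
  by have mV := cmeasV mb; exact: (cmeasM (cmeasM mV mV) mg).
apply: aeS b0 => x H x01; rewrite /winv.
rewrite (_ : b x * _ = (b x)^-1 * g x); first exact: lexx.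
by field; exact: H.
Qed.

Lemma Vop_L2w f : L2w b f -> L2w b (Vop f).
Proof.
move=> fb; apply: (eq_L2w wb (f := fun x => (-1) * ((b x)^-1 ^+ 2 * KI K f x))).
  by move=> x _; rewrite mulN1r.
by apply: L2wZ => //; apply: sqr_inv_L2w; exact: KI_L2w.
Qed.

Lemma VopD f g x : L2w b f -> L2w b g -> 0 <= x <= 1 ->
  Vop (fun t => f t + g t) x = Vop f x + Vop g x.
Proof.
move=> fb gb x01; rewrite /Vop -opprD -mulrDr /KI -cintD//; try exact: (KI_cint wb).
by congr (- (_ * _)); apply: eq_cint => t _; rewrite mulrDr.
Qed.

Lemma VopN f x : L2w b f -> 0 <= x <= 1 -> Vop (fun t => - f t) x = - Vop f x.
Proof.
move=> fb x01.
have E : KI K (fun t => - f t) x = - KI K f x.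
  rewrite /KI -mulN1r -cintZ; [|by []|exact: (KI_cint wb aK fb x01)].
  by apply: eq_cint => t _; rewrite mulN1r mulrN.
by rewrite /Vop E mulrN.
Qed.

(** [Vop f x] involves [f] only through an integral: equality almost everywhere becomes equality at
    every point, and iterates can be estimated pointwise. *)
Lemma Vop_ae f g x : L2w b f -> L2w b g -> 0 <= x <= 1 ->
  {ae mu, forall x, I01 x -> f x = g x} -> Vop f x = Vop g x.
Proof.
move=> fb gb x01 fg; congr (- (_ * _)); apply: eq_cint_ae => //.
- by apply: cintegrable_cmeas; exact: (KI_cint wb).
- by apply: cintegrable_cmeas; exact: (KI_cint wb).
- by apply: aeS fg => t H t0x; rewrite H//; apply: (I0x x01).
Qed.

(** With G the sum of all |A_i| + |B_i|, [Vop f] at x is at most 2 |b|^-2 G(x) times the integral of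
    G |f|. If |f| <= M om, then G |f| <= M g2 exp(4 J g2), whose integral is at most M h / 4 by
    [rJ_exp]: the exponent 4 absorbs the factor 2 of complex integrals and leaves the ratio 1/2. For
    an arbitrary f in L_{2,b}, one application of [Vop] already yields a multiple of om as bound. *)
Lemma Vop_bound : exists om : R -> R,
  [/\ forall x, 0 <= om x, L2w b (fun x => (om x)%:C),
      forall f, L2w b f -> exists M : R, forall x, I01 x -> cabs (Vop f x) <= M * om x &
      forall f (M : R), L2w b f -> (forall x, I01 x -> cabs (f x) <= M * om x) ->
        forall x, I01 x -> cabs (Vop f x) <= M / 2 * om x].
Proof.
have [I [A [B [AB KE _]]]] := adm_sep wb aK.
have m01 : measurable (@I01 R) := @mI01 R.
pose G x := \sum_i (cabs (A i x) + cabs (B i x)).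
have G0 x : 0 <= G x by apply: sumr_ge0 => i _; rewrite addr_ge0 ?cabs_ge0.
have GL : L2w (winv b) (fun x => (G x)%:C).
  apply: (eq_L2w wVb (f := fun x => \sum_i ((cabs (A i x))%:C + (cabs (B i x))%:C))).
    by move=> x _; rewrite /G rmorph_sum; apply: eq_bigr => i _; rewrite rmorphD.
  by apply: (L2w_sum _ wVb) => i; have [Ai Bi] := AB i; apply: (L2wD wVb); exact: L2w_cabs.
have KG x t : 0 <= t -> t <= x -> x <= 1 -> cabs (K x t) <= G x * G t.
  move=> t0 tx x1; rewrite KE//; apply: le_trans (cabs_sum _ _ _) _.
  rewrite /G mulr_suml; apply: ler_sum => i _; rewrite cabsM.
  apply: ler_pM; rewrite ?cabs_ge0// ?lerDl ?cabs_ge0//.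
  rewrite (bigD1 i)//= -addrA addrCA lerDl addr_ge0 ?cabs_ge0// sumr_ge0// => j _.
  by rewrite addr_ge0 ?cabs_ge0.
pose g2 x := csq (winv b x * (G x)%:C).
have g2i : mu.-integrable I01 (EFin \o g2) by case: GL.
have g2E x : g2 x = cabs (b x)^-1 ^+ 2 * G x ^+ 2.
  by rewrite /g2 csqM !csqE cabs_real ger0_norm.
pose h x := expR (4 * rJ g2 x).
have hA : rAC h by apply: rAC_expR; exact: (rACM (rAC_cst 4) (rAC_rJ g2i)).
have h0 x : 0 <= h x by exact: expR_ge0.
have h1 x : 1 <= h x.
  rewrite /h -expR0 ler_expR mulr_ge0// Rintegral_ge0// => y _; exact: csq_ge0.
pose om x := cabs (b x)^-1 ^+ 2 * G x * h x.
have om0 x : 0 <= om x by rewrite /om !mulr_ge0 ?cabs_ge0 ?G0 ?h0.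
have omL : L2w b (fun x => (om x)%:C).
  have hb : bmeas (fun x => (h x)%:C).
    apply: AC_bmeas; apply/AC_ReIm; split => //=; exact: rAC_cst.
  have [mh [M hM]] := hb.
  have mb : cmeas I01 b by case: wb.
  have mG := L2w_cmeas GL.
  apply: (L2w_le wb _ _ (integrable_RZ (M ^+ 2) m01 g2i)).
    apply: cmeas_real; rewrite /om; apply: measurable_funM; last exact: rAC_measurable.
    apply: measurable_funM; last by case: mG.
    by apply: measurable_funX; apply: cmeas_cabs; exact: cmeasV.
  apply: aeI => x x01; rewrite csqM !csqE cabs_real ger0_norm ?om0//=.
  have hMx := hM x x01; rewrite cabs_real ger0_norm// in hMx.
  rewrite g2E /om !exprMn cabsV.
  (* At a zero of [b], the convention that 0 has inverse 0 makes both sides vanish. *)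
  have [bx|bx] := eqVneq (cabs (b x)) 0.
    by rewrite bx invr0 !expr0n /= !mul0r !mulr0.
  rewrite [X in X <= _](_ : _ = h x ^+ 2 * ((cabs (b x))^-1 ^+ 2 * G x ^+ 2)); last by field.
  apply: ler_wpM2r; first by apply: mulr_ge0; exact: sqr_ge0.
  by apply: lerXn2r => //; rewrite nnegrE ?h0// (le_trans (h0 x) hMx).
have GfI f : L2w b f -> mu.-integrable I01 (EFin \o (fun t => G t * cabs (f t))).
  move=> fb; have := integrable_cabs m01 (L2w_mul wb fb GL).
  by under [X in integrable _ _ (EFin \o X)]eq_fun do rewrite cabsM cabs_real (ger0_norm (G0 _)).
have VB f x (N : R) : L2w b f -> I01 x ->
    rJ (fun t => G t * cabs (f t)) x <= N ->
    cabs (Vop f x) <= cabs (b x)^-1 ^+ 2 * G x * (2 * N).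
  move=> fb /I01E x01 HN.
  have Gf := GfI f fb.
  have Gf' : mu.-integrable `[0%R, x] (EFin \o (fun t => G t * cabs (f t))).
    by apply: (@integrableS _ _ R mu I01) Gf => //; exact: I0x.
  rewrite /Vop cabsN cabsM expr2 cabsM -expr2 -mulrA ler_wpM2l ?sqr_ge0//.
  have Ki := KI_cint wb aK fb x01.
  apply: le_trans (cabs_cint _ Ki) _ => //.
  rewrite mulrCA ler_wpM2l//.
  apply: le_trans (_ : G x * rJ (fun t => G t * cabs (f t)) x <= _); last first.
    by rewrite ler_wpM2l.
  rewrite -RintZ//; apply: le_Rint => //.
  - exact: integrable_cabs.
  - exact: integrable_RZ.
  - move=> t /=; rewrite in_itv/= => /andP[t0 tx]; rewrite cabsM mulrA.
    by rewrite ler_wpM2r ?cabs_ge0// KG//; case/andP: x01.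
exists om; split => //.
- move=> f fb; pose N := rJ (fun t => G t * cabs (f t)) 1.
  have Gf := GfI f fb.
  have N0 : 0 <= N by apply: Rintegral_ge0 => t _; rewrite mulr_ge0 ?cabs_ge0.
  exists (2 * N) => x x01; apply: le_trans (VB f x N fb x01 _) _.
    have /I01E/andP[x0 x1] := x01.
    rewrite /N -subr_ge0 rJB//; apply: Rintegral_ge0 => t _; rewrite mulr_ge0 ?cabs_ge0//.
  rewrite mulrC ler_wpM2l ?mulr_ge0// /om.
  by rewrite -[leLHS]mulr1 ler_wpM2l// mulr_ge0 ?sqr_ge0.
- move=> f M fb fM x x01; have /I01E x01' := x01.
  (* A negative M forces [f] and [om] to vanish on [0, 1]; otherwise inequalities may be multiplied
     by M. *)
  have [Mn|M0] := ltP M 0.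
    have f0 t : I01 t -> f t = 0.
      move=> t01; apply/eqP; rewrite -cabs_eq0 eq_le cabs_ge0 andbT.
      by apply: le_trans (fM t t01) _; rewrite nmulr_rle0.
    have om00 t : I01 t -> om t = 0.
      move=> t01; have := fM t t01; rewrite f0// cabs0 nmulr_rge0// => H.
      by apply/eqP; rewrite eq_le H om0.
    rewrite om00// mulr0.
    have -> : Vop f x = 0.
      rewrite /Vop (_ : KI K f x = 0) ?mulr0 ?oppr0//.
      rewrite -[RHS](cint0 `[0%R, x]); apply: eq_cint => t tx.
      by rewrite f0 ?mulr0//; apply: (I0x x01').
    by rewrite cabs0.
  have gh : mu.-integrable I01 (EFin \o (fun t => g2 t * expR (4 * rJ g2 t))).
    have [N hN] := rAC_bounded hA.
    have := @integrableMr _ _ R mu _ m01 h (EFin \o g2) (rAC_measurable hA).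
    have bh : [bounded h t | t in I01].
      exists N; split => //; first exact: num_real.
      by move=> N' NN y /I01E y01; apply: le_trans (hN _ y01) (ltW NN).
    move=> /(_ bh g2i).
    apply: (@eq_integrable _ _ R mu _ m01) => t _; by rewrite /= mulrC.
  have Gf := GfI f fb.
  have := VB f x (M * (h x / 4)) fb x01; rewrite (_ : _ * (2 * _) = M / 2 * om x); last first.
    by rewrite /om; field.
  apply; apply: le_trans (_ : M * rJ (fun t => g2 t * expR (4 * rJ g2 t)) x <= _); last first.
    by rewrite ler_wpM2l// rJ_exp.
  have S (k : R -> R) : mu.-integrable I01 (EFin \o k) -> mu.-integrable `[0%R, x] (EFin \o k).
    by apply: (@integrableS _ _ R mu I01) => //; exact: I0x.
  rewrite /rJ -RintZ//; last exact: S.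
  apply: le_Rint => //; [exact: S|by apply: integrable_RZ => //; exact: S|].
  move=> t /(I0x x01') t01.
  have := ler_wpM2l (G0 t) (fM t t01) => /le_trans; apply.
  rewrite g2E /om /h le_eqVlt; apply/orP; left; apply/eqP; ring.
Qed.

End Volterra.

(** * Bijectivity of B by a Neumann series *)

Section Neumann.
Variable R : realType.
Local Notation mu := (@lebesgue_measure R).
Local Notation C := R[i].
Implicit Types (f g : R -> C) (x t : R).

Lemma geo_le0 (c D : R) : (forall m, c <= D / 2 ^+ m) -> c <= 0.
Proof.
move=> H; rewrite leNgt; apply/negP => c0.
have D0 : 0 <= D by have := H 0%N; rewrite expr0 divr1; apply: le_trans; exact: ltW.
pose m := Num.bound (D / c).
have := archi_boundP (divr_ge0 D0 (ltW c0)); rewrite -/m ltr_pdivrMr// => Dm.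
have := H m; rewrite ler_pdivlMr ?exprn_gt0// leNgt => /negP; apply.
apply: lt_le_trans Dm _; rewrite mulrC ler_pM2l// -natrX ler_nat ltnW//.
exact: ltn_expl.
Qed.

Lemma halfX (M : R) m : M / 2 ^+ m.+1 = M / 2 ^+ m / 2.
Proof. by rewrite exprS invfM mulrA mulrAC. Qed.

(** The intervals with centre [u m] and radius 2D / 2^m are nested, since the next radius is D /
    2^m; L is the supremum of their left ends. The explicit formula lets the limit be taken at each
    point x. *)
Lemma geo_sup (u : nat -> R) (D : R) : (forall m, `|u m.+1 - u m| <= D / 2 ^+ m) ->
  let L := sup [set u m - 2 * D / 2 ^+ m | m in setT] in
  forall m, `|L - u m| <= 2 * D / 2 ^+ m.
Proof.
move=> H L.
have D0 : 0 <= D by have := H 0%N; rewrite expr0 divr1; apply: le_trans.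
pose v m := u m - 2 * D / 2 ^+ m; pose w m := u m + 2 * D / 2 ^+ m.
have E m : 2 * D / 2 ^+ m.+1 = D / 2 ^+ m.
  by rewrite exprS invfM mulrA [2 * D]mulrC mulfK.
have E2 m : 2 * D / 2 ^+ m = 2 * (D / 2 ^+ m) by rewrite mulrA.
have vS m : v m <= v m.+1.
  rewrite /v E E2; have := H m; rewrite ler_norml => /andP[]; set z := D / _; lra.
have wS m : w m.+1 <= w m.
  rewrite /w E E2; have := H m; rewrite ler_norml => /andP[]; set z := D / _; lra.
have vw m : v m <= w m.
  rewrite /v /w E2; have : 0 <= D / 2 ^+ m by rewrite divr_ge0// exprn_ge0.
  set z := D / _; lra.
have vmono k m : (k <= m)%N -> v k <= v m.
  move=> km; rewrite -(subnK km); elim: (m - k)%N => [//|j IH].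
  by rewrite addSn (le_trans IH).
have wmono k m : (k <= m)%N -> w m <= w k.
  move=> km; rewrite -(subnK km); elim: (m - k)%N => [//|j IH].
  by rewrite addSn (le_trans _ IH).
have vwk k m : v k <= w m.
  have [km|/ltnW mk] := leqP k m; first exact: le_trans (vmono _ _ km) (vw m).
  exact: le_trans (vw k) (wmono _ _ mk).
move=> m; have L1 : v m <= L.
  apply: ub_le_sup; last by exists m.
  by exists (w 0%N) => _ [k _ <-]; exact: vwk.
have L2 : L <= w m.
  by apply: ge_sup; [exists (v 0%N); exists 0%N | move=> _ [k _ <-]; exact: vwk].
rewrite ler_norml; move: L1 L2; rewrite /v /w; set z := 2 * D / _; lra.
Qed.

Variable b : R -> C.
Hypothesis wb : weight b.
Let wVb := weight_inv wb.
Variable K : R -> R -> C.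
Hypothesis aK : adm b K.

Lemma sqr_mul_L2w f : L2w b f -> L2w (winv b) (fun x => b x ^+ 2 * f x).
Proof.
move=> fb.
have wi : L2w (winv (winv b)) f by rewrite winvK.
by apply: (eq_L2w wVb _ (sqr_inv_L2w wVb wi)) => x _; rewrite /winv invrK.
Qed.

Lemma Bop_L2w f : L2w b f -> L2w (winv b) (Bop b K f).
Proof.
move=> fb; apply: (L2wD wVb); first exact: sqr_mul_L2w.
exact: (KI_L2w wb aK fb).
Qed.

(** The difference h satisfies h = V h almost everywhere, hence V h = V (V h) at every point of
    [0, 1]. There V h is bounded by a multiple of om, and each application of V halves the bound, so
    V h = 0. *)
Lemma volterra_inj f g : L2w b f -> L2w b g ->
  {ae mu, forall x, I01 x -> Bop b K f x = Bop b K g x} ->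
  {ae mu, forall x, I01 x -> f x = g x}.
Proof.
move=> fb gb fg; have [_ _ _ b0] := wb.
have [om [om0 omL B1 B2]] := Vop_bound wb aK.
pose h x := f x + - g x.
have Ngb : L2w b (fun x => - g x).
  by apply: (eq_L2w wb (f := fun x => (-1) * g x)) => [x _|]; [rewrite mulN1r|exact: L2wZ].
have hb : L2w b h by exact: (L2wD wb).
have Vhb : L2w b (Vop b K h) by exact: Vop_L2w.
have hV : {ae mu, forall x, I01 x -> h x = Vop b K h x}.
  apply: aeS2 b0 fg => x b0 fg x01; have {}b0 := b0 x01; have {}fg := fg x01.
  have x01' := (I01E _).1 x01.
  rewrite /h (VopD wb aK fb Ngb x01') (VopN wb aK gb x01') /Vop.
  move: fg; rewrite /Bop -/(KI K f x) -/(KI K g x) => fg.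
  have -> : f x = (b x)^-1 ^+ 2 * (b x ^+ 2 * f x + KI K f x - KI K f x).
    by field.
  by rewrite fg; field.
have VV x : I01 x -> Vop b K h x = Vop b K (Vop b K h) x.
  by move=> /I01E x01; exact: (Vop_ae wb aK hb Vhb x01 hV).
have [M HM] := B1 h hb.
have P m x : I01 x -> cabs (Vop b K h x) <= M / 2 ^+ m * om x.
  elim: m x => [|m IH] x x01; first by rewrite expr0 divr1 HM.
  rewrite VV// halfX; exact: B2.
have V0 x : I01 x -> Vop b K h x = 0.
  move=> x01; apply/eqP; rewrite -cabs_eq0 eq_le cabs_ge0 andbT.
  by apply: (@geo_le0 _ (M * om x)) => m; rewrite mulrAC P.
apply: aeS hV => x H x01; have := H x01; rewrite V0// => /eqP.
by rewrite /h subr_eq0 => /eqP.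
Qed.

(** Picard iteration from f_0 = g / b^2: successive differences are bounded by M om / 2^m at every
    point of [0, 1]. The pointwise limit is measurable, lies in L_{2,b} because it is within 4 M om
    of f_0, and solves the equation because the residual is at most 4 M om / 2^m for every m. *)
Lemma volterra_surj g : L2w (winv b) g -> exists2 f, L2w b f &
  {ae mu, forall x, I01 x -> Bop b K f x = g x}.
Proof.
move=> gb; have [_ _ _ b0] := wb.
have [om [om0 omL B1 B2]] := Vop_bound wb aK.
pose f0 x := (b x)^-1 ^+ 2 * g x.
have f0b : L2w b f0 by exact: sqr_inv_L2w.
pose S := fix S m := if m is m'.+1 then (fun x => f0 x + Vop b K (S m') x) else f0.
have Sb m : L2w b (S m).
  by elim: m => [//|m IH]; apply: (L2wD wb) => //; exact: Vop_L2w.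
have Nb f : L2w b f -> L2w b (fun x => - f x).
  move=> fb.
  by apply: (eq_L2w wb (f := fun x => (-1) * f x)) => [x _|]; [rewrite mulN1r|exact: L2wZ].
have VB f h x : L2w b f -> L2w b h -> I01 x ->
    Vop b K f x - Vop b K h x = Vop b K (fun t => f t + - h t) x.
  by move=> fb hb /I01E x01; rewrite (VopD wb aK fb (Nb _ hb) x01) (VopN wb aK hb x01).
have [M HM] := B1 f0 f0b.
have Sd m x : I01 x -> cabs (S m.+1 x - S m x) <= M / 2 ^+ m * om x.
  elim: m x => [|m IH] x x01.
    by rewrite expr0 divr1 /= addrC addKr HM.
  rewrite [S m.+2 x]/= [S m.+1 x]/= opprD addrACA subrr add0r.
  rewrite [Vop b K _ x - _](VB (S m.+1) (S m))//.
  by rewrite halfX; apply: B2 => //; apply: (L2wD wb) => //; exact: Nb.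
pose lim (u : nat -> R) (D : R) := sup [set u m - 2 * D / 2 ^+ m | m in setT].
pose fr x := lim (fun m => complex.Re (S m x)) (M * om x).
pose fi x := lim (fun m => complex.Im (S m x)) (M * om x).
have frS m x : I01 x -> `|fr x - complex.Re (S m x)| <= 2 * (M * om x) / 2 ^+ m.
  move=> x01; apply: geo_sup => k.
  by rewrite -cReN -cReD (le_trans (cabs_Re _))// mulrAC Sd.
have fiS m x : I01 x -> `|fi x - complex.Im (S m x)| <= 2 * (M * om x) / 2 ^+ m.
  move=> x01; apply: geo_sup => k.
  by rewrite -cImN -cImD (le_trans (cabs_Im _))// mulrAC Sd.
pose f x : C := Complex (fr x) (fi x).
have fS m x : I01 x -> cabs (f x - S m x) <= 4 * M / 2 ^+ m * om x.
  move=> x01; apply: le_trans (cabs_le _) _.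
  rewrite !(cReD, cReN, cImD, cImN) /=.
  have := frS m x x01; have := fiS m x x01.
  have -> : 4 * M / 2 ^+ m * om x = 2 * (M * om x) / 2 ^+ m + 2 * (M * om x) / 2 ^+ m.
    by set z := (2 ^+ m)^-1; ring.
  by move=> H1 H2; apply: lerD.
have cvg_geo (u : nat -> R) (l D : R) :
    (forall m, `|l - u m| <= D / 2 ^+ m) -> u m @[m --> \oo] --> l.
  move=> H.
  have H2 m : l - D * 2^-1 ^+ m <= u m <= l + D * 2^-1 ^+ m.
    have := H m; rewrite ler_norml exprVn => /andP[]; set z := D / _ => *.
    by apply/andP; split; lra.
  have geo0 : D * 2^-1 ^+ m @[m --> \oo] --> (0 : R).
    rewrite -[X in _ --> X](mulr0 D); apply: cvgMr; apply: cvg_expr.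
    by rewrite ger0_norm// invf_lt1// ltr1n.
  apply: (@squeeze_cvgr _ _ _ _ (fun m => l - D * 2^-1 ^+ m) (fun m => l + D * 2^-1 ^+ m)).
  - by near=> m; exact: H2.
  - by rewrite -[X in _ --> X]subr0; apply: cvgB => //; exact: cvg_cst.
  - by rewrite -[X in _ --> X]addr0; apply: cvgD => //; exact: cvg_cst.
have mf : cmeas I01 f.
  split => /=.
    apply: (measurable_fun_cvg (fun m => (L2w_cmeas (Sb m)).1)) => x x01.
    by apply: (cvg_geo _ _ (2 * (M * om x))) => m; exact: frS.
  apply: (measurable_fun_cvg (fun m => (L2w_cmeas (Sb m)).2)) => x x01.
  by apply: (cvg_geo _ _ (2 * (M * om x))) => m; exact: fiS.
have fb : L2w b f.
  pose F x : C := (cabs (f0 x))%:C + (4 * M)%:C * (om x)%:C.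
  have [mF Fi] : L2w b F by apply: (L2wD wb); [exact: L2w_cabs | exact: L2wZ].
  apply: (L2w_le wb mf _ Fi); apply: aeI => x x01.
  rewrite !csqM ler_wpM2l ?csq_ge0// !csqE.
  have fF : cabs (f x) <= cabs (f0 x) + 4 * M * om x.
    have -> : f x = f0 x + (f x - S 0%N x) by rewrite /= addrC subrK.
    apply: le_trans (cabsD _ _) _; rewrite lerD2l.
    by have := fS 0%N x x01; rewrite expr0 divr1.
  have -> : cabs (F x) = cabs (f0 x) + 4 * M * om x.
    rewrite /F -rmorphM -rmorphD cabs_real ger0_norm//.
    exact: le_trans (cabs_ge0 _) fF.
  by apply: lerXn2r => //; rewrite nnegrE ?cabs_ge0// (le_trans (cabs_ge0 _) fF).
exists f => //.
have fE x : I01 x -> f0 x + Vop b K f x - f x = 0.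
  move=> x01; apply/eqP; rewrite -cabs_eq0 eq_le cabs_ge0 andbT.
  apply: (@geo_le0 _ (4 * M * om x)) => m.
  have -> : f0 x + Vop b K f x - f x =
     (Vop b K f x - Vop b K (S m) x) + (- (f x - S m.+1 x)) by rewrite /=; ring.
  apply: le_trans (cabsD _ _) _; rewrite cabsN VB//.
  have H1 : cabs (Vop b K (fun t => f t + - S m t) x) <= 4 * M / 2 ^+ m / 2 * om x.
    apply: B2; [|exact: fS|exact: x01].
    exact: (L2wD wb fb (Nb _ (Sb m))).
  have H2 := fS m.+1 x x01.
  apply: le_trans (lerD H1 H2) _.
  rewrite exprS invfM; set z := (2 ^+ m)^-1.
  by rewrite le_eqVlt; apply/orP; left; apply/eqP; field.
(* The fixed-point equation holds on all of [0, 1]; the return to B multiplies by b^2 and takes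
   place where [b] is nonzero. *)
apply: aeS b0 => x H x01; have {}H := H x01.
have := fE x x01 => /eqP; rewrite subr_eq0 => /eqP fx.
rewrite /Bop -/(KI K f x) -fx /f0 /Vop; by field.
Unshelve. all: by end_near. Qed.

End Neumann.

(** * Independence of the primitives *)

Section Independence.
Variable R : realType.
Local Notation mu := (@lebesgue_measure R).
Local Notation C := R[i].
Local Notation ACf := (@Defs.AC R 0 1).
Implicit Types (f g : R -> C) (x t s : R).

(** The Vandermonde matrix of distinct nodes is invertible: on polynomials of degree at most n,
    evaluation at w is a combination of the evaluations at n + 1 nodes. *)
Lemma moments n (z : 'I_n.+1 -> R) (w : R) : injective z ->
  exists c : 'I_n.+1 -> R, forall m, (m < n.+1)%N -> \sum_i c i * z i ^+ m = w ^+ m.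
Proof.
move=> zI; pose V := Vandermonde n.+1 (\row_i z i).
have Vu : V \in unitmx.
  rewrite unitmxE det_Vandermonde unitfE; apply/prodf_neq0 => i _.
  apply/prodf_neq0 => j ij; rewrite !mxE subr_eq0.
  by apply: contraTneq ij => /zI ->; rewrite ltnn.
pose c := invmx V *m (\col_(m < n.+1) w ^+ m).
exists (fun i => c i 0) => m mn.
have : (V *m c) (Ordinal mn) 0 = w ^+ m by rewrite mulKVmx// !mxE.
by rewrite mxE => <-; apply: eq_bigr => i _; rewrite !mxE mulrC.
Qed.

(** Null sets can be discarded for countably many cut points only; continuity fills the gaps between
    the rational ones. *)
Lemma rat_AC_const g (c : C) : ACf g ->
  (forall q : rat, 0 < (ratr q : R) < 1 -> g (ratr q) = c) ->
  forall y, 0 <= y <= 1 -> g y = c.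
Proof.
move=> gA gq y /andP[y0 y1]; apply/eqP; rewrite -subr_eq0 -cabs_eq0 eq_le cabs_ge0 andbT.
apply/ler_addgt0Pl => e e0; rewrite addr0; apply: ltW.
have [d d0 H] := gA e e0.
have mm : Num.max 0 (y - d) < Num.min 1 (y + d).
  by rewrite gt_max !lt_min; apply/andP; split; apply/andP; split; lra.
have [q] := rat_in_itvoo mm.
rewrite in_itv/= gt_max lt_min => /andP[/andP[q0 qd] /andP[q1 qd']].
rewrite -(gq q) ?q0//.
have [qy|/ltW yq] := leP (ratr q : R) y.
- have := H 1%N (fun=> ratr q) (fun=> y); rewrite !big_ord1; apply.
  + by move=> _; rewrite ltW.
  + by move=> i j; rewrite !ord1 eqxx.
  + lra.
- have := H 1%N (fun=> y) (fun=> ratr q); rewrite !big_ord1 -cabsN opprB; apply.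
  + by move=> _; rewrite (ltW q1).
  + by move=> i j; rewrite !ord1 eqxx.
  + lra.
Qed.

(** Integrals over [0, s] become integrals over the fixed interval [0, 1]; with [f] constant 1 this
    is the step function used for testing. *)
Definition cutoff s f t : C := if t <= s then f t else 0.

Lemma cutoff_patch (f : R -> R) s : 0 <= s <= 1 ->
  {in I01, (fun t => if t <= s then f t else 0) =1 f \_ `[0%R, s]}.
Proof.
move=> s01 t; rewrite inE => /I01E/andP[t0 t1]; rewrite patchE.
case: ifPn => ts; first by rewrite mem_set// /= in_itv/= t0 ts.
by rewrite memNset// /= in_itv/= (negbTE ts) andbF.
Qed.

Lemma I01_cut s : 0 <= s <= 1 -> @I01 R `&` `[0%R, s]%classic = `[0%R, s]%classic.
Proof. by move=> s01; apply: setIidr; exact: I0x. Qed.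

Lemma cint_cutoff s f : 0 <= s <= 1 -> cint I01 (cutoff s f) = cint `[0%R, s] f.
Proof.
move=> s01; rewrite -(I01_cut s01); apply: eq_ReIm; rewrite ?Re_cint ?Im_cint Rintegral_mkcondr;
  apply: eq_Rintegral => t t01; rewrite -(cutoff_patch _ s01 t01) /cutoff; by case: ifP.
Qed.

Lemma cutoff_int s f : 0 <= s <= 1 -> cintegrable `[0%R, s] f -> cintegrable I01 (cutoff s f).
Proof.
move=> s01 [a b].
have H (h : R -> R) : mu.-integrable `[0%R, s] (EFin \o h) ->
    mu.-integrable I01 (EFin \o (fun t => if t <= s then h t else 0)).
  move=> hi.
  have := (@integrable_restrict _ _ R mu `[0%R, s] _ I01 _ (EFin \o h)).1.
  rewrite I01_cut// => /(_ (measurable_itv _) (@mI01 R) hi).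
  apply: (@eq_integrable _ _ R mu _ (@mI01 R)) => t t01.
  by rewrite restrict_EFin /= (cutoff_patch _ s01 t01).
split.
  have := H _ a; apply: (@eq_integrable _ _ R mu _ (@mI01 R)) => t _ /=.
  by rewrite /cutoff; case: ifP.
have := H _ b; apply: (@eq_integrable _ _ R mu _ (@mI01 R)) => t _ /=.
by rewrite /cutoff; case: ifP.
Qed.

Lemma cutoff_bmeas s : bmeas (cutoff s (fun=> 1)).
Proof.
split.
  have H : measurable_fun I01 (fun t : R => if t <= s then 1 else 0 : R).
    apply: measurable_funTS; apply: measurable_fun_ifT => //.
    by apply: measurable_fun_ler; [exact: measurable_id | exact: measurable_cst].
  apply: (@eq_cmeas _ _ (fun t => ((if t <= s then 1 else 0 : R))%:C)).
    by move=> t _; rewrite /cutoff; case: ifP.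
  exact: cmeas_real.
exists 1 => t _; rewrite /cutoff; case: ifP => _; last by rewrite cabs0.
by rewrite -[1]/(1%:C) cabs_real normr1.
Qed.

Lemma cint_mul_cutoff s g : 0 <= s <= 1 -> cint I01 (fun t => g t * cutoff s (fun=> 1) t) = J g s.
Proof.
move=> s01; rewrite /J -(cint_cutoff g s01); apply: eq_cint => t _; rewrite /cutoff.
by case: ifP => _; rewrite ?mulr1 ?mulr0.
Qed.

(** Cauchy's formula at the endpoint 1 integrates the divided power of 1 - t over [0, s]. This is
    why 1 - s, and not s, enters the moment problem. *)
Lemma iterJ_cutoff m s : 0 <= s <= 1 ->
  iter m.+1 (@J R) (cutoff s (fun=> 1)) 1 = ee m.+1 1 - ee m.+1 (1 - s) :> C.
Proof.
move=> s01; have /andP[s0 s1] := s01.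
have ei : cintegrable I01 (fun t => ee m (1 - t) : C).
  by apply: bmeas_cintegrable; exact: bmeas_eeB.
rewrite iterJE; [|by apply: bmeas_cintegrable; exact: cutoff_bmeas|by rewrite ler01 lexx].
rewrite [LHS](cint_mul_cutoff (fun t => ee m (1 - t)) s01).
have H1 := cint_ee m s0 s1 (lexx (1 : R)).
have H0 := cint_ee m (lexx (0 : R)) ler01 (lexx (1 : R)).
rewrite cint_tx// in H1; rewrite subr0 in H0.
by rewrite -H0 -H1 opprB addrC -/(J _ _) subrK.
Qed.

Variable b : R -> C.
Hypothesis wb : weight b.
Let wVb := weight_inv wb.

(** The function with n-th derivative [f] and zero data at 0, listed with its derivatives. *)
Definition prim n f j := iter (n - j) (@J R) f.

Lemma prim_Wfam n f : L2w b f -> Wfam b n (prim n f).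
Proof.
move=> fb; have fi := L2w_cint wb fb; split; last by rewrite /prim subnn.
move=> nu nun; rewrite /prim -(subnSK nun) iterS.
have ji := iterJ_cint (n - nu.+1) fi.
by split; [exact: J_AC | exact: J_deriv].
Qed.

Lemma prim0 n f nu : (nu < n)%N -> prim n f nu 0 = 0.
Proof. by move=> nun; rewrite /prim -(subnSK nun) iterS J0. Qed.

Lemma prim_n n f : prim n f n = f.
Proof. by rewrite /prim subnn. Qed.

(* A step function can be corrected on any initial interval so that its moments
   of order [< n] vanish, i.e. so that it is an [n]-th derivative of an element
   of [Wcirc]. *)
Lemma test_step n (r s : R) : 0 < r < 1 -> 0 <= s <= 1 ->
  exists (c z : 'I_n.+1 -> R),
    (forall i, 0 <= z i <= r) /\
    Wcirc b n (prim n (fun t => cutoff s (fun=> 1) t +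
      \sum_i (- (c i)%:C) * cutoff (z i) (fun=> 1) t)).
Proof.
move=> /andP[r0 r1] s01.
(* Equally spaced nodes below r, one for each of the powers 0, ..., n. *)
pose z (i : 'I_n.+1) : R := r * (i%:R / n.+1%:R).
have n0 : 0 < n.+1%:R :> R by rewrite ltr0n.
have zr i : 0 <= z i <= r.
  rewrite /z mulr_ge0 ?divr_ge0// ?(ltW r0)//=.
  by rewrite -[leRHS]mulr1 ler_wpM2l ?(ltW r0)// ler_pdivrMr// mul1r ler_nat ltnW.
have z01 i : 0 <= z i <= 1.
  by have /andP[-> /= zi] := zr i; rewrite (le_trans zi)// ltW.
have zI : injective (fun i => 1 - z i).
  move=> i j /addrI /oppr_inj /(mulfI (lt0r_neq0 r0)) H; apply: val_inj; apply/eqP.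
  rewrite -(eqr_nat R); apply/eqP; apply: (mulIf _ H).
  by rewrite invr_eq0 gt_eqF.
have [c Hc] := moments (1 - s) zI.
exists c, z; split => //.
set psi := (X in prim n X).
have ci i : cintegrable I01 (fun t => (- (c i)%:C) * cutoff (z i) (fun=> 1) t).
  apply: cintegrableZ; first exact: mI01.
  by apply: bmeas_cintegrable; exact: cutoff_bmeas.
have si : cintegrable I01 (cutoff s (fun=> 1)).
  by apply: bmeas_cintegrable; exact: cutoff_bmeas.
have psib : L2w b psi.
  apply: (L2wD wb); first by apply: L2w_bmeas => //; exact: cutoff_bmeas.
  apply: (L2w_sum _ wb) => i; apply: L2wZ => //.
  by apply: L2w_bmeas => //; exact: cutoff_bmeas.
split; first exact: prim_Wfam.
move=> nu nun; split; first exact: prim0.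
have i1 : 0 <= (1 : R) <= 1 by rewrite ler01 lexx.
rewrite /prim -(subnSK nun); set m := (n - nu.+1)%N.
have mn : (m.+1 < n.+1)%N by rewrite /m; lia.
rewrite iterJD//; last by apply: cintegrable_sum => //; exact: mI01.
rewrite iterJ_cutoff// iterJ_sum//.
have -> : \sum_i iter m.+1 (@J R) (fun t => (- (c i)%:C) * cutoff (z i) (fun=> 1) t) 1 =
    \sum_i (- (c i)%:C) * (ee m.+1 1 - ee m.+1 (1 - z i)).
  apply: eq_bigr => i _; rewrite iterJZ ?iterJ_cutoff//.
  by apply: bmeas_cintegrable; exact: cutoff_bmeas.
(* Order 0 cancels the constant [ee m.+1 1], and order m + 1 <= n the part that depends on the cut
   points. *)
have E1 := Hc 0%N (ltn0Sn n); have E2 := Hc m.+1 mn.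
rewrite /ee -rmorphB.
have -> : \sum_i - (c i)%:C *
      ((1 ^+ m.+1 / rfact R m.+1)%:C - ((1 - z i) ^+ m.+1 / rfact R m.+1)%:C) =
    (- ((\sum_i c i * (1 - z i) ^+ 0) * (1 ^+ m.+1 / rfact R m.+1) -
        (\sum_i c i * (1 - z i) ^+ m.+1) / rfact R m.+1))%:C.
  rewrite !mulr_suml -sumrB -sumrN rmorph_sum; apply: eq_bigr => i _.
  by rewrite -rmorphB -rmorphN -rmorphM; congr (_%:C); rewrite expr0; ring.
by rewrite E1 E2 -rmorphD expr0 mul1r subrr.
Qed.

(** The passage from H to D: for x outside one null set, the integrals of D(x, .) over (q, x] vanish
    for all rational q in (0, 1). So the primitive of D(x, .), extended by zero beyond x, is
    constant, and D(x, .) = 0 almost everywhere. *)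
Lemma kernel_zero n D : adm b D ->
  (forall Y Phi, Wfam b n Y -> (forall nu, (nu < n)%N -> Y nu 0 = 0) -> Wcirc b n Phi ->
     cint I01 (fun x => KI D (Y n) x * Phi n x) = 0) ->
  {ae mu, forall x, I01 x -> {ae mu, forall t, `[0%R, x]%classic t -> D x t = 0}}.
Proof.
move=> aD H.
pose f r t : C := 1 + (-1) * cutoff r (fun=> 1) t.
have fb r : L2w b (f r).
  apply: L2w_bmeas => //; apply: bmeasD; first exact: bmeas_cst.
  by apply: bmeasM; [exact: bmeas_cst | exact: cutoff_bmeas].
have f0 r t : t <= r -> f r t = 0 by move=> tr; rewrite /f /cutoff tr mulr1 subrr.
have step r : 0 < r < 1 -> {ae mu, forall x, I01 x -> KI D (f r) x = 0}.
  move=> r01; have /andP[r0 r1] := r01.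
  have KL := KI_L2w wb aD (fb r); have KIi := L2w_cint wVb KL.
  apply: J_zero => // s s01.
  have [c [z [zr PW]]] := test_step n r01 s01.
  have := H _ _ (prim_Wfam n (fb r)) (fun nu => @prim0 n (f r) nu) PW.
  rewrite !prim_n => HH.
  have K0 x : 0 <= x <= r -> KI D (f r) x = 0.
    move=> /andP[x0 xr]; rewrite -[RHS](cint0 `[0%R, x]); apply: eq_cint => t /=.
    by rewrite in_itv/= => /andP[t0 tx]; rewrite f0 ?mulr0// (le_trans tx).
  have z01 i : 0 <= z i <= 1.
    by have /andP[-> /= zi] := zr i; rewrite (le_trans zi)// ltW.
  have Jz i : J (KI D (f r)) (z i) = 0.
    rewrite /J -[RHS](cint0 `[0%R, z i]); apply: eq_cint => t /=.
    rewrite in_itv/= => /andP[t0 tz]; apply: K0; rewrite t0 (le_trans tz)//.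
    by have /andP[] := zr i.
  have cut_int q : cintegrable I01 (fun t => KI D (f r) t * cutoff q (fun=> 1) t).
    apply: (L2w_mul wb _ KL); apply: L2w_bmeas => //; exact: cutoff_bmeas.
  have m01 : measurable (@I01 R) := @mI01 R.
  rewrite -HH -cint_mul_cutoff//.
  transitivity (cint I01 (fun t => KI D (f r) t * cutoff s (fun=> 1) t) +
     \sum_i (- (c i)%:C) * cint I01 (fun t => KI D (f r) t * cutoff (z i) (fun=> 1) t)).
    rewrite big1 ?addr0// => i _; rewrite cint_mul_cutoff//.
    by rewrite Jz mulr0.
  have -> : \sum_i (- (c i)%:C) * cint I01 (fun t => KI D (f r) t * cutoff (z i) (fun=> 1) t)
    = cint I01 (fun t => \sum_i (- (c i)%:C) * (KI D (f r) t * cutoff (z i) (fun=> 1) t)).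
    rewrite cint_sum; [|exact: m01|by move=> i; exact: cintegrableZ].
    by apply: eq_bigr => i _; rewrite cintZ.
  rewrite -cintD; [|exact: m01|exact: cut_int|]; last first.
    by apply: cintegrable_sum => // i; exact: cintegrableZ.
  apply: eq_cint => t _; rewrite mulrDr mulr_sumr; congr (_ + _).
  by apply: eq_bigr => i _; rewrite mulrCA.
(* Quantifying over codes of rationals arranges the countably many null sets in a sequence. *)
have all : {ae mu, forall x : R, forall k : nat, I01 x ->
    forall q : rat, choice.unpickle k = Some q -> 0 < (ratr q : R) < 1 -> KI D (f (ratr q)) x = 0}.
  apply: (@ae_foralln _ _ R mu) => k.
  have [[q qk]|nq] := pselect (exists q : rat, choice.unpickle k = Some q /\ 0 < (ratr q : R) < 1).
    have [qE q01] := qk.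
    by apply: aeS (step _ q01) => x Hx x01 q' ; rewrite qE => -[<-] _; exact: Hx.
  by apply: aeI => x _ q qE q01; case: nq; exists q.
apply: aeS all => x Hx x01; have x01' := (I01E _).1 x01.
have bc (h : R -> C) : bmeas h -> L2w b h by move=> hb; exact: L2w_bmeas.
have Dxi : cintegrable `[0%R, x] (fun t => D x t).
  have := KI_cint wb aD (bc _ (bmeas_cst 1)) x01'.
  by apply: eq_cintegrable => // t _; rewrite mulr1.
pose d := cutoff x (fun t => D x t).
have di : cintegrable I01 d by exact: cutoff_int.
have Jq (q : rat) : 0 < (ratr q : R) < 1 -> J d (ratr q) = J d 1.
  move=> q01; have /andP[q0 q1] := q01.
  have q01' : 0 <= (ratr q : R) <= 1 by rewrite !ltW.
  have := Hx (choice.pickle q) x01 q (choice.pickleK q) q01.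
  rewrite /KI -cint_cutoff//.
  have -> : cint I01 (cutoff x (fun t => D x t * f (ratr q) t)) =
     cint I01 (fun t => d t + (-1) * (d t * cutoff (ratr q) (fun=> 1) t)).
    apply: eq_cint => t _.
    transitivity (if t <= x then D x t * (1 + (-1) * cutoff (ratr q) (fun=> 1) t) else 0 : C).
      by [].
    by set k := cutoff (ratr q) _ t; rewrite /d /cutoff; case: (t <= x); ring.
  have cdi : cintegrable I01 (fun t => d t * cutoff (ratr q) (fun=> 1) t).
    by under eq_fun do rewrite mulrC; apply: bmeas_cint => //; exact: cutoff_bmeas.
  rewrite cintD; [|exact: mI01|exact: di|by apply: cintegrableZ => //; exact: mI01].
  rewrite cintZ; [|exact: mI01|exact: cdi].
  rewrite cint_mul_cutoff// mulN1r => /eqP; rewrite subr_eq0 => /eqP <-.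
  by [].
have Jc := rat_AC_const (J_AC di) Jq.
have J1 : J d 1 = 0 by rewrite -(Jc 0) ?J0// lexx ler01.
have := J_zero di (fun y y01 => etrans (Jc y y01) J1).
apply: aeS => t Ht tx; have := Ht (I0x x01' tx).
by move: tx; rewrite /= in_itv/= /d /cutoff => /andP[_ ->].
Qed.

End Independence.

(** * Comparison of two choices of primitives, and the representation of ell by B and C *)

Section Main.
Variable R : realType.
Local Notation mu := (@lebesgue_measure R).
Local Notation C := R[i].
Variables (n : nat) (p0 b : R -> C) (p q : nat -> Distr R).
Hypothesis wb : weight b.
Hypothesis bp : {ae mu, forall x, I01 x -> b x ^+ 2 = p0 x}.
Hypothesis mp0 : cmeas I01 p0.
Implicit Types P Q : nat -> R -> C.

Lemma primitives_rep P Q : primitives b n p q P Q ->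
  rep b n (ell_rest n P Q) (Kfun n P Q).
Proof.
move=> PQ; apply: (rep_rest wb) => j jn.
by have := PQ j.+1 jn; rewrite subn1 /= => -[[Pj _] [Qj _]].
Qed.

(** Both sides are obtained from [ell], which does not mention the primitives. *)
Lemma ell_rest_indep P Q P' Q' Y Phi :
  primitives b n p q P Q -> primitives b n p q P' Q' ->
  Wfam b n Y -> Wcirc b n Phi -> ell_rest n P Q Y Phi = ell_rest n P' Q' Y Phi.
Proof.
move=> PQ PQ' YW PW; have := ell_restE wb p0 PQ YW PW.
rewrite (ell_restE wb p0 PQ' YW PW) => /(mulfI _) H.
by apply/esym; apply: addrI; apply: H; rewrite expf_neq0// oppr_eq0 oner_eq0.
Qed.

Lemma Kfun_indep P Q P' Q' :
  primitives b n p q P Q -> primitives b n p q P' Q' ->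
  {ae mu, forall x, I01 x -> {ae mu, forall t, `[0%R, x]%classic t ->
     Kfun n P Q x t = Kfun n P' Q' x t}}.
Proof.
move=> PQ PQ'.
have [aD [u [ub FE]]] := repD wb (primitives_rep PQ) (repZ wb (-1) (primitives_rep PQ')).
have := kernel_zero wb aD (n := n) _.
move=> H; apply: aeS (H _) => [x Hx x01|Y Phi YW Y0 PW].
  apply: aeS (Hx x01) => t Ht xt; have := Ht xt.
  by rewrite mulN1r => /eqP; rewrite subr_eq0 => /eqP.
(* The difference of the two functionals is zero, and its C part drops out because [Y] has zero data
   at 0; the kernel part is left. *)
have := FE Y Phi YW PW; rewrite (ell_rest_indep PQ PQ' YW PW) mulN1r subrr => ->.
apply: eq_cint => x _; rewrite /Cop big1 ?addr0// => i _.
by rewrite Y0// mul0r.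
Qed.

(** The term of p_0 is an integral, so p_0 may be replaced by b^2, which agrees with it almost
    everywhere; it then joins the kernel part to form B. *)
Lemma ell_BC P Q K u Y Phi : adm b K ->
  primitives b n p q P Q -> (forall nu, L2w (winv b) (u nu)) ->
  ell_rest n P Q Y Phi = cint I01 (fun x => (KI K (Y n) x + Cop n u Y x) * Phi n x) ->
  Wfam b n Y -> Wcirc b n Phi ->
  ell n p0 p q Y Phi =
  (-1) ^+ n * cint I01 (fun x => (Bop b K (Y n) x + Cop n u Y x) * Phi n x).
Proof.
move=> aK PQ ub E YW PW; rewrite (ell_restE wb p0 PQ YW PW) E; congr (_ * _).
have Yn : L2w b (Y n) by case: YW.
have Pn : L2w b (Phi n) by case: PW => -[].
have bY := sqr_mul_L2w wb Yn.
have bYP := L2w_mul wb Pn bY.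
have -> : cint I01 (fun x => p0 x * (Phi n x * Y n x)) =
    cint I01 (fun x => b x ^+ 2 * Y n x * Phi n x).
  apply: eq_cint_ae; first exact: mI01.
  - by apply: cmeasM => //; apply: cmeasM; exact: (L2w_cmeas (b := b)).
  - exact: cintegrable_cmeas.
  - apply: aeS bp => x H /H <-; ring.
rewrite -cintD; [|exact: mI01|exact: bYP|].
  by apply: eq_cint => x _; rewrite /Bop -/(KI K (Y n) x) -mulrDl addrA.
apply: (L2w_mul wb Pn); apply: (L2wD (weight_inv wb)); first exact: (KI_L2w wb).
exact: (Cop_L2w wb).
Qed.

End Main.
Theorem theorem4 (R : realType) (n : nat) (p0 b : R -> R[i])
    (p q : nat -> Distr R) :
  cintegrable I01 p0 ->
  cintegrable I01 (fun x => (p0 x)^-1) ->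
  {ae @lebesgue_measure R, forall x, I01 x -> p0 x != 0} ->
  cmeas I01 b ->
  {ae @lebesgue_measure R, forall x, I01 x -> b x ^+ 2 = p0 x} ->
  (forall k, (1 <= k <= n)%N -> exists sigma, Wneg b k (p k) sigma) ->
  (forall nu, (nu < n)%N -> exists sigma, Wneg b nu (q nu) sigma) ->
  (* K does not depend on the choice of the primitives *)
  (forall P Q P' Q', primitives b n p q P Q -> primitives b n p q P' Q' ->
     {ae @lebesgue_measure R, forall x, I01 x ->
       {ae @lebesgue_measure R, forall t, `[0%R, x]%classic t ->
          Kfun n P Q x t = Kfun n P' Q' x t}})
  /\
  (forall P Q, primitives b n p q P Q ->
   exists (a : R -> R) (u : nat -> R -> R[i]),
     [/\ L2w (winv b) (fun x => (a x)%:C),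
         (forall x t, 0 <= t -> t <= x -> x <= 1 ->
            cabs (Kfun n P Q x t) <= a x + a t),
         (forall nu, (nu < n)%N -> L2w (winv b) (u nu)),
         (* B maps L_{2,b} bijectively onto L_{2,1/b} *)
         [/\ forall f, L2w b f -> L2w (winv b) (Bop b (Kfun n P Q) f),
             forall f g, L2w b f -> L2w b g ->
               {ae @lebesgue_measure R, forall x, I01 x ->
                  Bop b (Kfun n P Q) f x = Bop b (Kfun n P Q) g x} ->
               {ae @lebesgue_measure R, forall x, I01 x -> f x = g x} &
             forall g, L2w (winv b) g -> exists2 f, L2w b f &
               {ae @lebesgue_measure R, forall x, I01 x ->
                  Bop b (Kfun n P Q) f x = g x}] &
         (* ell_{2n} y = (B y^(n) + C y)^(n) *)
         forall Y Phi, Wfam b n Y -> Wcirc b n Phi ->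
           ell n p0 p q Y Phi =
           (-1) ^+ n * cint I01 (fun x =>
             (Bop b (Kfun n P Q) (Y n) x + Cop n u Y x) * Phi n x)]).
Proof.
move=> p0i Vp0i p0n mb bp _ _.
have wb := weight_of_sqr p0i Vp0i p0n mb bp.
have mp0 := cintegrable_cmeas p0i.
split=> [P Q P' Q' PQ PQ'|P Q PQ]; first exact: (@Kfun_indep R n p0 b p q).
have [aK [u [ub FE]]] := primitives_rep wb PQ.
have [_ [a [ai Ka]]] := aK.
exists a, u; split => //.
- split.
  + by move=> f; exact: (Bop_L2w wb aK).
  + by move=> f g; exact: (volterra_inj wb aK).
  + by move=> g; exact: (volterra_surj wb aK).
- move=> Y Phi YW PW; apply: (ell_BC wb bp mp0 aK PQ ub _ YW PW).
  exact: FE.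
Qed.
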